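(* For all $m\geq 1$ we have $\exists qAC^0_m\subseteq\tilde{\Sigma}^{\mathit{plog}}_m$ and $\forall qAC^0_m\subseteq\tilde{\Sigma}^{\mathit{plog}}_{m+1}$; that is, every Boolean query computed by a circuit family in $\exists qAC^0_m$ (respectively $\forall qAC^0_m$) belongs to $\tilde{\Sigma}^{\mathit{plog}}_m$ (respectively $\tilde{\Sigma}^{\mathit{plog}}_{m+1}$).
   Context: **Circuits.** A circuit is a connected acyclic digraph with arbitrarily many input nodes and exactly one output node; gates have types $\mathrm{AND}$ ($\wedge$), $\mathrm{OR}$ ($\vee$), $\mathrm{NOT}$ ($\neg$), or $x$ (input gate). Edges are directed from inputs towards the output; gate $g$ is a child of gate $h$ if the output of $h$ is an input to $g$. For a family $\mathcal{C}$ of circuits (one for each input length $n$), $\mathrm{DCL}(\mathcal{C})$ is the set of tuples $(h,t,g,z_n)$, with $z_n$ an arbitrary binary string of length $n$, such that (in the circuit for input length $n$) the gate with number $h$ is of type $t$ and, if $t\in\{\vee,\wedge,\neg\}$, the gate with number $g$ is a child of $h$; if $t=x$, then $h$ is an input gate corresponding to bit $g$ of the input. The inputs are binary encodings $\mathrm{bin}(\mathcal{A})$, of length $n$, of finite ordered relational structures $\mathcal{A}$ (the concatenation of the characteristic bit strings of the relations and the binary representations of the constants). **$qAC^0$.** The class of families $\mathcal{C}$ of Boolean circuits of unbounded fan-in, size $2^{(\log n)^{O(1)}}$ and depth $O(1)$ that are $\mathrm{DTIME}[(\log n)^{O(1)}]$ $\mathrm{DCL}$-uniform, i.e. $\mathrm{DCL}(\mathcal{C})$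 is decidable by a deterministic random-access Turing machine in time $(\log n)^{O(1)}$. **$qAC^0_m$, $\exists qAC^0_m$, $\forall qAC^0_m$.** For $m\geq 1$, $qAC^0_m$ is the subclass of $qAC^0$ of families in which the path from an input gate to the output gate with the maximum number of alternated gates of unbounded fan-in of type $\mathrm{AND}$ and $\mathrm{OR}$ has $m$ such gates. The circuits are assumed to have this form: $\mathrm{NOT}$ gates occur only immediately after input gates; then comes a region consisting only of $\mathrm{AND}$ and $\mathrm{OR}$ gates of fan-in $2$ with arbitrary layout; then come $m$ layers of unbounded fan-in gates, all gates in one layer being of the same type, consecutive layers alternating between $\mathrm{AND}$ and $\mathrm{OR}$, and the inputs to a gate in a layer always being outputs of gates in the previous layer. $\exists qAC^0_m$ (respectively $\forall qAC^0_m$) is the subclass of $qAC^0_m$ in which the output gate is of type $\mathrm{OR}$ (respectively $\mathrm{AND}$). **Machines.** A random-access Turing machine is a multi-tape Turing machine with (1) a read-only random-access input of length $n+1$ ($n$ input bits followed by an endmark $\triangleleft$ in cell $n+1$), (2) a fixed number of read-write working tapes, and (3) a read-write address-tape of length $\lceil\log_2 n\rceil$ over $\{0,1\}$. In each step the binary number on the address-tape determines the input cell that is read; if this number exceeds $n$, the endmark is read. In a random-access alternating Turing machine the state set is partitioned into existential and universal states; a configuration is accepting iff it is in a final accepting state, or it is in an existential state and some next configuration is accepting, or it is in a universal state, there is a next configuration, and all next configurations are accepting. **Complexity classes.** $\tilde{\Sigma}^{\mathit{plog}}_m$ is the union over $k\in\mathbb{N}$ of the classes of languages accepted by random-access alternating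 Turing machines that start in an existential state, make at most $O((\lceil\log_2 n\rceil)^k)$ steps before accepting an input of length $n$, and use at most $m$ alternating blocks of existential and universal states (so $\tilde{\Sigma}^{\mathit{plog}}_1$ is non-deterministic polylogarithmic time). *)

(* Defs.v *)
From HB Require Import structures.
From mathcomp Require Import all_boot.

Set Implicit Arguments.
Unset Strict Implicit.
Unset Printing Implicit Defensive.

Definition eventually (P : nat -> Prop) : Prop :=
  exists n0, forall n, n0 <= n -> P n.

Definition clog (n : nat) : nat := up_log 2 n.

(* Binary numbers are written most significant bit first. *)
Definition fixed_bits (w n : nat) : seq bool :=
  [seq odd (n %/ 2 ^ (w - i.+1)) | i <- iota 0 w].

(* No leading zeros, except that 0 is written as the one-bit string 0. *)
Definition bits (n : nat) : seq bool := fixed_bits (trunc_log 2 n).+1 n.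

Definition bits_val (s : seq bool) : nat :=
  foldl (fun (v : nat) (b : bool) => v.*2 + b) 0 s.

(* A language is a property of nonempty bit strings, since log n only makes
   sense for n > 0 and there is no circuit without inputs: its value on the
   empty string is irrelevant everywhere below. *)
Definition language := seq bool -> Prop.

Inductive move := GoLeft | Stay | GoRight.

Definition move_code (d : move) : option bool :=
  match d with GoLeft => Some false | Stay => None | GoRight => Some true end.
Definition move_decode (o : option bool) : move :=
  match o with Some false => GoLeft | None => Stay | Some true => GoRight end.
Lemma move_codeK : cancel move_code move_decode. Proof. by case. Qed.
HB.instance Definition _ := Countable.copy move (can_type move_codeK).
HB.instance Definition _ : isFinite move := CanIsFinite move_codeK.

Definition shift (d : move) (p : nat) : nat :=
  match d with GoLeft => p.-1 | Stay => p | GoRight => p.+1 end.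

(* New state, bit written on the address-tape and move of its head, symbols
   written on the k working tapes and moves of their heads. *)
Definition action (Q S : finType) (k : nat) : finType :=
  (Q * bool * move * {ffun 'I_k -> S} * {ffun 'I_k -> move})%type.

(* In rm_delta, the symbol read on the input is None for the endmark, and the
   symbol read on the address-tape is None when its head has left the tape. *)
Record ratm := RATM {
  rm_state : finType;
  rm_symbol : finType;
  rm_blank : rm_symbol;
  rm_tapes : nat;
  rm_start : rm_state;
  rm_final : pred rm_state;
  rm_universal : pred rm_state;
  rm_delta : rm_state -> option bool -> option bool ->
             {ffun 'I_rm_tapes -> rm_symbol} ->
             {set action rm_state rm_symbol rm_tapes}
}.

Definition deterministic (M : ratm) : Prop :=
  forall (q : rm_state M) (i a : option bool)
         (w : {ffun 'I_(rm_tapes M) -> rm_symbol M}),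
    #|rm_delta q i a w| <= 1.

(* Working tapes are infinite to the right. *)
Record config (M : ratm) := Config {
  cf_state : rm_state M;
  cf_addr : seq bool;
  cf_apos : nat;
  cf_tape : 'I_(rm_tapes M) -> nat -> rm_symbol M;
  cf_pos : 'I_(rm_tapes M) -> nat
}.

Definition init (M : ratm) (x : seq bool) : config M :=
  Config (rm_start M) (nseq (clog (size x)) false) 0
         (fun _ _ => rm_blank M) (fun _ => 0).

Section Run.

Variables (M : ratm) (x : seq bool).
Implicit Types c : config M.

(* Input cells are numbered from 0, so that the addresses of clog n bits reach
   all n input bits (and possibly not the endmark, when n is a power of 2). *)
Definition scan_input c : option bool := onth x (bits_val (cf_addr c)).

Definition scan_addr c : option bool := onth (cf_addr c) (cf_apos c).

Definition scan_tapes c : {ffun 'I_(rm_tapes M) -> rm_symbol M} :=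
  [ffun j => cf_tape c j (cf_pos c j)].

(* The address-tape keeps its length: off the tape nothing is written, and its
   head cannot go further right than one position past the last cell. *)
Definition perform (a : action (rm_state M) (rm_symbol M) (rm_tapes M)) c
    : config M :=
  let: (q, b, d, ws, ds) := a in
  let L := size (cf_addr c) in
  Config q
    (if cf_apos c < L then set_nth false (cf_addr c) (cf_apos c) b
     else cf_addr c)
    (minn (shift d (cf_apos c)) L)
    (fun j p => if p == cf_pos c j then ws j else cf_tape c j p)
    (fun j => shift (ds j) (cf_pos c j)).

Definition final c : bool := rm_final (cf_state c).

Definition universal c : bool := rm_universal (cf_state c).

Definition next c c' : Prop :=
  ~~ final c /\
  exists2 a, a \in rm_delta (cf_state c) (scan_input c) (scan_addr c)
                     (scan_tapes c)
           & c' = perform a c.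

Inductive accepting : config M -> Prop :=
| AccFinal c : final c -> accepting c
| AccExists c c' :
    ~~ universal c -> next c c' -> accepting c' -> accepting c
| AccForall c :
    universal c -> (exists c', next c c') ->
    (forall c', next c c' -> accepting c') -> accepting c.

Fixpoint accepting_within (t : nat) c : Prop :=
  final c \/
  if t is t'.+1 then
    if universal c then
      (exists c', next c c') /\
      (forall c', next c c' -> accepting_within t' c')
    else exists2 c', next c c' & accepting_within t' c'
  else False.

(* run s b c: some computation leads from the initial configuration to c in s
   steps and consists of b maximal blocks of existential or universal states *)
Inductive run : nat -> nat -> config M -> Prop :=
| RunInit : run 0 1 (init M x)
| RunStep s b c c' :
    run s b c -> next c c' ->
    run s.+1 (b + (universal c != universal c')) c'.

Definition halted c : Prop := forall c', ~ next c c'.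

End Run.

Definition decides (M : ratm) (L : language) : Prop :=
  deterministic M /\
  forall x, 0 < size x ->
    exists s b (c : config M), run x s b c /\ halted x c /\ (L x <-> final c).

Definition runs_in_time (M : ratm) (T : nat -> nat) : Prop :=
  eventually (fun n => forall x s b (c : config M),
    size x = n -> run x s b c -> s <= T n).

(* DTIME[(log n)^O(1)] *)
Definition DPolylogTime (L : language) : Prop :=
  exists (M : ratm) (k : nat),
    decides M L /\ runs_in_time M (fun n => clog n ^ k).

Definition SigmaPlog (m : nat) (L : language) : Prop :=
  exists M : ratm,
  [/\ ~~ rm_universal (rm_start M),
      forall x, 0 < size x -> (L x <-> accepting x (init M x)),
      exists k c : nat, eventually (fun n => forall x, size x = n -> L x ->
        accepting_within x (c * clog n ^ k) (init M x))
    & forall x s b (c : config M), 0 < size x -> run x s b c -> b <= m].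

Inductive gate_type := AND | OR | NOT | IN.

Definition dual (t : gate_type) : gate_type :=
  match t with AND => OR | OR => AND | _ => t end.

(* edge a b: the output of a is an input to b, i.e. a is a child of b.
   bitno a is only meaningful for input gates. *)
Record circuit := Circuit {
  gate : finType;
  gateno : gate -> nat;
  gtype : gate -> gate_type;
  bitno : gate -> nat;
  edge : rel gate;
  output : gate
}.

Definition children (C : circuit) (a : gate C) : {set gate C} :=
  [set b | edge b a].

(* As usual for direct connection languages, the output gate has number 0. *)
Definition wf_circuit (n : nat) (C : circuit) : Prop :=
  [/\ injective (@gateno C) /\ gateno (output C) = 0,
      forall a b : gate C, edge a b -> ~~ connect (@edge C) b a,
      forall a b : gate C, connect [rel u v | edge u v || edge v u] a b,
      forall a : gate C, (forall b, ~~ edge a b) <-> a = output C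
    & forall a : gate C,
        match gtype a return Prop with
        | IN => children a = set0 /\ bitno a < n
        | NOT => #|children a| = 1
        | AND | OR => 0 < #|children a|
        end].

Definition valuation (C : circuit) (x : seq bool) (v : gate C -> bool) : Prop :=
  forall a, v a = match gtype a with
                  | IN => nth false x (bitno a)
                  | NOT => [exists b in children a, ~~ v b]
                  | AND => [forall b in children a, v b]
                  | OR => [exists b in children a, v b]
                  end.

(* A well-formed circuit is acyclic, hence has exactly one valuation. *)
Definition outputs1 (C : circuit) (x : seq bool) : Prop :=
  exists2 v : gate C -> bool, valuation x v & v (output C).

Definition depth_le (C : circuit) (d : nat) : Prop :=
  forall (a : gate C) (p : seq (gate C)), path (@edge C) a p -> size p <= d.

(* C n is the circuit for input length n; C 0 is irrelevant. *)
Definition family := nat -> circuit.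

Definition DCL (C : family) (h : nat) (t : gate_type) (g : nat)
    (z : seq bool) : Prop :=
  exists a : gate (C (size z)),
    [/\ gateno a = h, gtype a = t
      & match t with
        | IN => bitno a = g
        | _ => exists2 b, b \in children a & gateno b = g
        end].

Definition self_delimiting (s : seq bool) : seq bool :=
  rcons (flatten [seq [:: true; b] | b <- s]) false.

Definition type_code (t : gate_type) : seq bool :=
  match t with
  | AND => [:: false; false]
  | OR => [:: false; true]
  | NOT => [:: true; false]
  | IN => [:: true; true]
  end.

Definition encode_tuple (h : nat) (t : gate_type) (g : nat) (z : seq bool)
    : seq bool :=
  self_delimiting (bits h) ++ type_code t ++ self_delimiting (bits g) ++ z.

Definition DCL_language (C : family) : language :=
  fun w => exists h t g z,
    [/\ 0 < size z, w = encode_tuple h t g z & DCL C h t g z].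

(* Size 2^(log n)^O(1) also bounds the gate numbers, i.e. these are binary
   strings of length (log n)^O(1), but they need not be consecutive. *)
Definition qAC0 (C : family) : Prop :=
  [/\ forall n, 0 < n -> wf_circuit n (C n),
      exists k, eventually (fun n =>
        #|gate (C n)| <= 2 ^ (clog n ^ k) /\
        forall a : gate (C n), gateno a < 2 ^ (clog n ^ k)),
      exists d, forall n, 0 < n -> depth_le (C n) d
    & DPolylogTime (DCL_language C)].

(* layer a = 0 for input and NOT gates and for the region of fan-in 2 gates;
   the layers of unbounded fan-in gates are numbered from 1 to m, towards the
   output, and layer i consists of gates of type ty i. *)
Definition layered (m : nat) (C : circuit) : Prop :=
  exists (layer : gate C -> nat) (ty : nat -> gate_type),
  [/\ layer (output C) = m,
      forall i, 0 < i <= m -> ty i = AND \/ ty i = OR,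
      forall i, 0 < i < m -> ty i.+1 = dual (ty i),
      forall a b, edge b a -> layer b = (layer a).-1
    & forall a,
        if layer a is 0 then
          match gtype a return Prop with
          | IN => True
          | NOT => forall b, edge b a -> gtype b = IN
          | AND | OR => #|children a| = 2
          end
        else layer a <= m /\ gtype a = ty (layer a)].

Definition qAC0m (m : nat) (C : family) : Prop :=
  qAC0 C /\ forall n, 0 < n -> layered m (C n).

Definition computes (C : family) (L : language) : Prop :=
  forall x, 0 < size x -> (L x <-> outputs1 (C (size x)) x).

Definition ExistsqAC0 (m : nat) (L : language) : Prop :=
  exists2 C : family,
    qAC0m m C /\ (forall n, 0 < n -> gtype (output (C n)) = OR)
  & computes C L.

Definition ForallqAC0 (m : nat) (L : language) : Prop :=
  exists2 C : family,
    qAC0m m C /\ (forall n, 0 < n -> gtype (output (C n)) = AND)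
  & computes C L.

Record vocabulary := Vocabulary { arities : seq nat; constants : nat }.

Definition arity (V : vocabulary) (i : 'I_(size (arities V))) : nat :=
  nth 0 (arities V) i.

(* The universe of an ordered structure is an initial segment of the natural
   numbers; the order itself is fixed and is not part of the vocabulary. *)
Record structure (V : vocabulary) := Structure {
  dom : nat;
  dom_gt0 : 0 < dom;
  relation : forall i : 'I_(size (arities V)), {set (arity i).-tuple 'I_dom};
  constant : 'I_(constants V) -> 'I_dom
}.

Fixpoint lex_tuples (N r : nat) : seq (r.-tuple 'I_N) :=
  if r is r'.+1 then
    [seq cons_tuple a t | a <- enum 'I_N, t <- lex_tuples N r']
  else [:: [tuple]].

Definition bin (V : vocabulary) (A : structure V) : seq bool :=
  flatten [seq [seq t \in relation A i | t <- lex_tuples (dom A) (arity i)]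
          | i <- enum 'I_(size (arities V))] ++
  flatten [seq fixed_bits (clog (dom A)) (constant A j)
          | j <- enum 'I_(constants V)].

Definition query (V : vocabulary) := structure V -> Prop.

Definition query_in (V : vocabulary) (K : language -> Prop) (q : query V)
    : Prop :=
  exists2 L : language, K L & forall A, q A <-> L (bin A).

(* Main.v *)
(* A gate above the fan-in 2 region is evaluated by a game with one block per
   layer: in an existential (universal) block the machine guesses the number of a
   child of the current OR (AND) gate. In the last block it also guesses a
   certificate for the value of the gate of fan-in 2 that was reached; since the
   depth is bounded, a certificate names boundedly many gates. Every guess is
   checked at once, by simulating the machine D that decides the DCL language on
   the query followed by the input x: any string of length n may play the role
   of z_n. A guess that fails makes its player lose, so the checks cost no block.

   D reads the string w = P ++ x, where P encodes the query and lies on a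
   working tape. The symbol of w at address i is found by decrementing i once for
   each symbol of P, and then, if i is not used up, reading x at what remains of
   i. The length log |w| of the address tape of D is the first e such that w has
   no symbol at address 2 ^ e. *)

Require Import Defs.
From mathcomp Require Import all_boot zify.
From Stdlib Require Import FunctionalExtensionality Classical.

Set Implicit Arguments.
Unset Strict Implicit.
Unset Printing Implicit Defensive.

(** * Alternating machines as structured programs *)

(** The obstacle is to reason about subroutines that run in blocks of both kinds without doing
    everything twice. Acceptance is replaced by the claim of the player to move, which is
    existential in either kind of block, and a fragment is described by what each surviving play
    must satisfy and by which exits a play may reach. A deterministic fragment has a single exit,
    for which both hold.

    The block bound concerns every run, so the state carries a saturating block counter. Between m
    layers the player changes m - 1 times; for an AND output the obligatory existential start is an
    empty block, which is the extra one.

    Membership has to be exact for all nonempty inputs, while the bounds on gate numbers and on the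
    time of [D] hold only from some length on. Hence an additive constant in the length of the
    guesses, and a time analysis with the step count of [D] as a parameter, which is instantiated
    twice.

    A DCL query only shows that one gate is a child of another, never that all children have been
    seen. This is enough in the layers, where one child decides the move, and in the region of
    fan-in 2, where two distinct children are all of them. *)

Section Fragments.

Variables (I S : finType) (blank : S) (nb : nat).

Definition tape := ((nat -> S) * nat)%type.

Record store := Store { adr : seq bool; apo : nat; tps : I -> tape }.

Record reads := Reads {
  rin : option bool; rad : option bool; rtp : I -> S }.

(* None stands for rewriting the symbol that was read. *)
Record act := Act {
  aw : option bool; am : move; tw : I -> option S * move }.

Definition scan (T : tape) : S := T.1 T.2.

Definition stept (a : option S * move) (T : tape) : tape :=
  (if a.1 is Some s then fun p => if p == T.2 then s else T.1 p else T.1,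
   shift a.2 T.2).

Definition look x (s : store) : reads :=
  Reads (onth x (bits_val (adr s))) (onth (adr s) (apo s))
        (fun i => scan (tps s i)).

Definition perf (a : act) (s : store) : store :=
  Store (if aw a is Some b then
           if apo s < size (adr s) then set_nth false (adr s) (apo s) b
           else adr s
         else adr s)
        (minn (shift (am a) (apo s)) (size (adr s)))
        (fun i => stept (tw a i) (tps s i)).

Definition noop : act := Act None Stay (fun=> (None, Stay)).

Definition wf (s : store) := apo s <= size (adr s).

Lemma wf_perf a s : wf (perf a s).
Proof.
rewrite /wf /=; case: (aw a) => [b|]; last exact: geq_minr.
case: ltnP => h; last exact: geq_minr.
by rewrite size_set_nth (maxn_idPr h) geq_minr.
Qed.

(** Every action clamps the address head to the tape. This is the only effect of [noop], and
    well-formedness makes it void. *)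
Lemma perf_noop s : wf s -> perf noop s = s.
Proof.
case: s => a p T; rewrite /wf /perf /= => h; congr Store; first exact/minn_idPl.
by apply: functional_extensionality => i; rewrite /stept /=; case: (T i).
Qed.

(* A fragment has one entry fe and one exit, written None. In a state s with
   fh s = Some b the whole machine halts, and accepts iff b. The boolean
   returned by fd tells whether the step starts the next block. *)
Record frag := Frag {
  fs : finType;
  fe : fs;
  fh : fs -> option bool;
  fd : fs -> reads -> act * bool * seq (option fs)
}.

Definition Do (g : reads -> act) : frag :=
  @Frag unit tt (fun=> None) (fun _ r => (g r, false, [:: None])).

Definition Tick : frag :=
  @Frag unit tt (fun=> None) (fun _ r => (noop, true, [:: None])).

Definition Halt (b : bool) : frag :=
  @Frag unit tt (fun=> Some b) (fun _ r => (noop, false, [::])).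

(** The exit of [p] is redirected to the entry of [q], so sequencing costs no step and times simply
    add. *)
Definition Seq (p q : frag) : frag :=
  @Frag (fs p + fs q)%type (inl (fe p))
    (fun s => match s with inl s => fh s | inr s => fh s end)
    (fun s r => match s with
     | inl s => let: (a, k, l) := fd s r in
        (a, k, [seq Some (if o is Some s' then inl s' else inr (fe q)) | o <- l])
     | inr s => let: (a, k, l) := fd s r in
        (a, k, [seq omap inr o | o <- l])
     end).

(** The test yields the list of permitted branches: a singleton gives an ordinary conditional, both
    values give a guess. One construction and one pair of rules thus cover both. *)
Definition Cond (g : reads -> seq bool) (p q : frag) : frag :=
  @Frag (option (fs p + fs q))%type None
    (fun s => match s with
     | None => None | Some (inl s) => fh s | Some (inr s) => fh s end)
    (fun s r => match s with
     | None => (noop, false,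
         [seq Some (Some (if b : bool then inl (fe p) else inr (fe q)))
         | b <- g r])
     | Some (inl s) => let: (a, k, l) := fd s r in
        (a, k, [seq omap (Some \o inl) o | o <- l])
     | Some (inr s) => let: (a, k, l) := fd s r in
        (a, k, [seq omap (Some \o inr) o | o <- l])
     end).

Definition While (g : reads -> bool) (p : frag) : frag :=
  @Frag (option (fs p)) None
    (fun s => if s is Some s then fh s else None)
    (fun s r => match s with
     | None => (noop, false, [:: if g r then Some (Some (fe p)) else None])
     | Some s => let: (a, k, l) := fd s r in
        (a, k, [seq Some o | o <- l])
     end).

Definition If (g : reads -> bool) := Cond (fun r => [:: g r]).

Definition Branch := Cond (fun=> [:: true; false]).

Definition Skip := Do (fun=> noop).

(** The counter saturates, which bounds the number of blocks on every run; its parity is the kind of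
    the block. *)
Definition tick (i : 'I_nb.+1) (k : bool) : 'I_nb.+1 :=
  if k then inord (minn i.+1 nb) else i.

Definition enc_act (i : 'I_nb.+1) (Q : finType) (ad : option bool)
    (w : {ffun 'I_#|I| -> S}) (a : act) (k : bool) (o : Q) :
    action ('I_nb.+1 * Q)%type S #|I| :=
  ((tick i k, o), odflt (odflt false ad) (aw a), am a,
   [ffun j => odflt (w j) (tw a (enum_val j)).1],
   [ffun j => (tw a (enum_val j)).2]).

(** A rejecting halt is a non-final state without successors, and such a state fails to accept in
    blocks of either kind. The exit [None] of the whole program behaves in the same way. *)
Definition mk (f : frag) : ratm :=
  @RATM ('I_nb.+1 * option (fs f))%type S blank #|I| (ord0, Some (fe f))
    (fun q => if q.2 is Some s then fh s == Some true else false)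
    (fun q => odd q.1)
    (fun q i ad w => if q.2 is Some s then
       let: (a, k, l) := fd s (Reads i ad (fun j => w (enum_rank j))) in
       if fh s is None then
         [set c in [seq enc_act q.1 ad w a k o | o <- l]] else set0
     else set0).

Definition cfg (f : frag) (i : 'I_nb.+1) (o : option (fs f)) (s : store)
  : config (mk f) :=
  @Config (mk f) (i, o) (adr s) (apo s) (fun j => (tps s (enum_val j)).1)
    (fun j => (tps s (enum_val j)).2).

Variable x : seq bool.

(** A machine always writes, whereas an action may leave a cell alone. [enc_act] writes back the
    symbol read, and so machine steps become steps on stores. *)
Lemma next_cfg f i s (sg : store) c' :
  Defs.next x (@cfg f i (Some s) sg) c' <->
  fh s = None /\
  let: (a, k, l) := fd s (look x sg) in
  exists2 o, o \in l & c' = cfg (tick i k) o (perf a sg).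
Proof.
have Er : Reads (onth x (bits_val (adr sg))) (onth (adr sg) (apo sg))
            (fun j => scan_tapes (@cfg f i (Some s) sg) (enum_rank j))
        = look x sg.
  congr Reads; apply: functional_extensionality => j.
  by rewrite ffunE /= enum_rankK.
have Ep a k (o : option (fs f)) : @perform (mk f) (enc_act i (onth (adr sg) (apo
  sg))
                   (scan_tapes (@cfg f i (Some s) sg)) a k o)
                 (@cfg f i (Some s) sg) = cfg (tick i k) o (perf a sg).
  rewrite /cfg /=; congr Config.
  - case: (aw a) => [b|] //=; case: ltnP => // h.
    rewrite odflt_onth.
    apply: (@eq_from_nth _ false); rewrite size_set_nth (maxn_idPr h) // => j hj;
      rewrite nth_set_nth /=; case: eqP => [-> //|//].
  - apply: functional_extensionality => j; apply: functional_extensionality => p.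
    rewrite /stept !ffunE /=; case: (tw a _).1 => [s'|] //=.
    by case: eqP => // ->.
  - by apply: functional_extensionality => j; rewrite ffunE.
rewrite /Defs.next /= /final /=.
rewrite /scan_input /scan_addr /= Er.
case: (fd s (look x sg)) => [[a k] l]; split=> [[h1 [e]]|[h1 [o ol ->]]].
  case Eh: (fh s) => [b|] ; first by rewrite inE.
  rewrite inE => /mapP[o ol ->] ->; split=> //; exists o => //; exact: Ep.
rewrite h1; split=> //; exists (enc_act i (onth (adr sg) (apo sg)) (scan_tapes (@cfg
  f i (Some s) sg)) a k o).
  by rewrite inE; apply/mapP; exists o.
by rewrite Ep.
Qed.

Lemma acceptingP M (c : config M) : accepting x c ->
  [\/ final c,
      ~~ universal c /\ exists2 c', Defs.next x c c' & accepting x c'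
    | universal c /\ (exists c', Defs.next x c c') /\
      forall c', Defs.next x c c' -> accepting x c'].
Proof.
by case=> {}c => [fc|c' uc n ac|uc ex al]; [constructor 1|constructor 2; split=> //;
  exists c'|constructor 3].
Qed.

Fixpoint bounded M (t : nat) (c : config M) : Prop :=
  forall c', Defs.next x c c' -> if t is t'.+1 then bounded t' c' else False.

(** Termination of all runs turns acceptance into acceptance in bounded time, so that the outcome of
    the game and its duration can be treated separately. *)
Lemma bounded_accepting M t (c : config M) :
  bounded t c -> accepting x c -> accepting_within x t c.
Proof.
move=> + H; elim: H t => {c} [c fc|c c' uc n _ IH|c uc [c' n] _ IH] t.
- by case: t => *; left.
- by case: t => [|t] b; [case: (b _ n)|right; rewrite (negPf uc); exists c' => //;
  apply/IH/b].
- case: t => [|t] b; [by case: (b _ n)|right; rewrite uc; split;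
  first by exists c'].
  by move=> c'' n''; apply: IH => //; apply: b.
Qed.

Lemma bounded_leq M t t' (c : config M) : t <= t' -> bounded t c -> bounded t' c.
Proof.
elim: t t' c => [|t IH] [|t'] c //= h b c' n; first by case: (b _ n).
by apply: IH (b _ n).
Qed.

Section Context.
Variables (f : frag).

(* The claim of the player to move: acceptance in an existential block,
   non-acceptance in a universal one, so that both kinds of blocks search
   existentially for an exit where the claim still holds. *)
Definition V (i : 'I_nb.+1) o s : Prop :=
  if odd i then ~ accepting x (@cfg f i o s) else accepting x (@cfg f i o s).

Definition bnd t i o s := bounded t (@cfg f i o s).

(** The fragment [p] sits inside [f]: its states keep their halting behaviour and their transitions.
    Only the exit is left open, since the context decides where it leads. *)
Definition emb (p : frag) (io : option (fs p) -> option (fs f)) : Prop :=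
  forall s, exists s', [/\ io (Some s) = Some s', fh s' = fh s &
    forall r, fd s' r = let: (a, k, l) := fd s r in (a, k, map io l)].

(** The negation of the universal acceptance rule is existential, which is why one rule serves both
    kinds of blocks. This takes classical logic and a nonempty list [l]: a universal configuration
    without successors does not accept, but then there is no successor to hand the claim on to. *)
Lemma V_step (i : 'I_nb.+1) s sg : fh s = None ->
  let: (a, k, l) := fd s (look x sg) in
  ~~ k ->
  (l != [::] -> V i (Some s) sg -> exists2 o, o \in l & V i o (perf a sg)) /\
  (forall o, o \in l -> V i o (perf a sg) -> V i (Some s) sg).
Proof.
move=> hs; have N := fun c' => next_cfg i s sg c'.
case E: (fd s (look x sg)) N => [[a k] l] N; case: k E N => // E N _.
have nf : ~~ final (cfg i (Some s) sg) by rewrite /final /= hs.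
rewrite /V; case oi: (odd i); split.
- case: l E N => // o0 l E N _ na.
  apply: NNPP => H; apply: na; apply: AccForall.
  + by rewrite /universal /= oi.
  + by eexists; apply/N; split=> //; exists o0; rewrite ?mem_head.
  + move=> c' /N[_ [o ol ->]]; apply: NNPP => h; apply: H; by exists o.
- move=> o ol na /= ac; apply: na; case/acceptingP: ac => [fc|[uc _]|[uc [ex al]]].
  + by rewrite fc in nf.
  + by move: uc; rewrite /universal /= oi.
  + by apply: al; apply/N; split=> //; exists o.
- move=> _ ac; case/acceptingP: ac => [fc|[uc [c' n ac]]|[uc [ex al]]].
  + by rewrite fc in nf.
  + by move: n => /N[_ [o ol E']]; exists o; rewrite -?E'.
  + by move: uc; rewrite /universal /= oi.
- move=> o ol ac; apply: AccExists ac; first by rewrite /universal /= oi.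
  by apply/N; split=> //; exists o.
Qed.

Lemma bnd_step i s sg t :
  let: (a, k, l) := fd s (look x sg) in
  (forall o, o \in l -> bnd t (tick i k) o (perf a sg)) ->
  bnd t.+1 i (Some s) sg.
Proof.
have N := fun c' => next_cfg i s sg c'.
case E: (fd s (look x sg)) N => [[a k] l] N H c' /N[_ [o ol ->]]; exact: H.
Qed.

Lemma bnd_halt i s sg b t : fh s = Some b -> bnd t i (Some s) sg.
Proof. by move=> h; case: t => [|t] c' /next_cfg; rewrite h => -[]. Qed.

End Context.

(* A claim held when p is entered in a block of kind u survives at some exit in
   Q (must), and a claim held at the exit s' was held at the entry (may);
   quantifying over the contexts f, io makes both compositional. *)
Definition must u p t sg (Q : store -> Prop) : Prop :=
  wf sg -> forall f (io : option (fs p) -> option (fs f)) (i : 'I_nb.+1),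
  emb io -> odd i = u ->
  (V i (io (Some (fe p))) sg ->
     exists s', [/\ wf s', Q s' & V i (io None) s']) /\
  (forall r, (forall s', wf s' -> Q s' -> bnd r i (io None) s') ->
     bnd (t + r) i (io (Some (fe p))) sg).

Definition may u p sg s' : Prop :=
  wf sg -> wf s' /\
  forall f (io : option (fs p) -> option (fs f)) (i : 'I_nb.+1),
  emb io -> odd i = u -> V i (io None) s' -> V i (io (Some (fe p))) sg.

Lemma must_mono u p t t' sg (Q Q' : store -> Prop) :
  t <= t' -> (forall s, Q s -> Q' s) -> must u p t sg Q -> must u p t' sg Q'.
Proof.
move=> ht hQ d w f io i em oi; have [d1 d2] := d w f io i em oi; split.
  by move=> /d1[s' [w' q v]]; exists s'; split=> //; apply: hQ.
move=> r H; apply: (@bounded_leq _ (t + r)); first by rewrite leq_add2r.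
by apply: d2 => s' w' q; apply: H => //; apply: hQ.
Qed.

Lemma must_Do u g sg : must u (Do g) 1 sg (eq (perf (g (look x sg)) sg)).
Proof.
move=> w f io i em oi; have [s' [Es hs ds]] := em tt; rewrite Es; split.
  have := V_step (f := f) i sg hs; rewrite ds /= => /(_ isT)[H _] /H.
  by case=> // o; rewrite inE => /eqP -> v; exists (perf (g (look x sg)) sg);
    split=> //; apply: wf_perf.
move=> r H; have := @bnd_step f i s' sg r; rewrite ds /=; apply=> o.
by rewrite inE => /eqP ->; apply: H => //; apply: wf_perf.
Qed.

Lemma may_Do u g sg : may u (Do g) sg (perf (g (look x sg)) sg).
Proof.
move=> w; split; first exact: wf_perf.
move=> f io i em oi; have [s' [Es hs ds]] := em tt; rewrite Es.
have := V_step (f := f) i sg hs; rewrite ds /= => /(_ isT)[_]; apply.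
by rewrite inE.
Qed.

(** The verdict [u] refutes the claim in a block of kind [u], since acceptance ends a universal
    block and rejection an existential one. The claim therefore cannot hold at the entry, and any
    postcondition follows. *)
Lemma must_Halt u sg Q : must u (Halt u) 0 sg Q.
Proof.
move=> w f io i em oi; have [s' [Es hs ds]] := em tt; rewrite Es; split.
  rewrite /V oi; move: hs => /=; case: (u) => hs.
    by case; apply: AccFinal; rewrite /final /= hs.
  move=> ac; case/acceptingP: ac => [fc|[uc [c' n ac]]|[uc [[c' n] al]]].
  + by move: fc; rewrite /final /= hs.
  + by move: n => /next_cfg; rewrite hs; case.
  + by move: n => /next_cfg; rewrite hs; case.
by move=> r _; apply: bnd_halt hs.
Qed.

(** The opposite verdict establishes the claim outright; a verified certificate ends the last block
    in this way. *)
Lemma V_Halt u f (io : option (fs (Halt (~~ u))) -> option (fs f))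
    (i : 'I_nb.+1) sg :
  odd i = u -> emb io -> V i (io (Some (fe (Halt (~~ u))))) sg.
Proof.
move=> oi em; have [s' [Es hs ds]] := em tt; rewrite Es /V oi.
move: hs => /=; case: (u) => /= hs.
  move=> ac; case/acceptingP: ac => [fc|[uc [c' n ac]]|[uc [[c' n] al]]].
  + by move: fc; rewrite /final /= hs.
  + by move: n => /next_cfg; rewrite hs; case.
  + by move: n => /next_cfg; rewrite hs; case.
by apply: AccFinal; rewrite /final /= hs.
Qed.

Lemma emb_seq1 p q f (io : option (fs (Seq p q)) -> option (fs f)) :
  emb io -> emb (fun o : option (fs p) =>
    io (Some (if o is Some s then inl s else inr (fe q)))).
Proof.
move=> em s; have [s' [Es hs ds]] := em (inl s); exists s'; split=> // r.
rewrite ds /=; case: (fd s r) => [[a k] l]; congr (_, _).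
by rewrite -map_comp; apply: eq_map.
Qed.

Lemma emb_seq2 p q f (io : option (fs (Seq p q)) -> option (fs f)) :
  emb io -> emb (fun o : option (fs q) => io (omap inr o)).
Proof.
move=> em s; have [s' [Es hs ds]] := em (inr s); exists s'; split=> // r.
rewrite ds /=; case: (fd s r) => [[a k] l]; congr (_, _).
by rewrite -map_comp; apply: eq_map.
Qed.

Lemma must_Seq u p q t1 t2 sg Q R :
  must u p t1 sg Q -> (forall s', Q s' -> must u q t2 s' R) ->
  must u (Seq p q) (t1 + t2) sg R.
Proof.
move=> dp dq w f io i em oi.
have [p1 p2] := dp w f _ i (emb_seq1 em) oi.
split.
  case/p1 => s' [w' q' v].
  have [q1 _] := dq s' q' w' f _ i (emb_seq2 em) oi.
  exact: q1.
move=> r H; rewrite -addnA; apply: p2 => s' w' q'.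
have [_ q2] := dq s' q' w' f _ i (emb_seq2 em) oi.
exact: q2.
Qed.

Lemma may_Seq u p q s1 s2 s3 :
  may u p s1 s2 -> may u q s2 s3 -> may u (Seq p q) s1 s3.
Proof.
move=> ep eq w1; have [w2 p2] := ep w1; have [w3 q3] := eq w2; split=> //.
move=> f io i em oi v.
apply: (p2 f _ i (emb_seq1 em) oi).
exact: (q3 f _ i (emb_seq2 em) oi).
Qed.

Lemma emb_cond g p q b f (io : option (fs (Cond g p q)) -> option (fs f)) :
  emb io -> emb (fun o : option (fs (if b then p else q)) => io (omap (Some \o
     (if b return fs (if b then p else q) -> fs p + fs q then inl else inr)) o)).
Proof.
by case: b => em s; [have [s' [Es hs ds]] := em (Some (inl s))|have [s' [Es hs ds]]
  := em (Some (inr s))];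
  exists s'; split=> // r; rewrite ds /=; case: (fd s r) => [[a k] l];
  congr (_, _); rewrite -map_comp; apply: eq_map.
Qed.

Lemma must_Cond u g p q t sg Q : g (look x sg) != [::] ->
  (forall b, b \in g (look x sg) -> must u (if b then p else q) t sg Q) ->
  must u (Cond g p q) t.+1 sg Q.
Proof.
move=> ne H w f io i em oi; have [s' [Es hs ds]] := em None; rewrite Es; split.
  have := V_step (f := f) i sg hs; rewrite ds /= => /(_ isT)[h _] /h{h}.
  case; first by case: (g _) ne.
  move=> o /mapP[_ /mapP[b bg ->] ->]; rewrite perf_noop // => v.
  have [h _] := H b bg w f _ i (emb_cond (b := b) em) oi.
  by apply: h; case: (b) v.
move=> r h; have := @bnd_step f i s' sg (t + r); rewrite ds /=; apply=> o.
move=> /mapP[_ /mapP[b bg ->] ->]; rewrite perf_noop //.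
have [_ h2] := H b bg w f _ i (emb_cond (b := b) em) oi.
by have := h2 r h; case: (b).
Qed.

Lemma may_Cond u g p q sg b s' : b \in g (look x sg) ->
  may u (if b then p else q) sg s' -> may u (Cond g p q) sg s'.
Proof.
move=> bg e w; have [w' h] := e w; split=> // f io i em oi v.
have [s0 [Es hs ds]] := em None; rewrite Es.
have := V_step (f := f) i sg hs; rewrite ds /= => /(_ isT)[_].
rewrite perf_noop //.
apply; first by apply: map_f; apply: map_f bg.
have := h f _ i (emb_cond (b := b) em) oi v.
by case: (b).
Qed.

Lemma emb_while g p f (io : option (fs (While g p)) -> option (fs f)) :
  emb io -> emb (fun o : option (fs p) => io (Some o)).
Proof.
move=> em s; have [s' [Es hs ds]] := em (Some s); exists s'; split=> // r.
by rewrite ds /=; case: (fd s r) => [[a k] l] /=; rewrite -map_comp.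
Qed.

Lemma must_While0 u (g : reads -> bool) p sg : ~~ g (look x sg) -> must u (While g
  p) 1 sg (eq sg).
Proof.
move=> ng w f io i em oi; have [s' [Es hs ds]] := em None; rewrite Es; split.
  have := V_step (f := f) i sg hs; rewrite ds /= (negPf ng) /= =>
    /(_ isT)[h _] /h{h}[] // o.
  by rewrite inE => /eqP ->; rewrite perf_noop // => v; exists sg.
move=> r h; have := @bnd_step f i s' sg r; rewrite ds /= (negPf ng); apply=> o.
by rewrite inE => /eqP ->; rewrite perf_noop //; apply: h.
Qed.

Lemma must_WhileS u (g : reads -> bool) p sg t1 t2 Q R : g (look x sg) -> must u p
  t1 sg Q ->
  (forall s', Q s' -> must u (While g p) t2 s' R) ->
  must u (While g p) (t1 + t2).+1 sg R.
Proof.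
move=> gs dp dw w f io i em oi; have [s' [Es hs ds]] := em None.
have [p1 p2] := dp w f _ i (emb_while em) oi.
split.
  rewrite Es; have := V_step (f := f) i sg hs;
    rewrite ds /= gs /= => /(_ isT)[h _] /h{h}[] // o.
  rewrite inE => /eqP ->; rewrite perf_noop // => /p1[s2 [w2 q2]].
  by have [d1 _] := dw s2 q2 w2 f _ i em oi => /d1.
move=> r h; rewrite Es; have := @bnd_step f i s' sg (t1 + t2 + r); rewrite ds /= gs;
  apply=> o.
rewrite inE => /eqP ->; rewrite perf_noop // -addnA; apply: p2 => s2 w2 q2.
by have [_ d2] := dw s2 q2 w2 f _ i em oi; apply: d2.
Qed.

Lemma may_While0 u (g : reads -> bool) p sg : ~~ g (look x sg) -> may u (While g p)
  sg sg.
Proof.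
move=> ng w; split=> // f io i em oi v; have [s' [Es hs ds]] := em None; rewrite Es.
have := V_step (f := f) i sg hs; rewrite ds /= (negPf ng) => /(_ isT)[_].
by rewrite perf_noop //; apply; rewrite ?inE.
Qed.

Lemma may_WhileS u (g : reads -> bool) p s1 s2 s3 : g (look x s1) -> may u p s1 s2
  ->
  may u (While g p) s2 s3 -> may u (While g p) s1 s3.
Proof.
move=> gs ep ew w; have [w2 p2] := ep w; have [w3 p3] := ew w2; split=> //.
move=> f io i em oi v; have [s' [Es hs ds]] := em None.
have := V_step (f := f) i s1 hs; rewrite ds /= gs Es => /(_ isT)[_].
rewrite perf_noop //; apply; first by rewrite inE.
apply: (p2 f _ i (emb_while em) oi).
exact: (p3 f _ i em oi).
Qed.

(** For deterministic fragments: a single final store, the same in both kinds of blocks, is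
    reachable and is all that is reachable, so one specification yields soundness and
    completeness. *)
Definition runs p t sg (Q : store -> Prop) : Prop :=
  exists2 s', forall u, must u p t sg (eq s') /\ may u p sg s' & Q s'.

Lemma runs_must u p t sg Q : runs p t sg Q -> must u p t sg Q.
Proof. by case=> s' /(_ u)[d _] q; apply: must_mono d => // s <-. Qed.

Lemma runs_may u p t sg Q : runs p t sg Q -> exists2 s', may u p sg s' & Q s'.
Proof. by case=> s' /(_ u)[_ e] q; exists s'. Qed.

Lemma runs_mono p t t' sg (Q Q' : store -> Prop) :
  t <= t' -> (forall s, Q s -> Q' s) -> runs p t sg Q -> runs p t' sg Q'.
Proof.
move=> ht hQ [s' H q]; exists s'; last exact: hQ.
by move=> u; have [d e] := H u; split=> //; apply: must_mono d.
Qed.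

Lemma runs_Do g sg Q : Q (perf (g (look x sg)) sg) -> runs (Do g) 1 sg Q.
Proof.
move=> q; exists (perf (g (look x sg)) sg) => // u.
by split; [apply: must_Do|apply: may_Do].
Qed.

Lemma runs_Seq p q t1 t2 sg Q R :
  runs p t1 sg Q -> (forall s', Q s' -> runs q t2 s' R) ->
  runs (Seq p q) (t1 + t2) sg R.
Proof.
move=> [s1 h1 q1] /(_ _ q1)[s2 h2 q2]; exists s2 => // u.
have [d1 e1] := h1 u; have [d2 e2] := h2 u; split.
  by apply: must_Seq d1 _ => s <-.
exact: may_Seq e1 e2.
Qed.

Lemma runs_If (g : reads -> bool) p q t sg Q :
  (if g (look x sg) then runs p t sg Q else runs q t sg Q) ->
  runs (If g p q) t.+1 sg Q.
Proof.
move=> H; have {}H : runs (if g (look x sg) then p else q) t sg Q by move: H;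
  case: (g _).
case: H => s' h qs; exists s' => // u; have [d e] := h u; split.
  by apply: must_Cond => // b; rewrite inE => /eqP ->.
by apply: may_Cond e; rewrite inE.
Qed.

Lemma runs_While0 (g : reads -> bool) p sg Q : ~~ g (look x sg) -> Q sg -> runs
  (While g p) 1 sg Q.
Proof.
by move=> ng q; exists sg => // u; split; [apply: must_While0|apply: may_While0].
Qed.

Lemma runs_WhileS (g : reads -> bool) p sg t1 t2 Q R : g (look x sg) -> runs p t1 sg
  Q ->
  (forall s', Q s' -> runs (While g p) t2 s' R) ->
  runs (While g p) (t1 + t2).+1 sg R.
Proof.
move=> gs [s1 h1 q1] /(_ _ q1)[s2 h2 q2]; exists s2 => // u.
have [d1 e1] := h1 u; have [d2 e2] := h2 u; split.
  by apply: must_WhileS d1 _ => // s <-.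
exact: may_WhileS e1 e2.
Qed.

(** The measure bounds the rounds left and may fall by more than one, so that a search can stop
    early by dropping to 0. Each round costs one test and the body. *)
Lemma runs_loop (g : reads -> bool) p t (J : nat -> store -> Prop) k sg :
  (forall k s, J k.+1 s -> g (look x s)) ->
  (forall s, J 0 s -> ~~ g (look x s)) ->
  (forall k s, J k.+1 s ->
     runs p t s (fun s' => exists2 k', k' <= k & J k' s')) ->
  J k sg -> runs (While g p) (k * t.+1).+1 sg (J 0).
Proof.
move=> hS h0 hb; move: {2}k (leqnn k) => n.
elim: n k sg => [|n IH] [|k] sg // hk j; try exact: runs_While0 (h0 _ j) j.
rewrite mulSn addSn -addnS; apply: runs_WhileS (hS _ _ j) (hb _ _ j) _ =>
  s [k' hk' j'].
apply: runs_mono (IH _ _ (leq_trans hk' hk) j') => //.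
by rewrite ltnS leq_mul2r hk' orbT.
Qed.

Lemma runs_le p t t' sg Q : runs p t sg Q -> t <= t' -> runs p t' sg Q.
Proof. by move=> h le; apply: runs_mono h. Qed.

Lemma runs_post p t sg (Q Q' : store -> Prop) :
  runs p t sg Q -> (forall s, Q s -> Q' s) -> runs p t sg Q'.
Proof. by move=> h le; apply: runs_mono h. Qed.

(** A guessing body has no unique final store, so this rule is for [must] alone; what such a loop
    may reach is shown by direct induction. *)
Lemma must_loop u (g : reads -> bool) p t (J : nat -> store -> Prop) k sg :
  (forall k s, J k.+1 s -> g (look x s)) ->
  (forall s, J 0 s -> ~~ g (look x s)) ->
  (forall k s, J k.+1 s -> must u p t s (J k)) ->
  J k sg -> must u (While g p) (k * t.+1).+1 sg (J 0).
Proof.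
move=> hS h0 hb; elim: k sg => [|k IH] sg j.
  by apply: must_mono (@must_While0 u g p sg (h0 _ j)) => // s <-.
by rewrite mulSn addSn -addnS; apply: must_WhileS (hS _ _ j) (hb _ _ j) _ => s /IH.
Qed.

(** A tick leaves acceptance as it is but hands the move to the other player, whose claim is the
    negation. The condition [i < nb] keeps the counter away from saturation. *)
Lemma V_Tick f (io : option (fs Tick) -> option (fs f)) (i : 'I_nb.+1) sg :
  emb io -> wf sg -> i < nb ->
  V i (io (Some (fe Tick))) sg <-> ~ V (inord i.+1) (io None) sg.
Proof.
move=> em w hi; have [s [Es hs ds]] := em tt; rewrite Es.
have N c' : Defs.next x (@cfg f i (Some s) sg) c' <-> c' = cfg (inord i.+1) (io
  None) sg.
  rewrite next_cfg ds /= hs /= perf_noop // (minn_idPl hi); split;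
    first by case=> _ [o]; rewrite inE => /eqP ->.
  by move=> ->; split=> //; exists (io None); rewrite ?inE.
have A : accepting x (@cfg f i (Some s) sg) <-> accepting x (@cfg f (inord i.+1) (io
  None) sg).
  have nf : ~~ final (cfg i (Some s) sg) by rewrite /final /= hs.
  split=> ac.
    case/acceptingP: ac => [fc|[uc [c' n ac]]|[uc [ex al]]].
    + by rewrite fc in nf.
    + by move: n => /N <-.
    + by apply: al; apply/N.
  case oi: (odd i).
    apply: AccForall; rewrite /universal //=; first by eexists; apply/N.
    by move=> c' /N ->.
  by apply: AccExists ac; rewrite /universal /= ?oi //; apply/N.
rewrite /V inordK ?ltnS //= ; case: (odd i) => /=; rewrite A; split; try tauto.
Qed.

Lemma bnd_Tick f (io : option (fs Tick) -> option (fs f)) (i : 'I_nb.+1) sg t :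
  emb io -> wf sg -> i < nb ->
  bnd t (inord i.+1) (io None) sg -> bnd t.+1 i (io (Some (fe Tick))) sg.
Proof.
move=> em w hi b; have [s [Es hs ds]] := em tt; rewrite Es.
have := @bnd_step f i s sg t; rewrite ds /=; apply=> o.
by rewrite inE => /eqP ->; rewrite perf_noop // /tick (minn_idPl _).
Qed.

Definition istore n : store := Store (nseq (clog n) false) 0 (fun=> (fun=> blank,
  0)).

Lemma init_cfg f : init (mk f) x = cfg ord0 (Some (fe f)) (istore (size x)).
Proof. by []. Qed.

(** The counter never decreases, and the kind of a block is its parity, so each change of kind has
    raised it. At saturation a tick changes neither. *)
Lemma run_blocks f s b c : @run (mk f) x s b c -> b <= (cf_state c).1.+1.
Proof.
have N (c0 c1 : config (mk f)) : Defs.next x c0 c1 ->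
  exists k, (cf_state c1).1 = tick (cf_state c0).1 k.
  case=> _ [e]; rewrite /mk /=; case: (cf_state c0) => i [s'|] /=;
    last by rewrite inE.
  case: fd => [[a k] l]; case: fh => [?|]; first by rewrite inE.
  by rewrite inE => /mapP[o _ ->] ->; exists k.
elim=> {s b c} [//|s b c c' _ IH n].
have [k Ek] := N _ _ n.
move: IH; rewrite /universal /= Ek /tick; case: k {Ek} => h;
  last by rewrite eqxx addn0.
rewrite inordK ?ltnS ?geq_minr //.
have := ltn_ord (cf_state c).1; rewrite ltnS leq_eqVlt => /orP[/eqP E0|lt].
  by rewrite E0 (minn_idPr _) ?eqxx //= addn0 -E0.
rewrite (minn_idPl lt) /=; case: eqP => _; lia.
Qed.

End Fragments.

(** * Bit strings on tapes *)

Lemma rcons_nseq (b : bool) n : rcons (nseq n b) b = nseq n.+1 b.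
Proof. by elim: n => //= n ->. Qed.

Lemma bits_val_rcons s b : bits_val (rcons s b) = (bits_val s).*2 + b.
Proof. by rewrite /bits_val foldl_rcons. Qed.

Lemma bits_val_cat s t : bits_val (s ++ t) = bits_val s * 2 ^ size t + bits_val t.
Proof.
elim/last_ind: t => [|t b IH]; first by rewrite cats0 muln1 addn0.
rewrite -rcons_cat !bits_val_rcons IH size_rcons expnS -!mul2n.
by rewrite mulnDr mulnCA addnA.
Qed.

Lemma bits_val_nseq0 n : bits_val (nseq n false) = 0.
Proof. by elim: n. Qed.

Lemma bits_val_nseq1 n : (bits_val (nseq n true)).+1 = 2 ^ n.
Proof.
elim: n => // n IH; rewrite -rcons_nseq bits_val_rcons expnS.
by rewrite -IH; lia.
Qed.

(** The last one of a string is where a binary decrement stops borrowing; without a one the number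
    is zero. *)
Lemma nseq0P s : {n | s = nseq n false} +
  {at_ : seq bool * nat | s = at_.1 ++ true :: nseq at_.2 false}.
Proof.
elim/last_ind: s => [|s b [[n ->]|[[a n] /= ->]]]; first by left; exists 0.
- case: b; first by right; exists (nseq n false, 0); rewrite cats1.
  by left; exists n.+1; rewrite rcons_nseq.
- case: b; right; first by exists (a ++ true :: nseq n false, 0); rewrite cats1.
  exists (a, n.+1) => /=.
  by rewrite rcons_cat rcons_cons rcons_nseq.
Qed.

(** * Frame conditions on stores *)

Section Frames.

Variables (I S : finType).
Notation store := (store I S).
Implicit Types (X Y : seq I) (s : store).

(* Only the tapes in X changed, and for frz also the contents of the address
   tape. *)
Definition fr (X : seq I) (s s' : store) : Prop :=
  [/\ adr s' = adr s, wf s -> apo s' = apo s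
    & forall k, k \notin X -> tps s' k = tps s k].

Definition frz (X : seq I) (s s' : store) : Prop :=
  size (adr s') = size (adr s) /\ forall k, k \notin X -> tps s' k = tps s k.

Lemma fr_refl X s : fr X s s. Proof. by []. Qed.

Lemma fr_wf X s s' : fr X s s' -> wf s -> wf s'.
Proof. by rewrite /wf => -[-> h _] w; rewrite h. Qed.

Lemma fr_trans X Y s s' s'' :
  fr X s s' -> fr Y s' s'' -> {subset X <= Y} -> fr Y s s''.
Proof.
move=> F [a' p' t'] h; have w' := fr_wf F; case: F => a p t.
split; [by rewrite a' | by move=> w; rewrite p' ?p //; apply: w' |].
move=> k kY; rewrite t' // t //; apply: contra kY; exact: h.
Qed.

Lemma fr_sub X Y s s' : fr X s s' -> {subset X <= Y} -> fr Y s s'.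
Proof. by move=> h; apply: fr_trans h (fr_refl _ _). Qed.

Lemma frz_refl X s : frz X s s. Proof. by []. Qed.

Lemma frz_trans X Y s s' s'' :
  frz X s s' -> frz Y s' s'' -> {subset X <= Y} -> frz Y s s''.
Proof.
move=> [a t] [a' t'] h; split; first by rewrite a'.
move=> k kY; rewrite t' // t //; apply: contra kY; exact: h.
Qed.

Lemma frz_sub X Y s s' : frz X s s' -> {subset X <= Y} -> frz Y s s'.
Proof. by move=> h; apply: frz_trans h (frz_refl _ _). Qed.

Lemma fr_frz X s s' : fr X s s' -> frz X s s'.
Proof. by case=> a _ t; split; rewrite ?a. Qed.

Lemma fr_tps X s s' k : fr X s s' -> k \notin X -> tps s' k = tps s k.
Proof. by case=> _ _; apply. Qed.

Lemma frz_tps X s s' k : frz X s s' -> k \notin X -> tps s' k = tps s k.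
Proof. by case=> _; apply. Qed.

(** A scratch tape that ends as it began may leave the frame. *)
Lemma frz_drop X i s s' :
  frz (i :: X) s s' -> tps s' i = tps s i -> frz X s s'.
Proof.
move=> [a t] e; split=> // k kX; case: (eqVneq k i) => [->//|ki].
by apply: t; rewrite inE negb_or ki.
Qed.

Lemma fr_drop X i s s' :
  fr (i :: X) s s' -> tps s' i = tps s i -> fr X s s'.
Proof.
move=> [a p t] e; split=> // k kX; case: (eqVneq k i) => [->//|ki].
by apply: t; rewrite inE negb_or ki.
Qed.

Lemma fr_back X Y s s' s'' :
  fr Y s' s'' -> {subset Y <= X} -> fr X s s' -> fr X s s''.
Proof. by move=> F2 h F1; apply: fr_trans F1 (fr_sub F2 h) _. Qed.

Lemma frz_back X Y s s' s'' :
  frz Y s' s'' -> {subset Y <= X} -> frz X s s' -> frz X s s''.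
Proof. by move=> F2 h F1; apply: frz_trans F1 (frz_sub F2 h) _. Qed.

End Frames.

Ltac subs := by apply/allP; rewrite /= ?inE ?eqxx ?orbT.
Ltac frs := match goal with
  | |- fr _ ?s ?s => exact: fr_refl
  | F : fr _ _ ?s |- fr _ _ ?s => apply: (fr_back F); [subs | frs]
  end.
Ltac frzs := match goal with
  | |- frz _ ?s ?s => exact: frz_refl
  | F : fr _ _ ?s |- frz _ _ ?s => apply: (frz_back (fr_frz F)); [subs | frzs]
  | F : frz _ _ ?s |- frz _ _ ?s => apply: (frz_back F); [subs | frzs]
  end.
Ltac dist := rewrite ?inE ?negb_or; repeat (apply/andP; split);
  solve [assumption | rewrite eq_sym; assumption].
(* Rewrites tps s k back through the frames, up to the state where it is known. *)
Ltac keep := first [assumption | match goal with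
  | F : fr _ _ ?s |- tps ?s _ = _ => rewrite (fr_tps F); [keep | dist]
  | F : frz _ _ ?s |- tps ?s _ = _ => rewrite (frz_tps F); [keep | dist]
  | |- _ => idtac
  end].
Ltac olia := repeat match goal with
  | H : is_true (negb _) |- _ => clear H
  | H : @eq (tape _) _ _ |- _ => clear H
  | H : fr _ _ _ |- _ => clear H
  | H : frz _ _ _ |- _ => clear H
  end; lia.
Tactic Notation "sq" uconstr(L) := eapply runs_Seq; [eapply L|].
Tactic Notation "lst" uconstr(L) := eapply runs_post; [eapply L|].

(** * Elementary operations on strings and registers *)

Section Strings.

Variables (I T : finType) (t0 : T) (nb : nat).

(** A cell has an optional bit for strings, a mark for finding a place again, and a payload in [T],
    which will hold a symbol and a state of the simulated machine. *)
Definition sym : finType := ((option bool * bool) * T)%type.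
Definition sy (o : option bool) (m : bool) : sym := ((o, m), t0).
Definition bit (s : sym) := s.1.1.
Definition mkd (s : sym) := s.1.2.
Definition blank := sy None false.
Definition blank0 : tape sym := (fun=> blank, 0).

(* Cell 0 stays blank and marks the left end. *)
Definition st (s : seq bool) (p : nat) : tape sym :=
  (fun q => if q is q'.+1 then sy (onth s q') false else blank, p).

Definition reg (o : option bool) : tape sym :=
  (fun q => if q is 0 then sy o false else blank, 0).

Notation store := (store I sym).
Notation reads := (reads I sym).
Notation act := (act I sym).
Notation frag := (frag I sym).

Variable x : seq bool.
Notation runs := (@runs I sym blank nb x).

Implicit Types (i j : I) (X Y : seq I) (s : store) (c : seq bool).

Definition W1 i (g : reads -> option sym) (d : move) : frag :=
  Do (fun r => Act None Stay (fun j => if j == i then (g r, d) else (None, Stay))).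

Definition WA (g : reads -> option bool) (d : move) : frag :=
  Do (fun r => Act (g r) d (fun=> (None, Stay))).

Definition mv i d := W1 i (fun=> None) d.

Definition nb_ i (r : reads) : bool := bit (rtp r i).

Lemma runs_W1 i g d s :
  runs (W1 i g d) 1 s (fun s' => tps s' i = stept (g (look x s),
    d) (tps s i) /\ fr [:: i] s s').
Proof.
apply: runs_Do; rewrite /= eqxx; split=> //; split=> //.
  by move=> w; rewrite /=; apply/minn_idPl.
by move=> k; rewrite inE => /negPf h; rewrite /= h /stept /=; case: (tps s k).
Qed.

Lemma runs_mv i d s :
  runs (mv i d) 1 s (fun s' => tps s' i = ((tps s i).1,
    shift d (tps s i).2) /\ fr [:: i] s s').
Proof. exact: runs_W1. Qed.

Lemma look_nb i s c p : tps s i = st c p ->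
  nb_ i (look x s) = (0 < p <= size c).
Proof. by rewrite /nb_ /= => ->; case: p => //= p; rewrite onthTE. Qed.

Lemma look_bit i s c p : tps s i = st c p.+1 -> bit (rtp (look x s) i) = onth c p.
Proof. by rewrite /= => ->. Qed.


Lemma goR i s c p : tps s i = st c p -> 0 < p <= (size c).+1 ->
  runs (While (nb_ i) (mv i GoRight)) (2 * size c).+1 s
    (fun s' => tps s' i = st c (size c).+1 /\ fr [:: i] s s').
Proof.
move=> e hp.
pose J k s' := [/\ tps s' i = st c ((size c).+1 - k), k <= size c & fr [:: i] s s'].
eapply runs_le.
  apply: runs_post; first apply: (@runs_loop _ _ _ _ _ _ _ 1 J ((size c).+1 - p)).
  - by move=> k s' [e' hk _]; rewrite (look_nb e'); lia.
  - by move=> s' [e' _ _]; rewrite (look_nb e'); lia.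
  - move=> k s' [e' hk F]; apply: runs_post (runs_mv _ _ _) _ => s2 [e2 F2].
    exists k => //; split; last by frs.
      by rewrite e2 e' /st /=; congr (_, _); lia.
    by lia.
  - by split=> //; [rewrite e; congr (st _ _); lia | lia].
  - by move=> s' [e' _ F]; rewrite e' subn0.
rewrite mulnC; case/andP: hp; lia.
Qed.

Lemma goL i s c p : tps s i = st c p -> p <= size c ->
  runs (While (nb_ i) (mv i GoLeft)) (2 * size c).+1 s
    (fun s' => tps s' i = st c 0 /\ fr [:: i] s s').
Proof.
move=> e hp.
pose J k s' := [/\ tps s' i = st c k, k <= size c & fr [:: i] s s'].
eapply runs_le.
  apply: runs_post; first apply: (@runs_loop _ _ _ _ _ _ _ 1 J p).
  - by move=> k s' [e' hk _]; rewrite (look_nb e').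
  - by move=> s' [e' _ _]; rewrite (look_nb e').
  - move=> k s' [e' hk F]; apply: runs_post (runs_mv _ _ _) _ => s2 [e2 F2].
    exists k => //; split; last by frs.
      by rewrite e2 e'.
    by lia.
  - by split.
  - by move=> s' [e' _ F]; rewrite e'.
by lia.
Qed.

(** The first move is for a head on the blank past the end, where the loop would stop at once. *)
Definition rewind i := Seq (mv i GoLeft) (While (nb_ i) (mv i GoLeft)).

Lemma runs_rewind i s c p : tps s i = st c p -> p <= (size c).+1 ->
  runs (rewind i) (2 * size c + 2) s
    (fun s' => tps s' i = st c 0 /\ fr [:: i] s s').
Proof.
move=> e hp; eapply runs_le.
  apply: runs_Seq (runs_mv _ _ _) _ => s1 [e1 F1].
  have {}e1 : tps s1 i = st c p.-1 by rewrite e1 e.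
  apply: runs_post; first by apply: goL e1 _; lia.
  by move=> s2 [e2 F2]; split=> //; apply: fr_trans F1 F2 _.
by lia.
Qed.

Definition toend i := Seq (rewind i) (Seq (mv i GoRight)
  (Seq (While (nb_ i) (mv i GoRight)) (mv i GoLeft))).

Lemma runs_toend i s c p : tps s i = st c p -> p <= (size c).+1 ->
  runs (toend i) (4 * size c + 5) s
    (fun s' => tps s' i = st c (size c) /\ fr [:: i] s s').
Proof.
move=> e hp; eapply runs_le.
  apply: runs_Seq; first exact: runs_rewind e hp. move=> s1 [e1 F1].
  apply: runs_Seq (runs_mv _ _ _) _ => s2 [e2 F2].
  apply: runs_Seq; first by apply: goR (_ : 0 < 1 <= _) => //; rewrite e2 e1.
  move=> s3 [e3 F3].
  apply: runs_post (runs_mv _ _ _) _ => s4 [e4 F4].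
  split; first by rewrite e4 e3.
  by frs.
by lia.
Qed.

Lemma st_rcons c b :
  (fun p => if p == (size c).+1 then sy (Some b) false else (st c 0).1 p) = (st
    (rcons c b) 0).1.
Proof.
apply: functional_extensionality => -[|p] //=.
rewrite eqSS -cats1 onth_cat; case: ltngtP => h //.
- by rewrite !onth_default //=; lia.
- by rewrite h subnn.
Qed.

Definition app i (g : reads -> bool) := W1 i (fun r =>
  Some (sy (Some (g r)) false)) GoRight.

Lemma runs_app i s g c : tps s i = st c (size c).+1 ->
  runs (app i g) 1 s
    (fun s' => tps s' i = st (rcons c (g (look x s))) (size c).+2 /\ fr [:: i] s
      s').
Proof.
move=> e; apply: runs_post (runs_W1 _ _ _ _) _ => s' [-> F]; split=> //.
by rewrite e; exact: (f_equal (fun f => (f, (size c).+2)) (st_rcons c _)).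
Qed.

Lemma st_nil p : st [::] p = (fun=> blank, p).
Proof. by congr (_, _); apply: functional_extensionality => -[|[]]. Qed.

Lemma reg_None : reg None = blank0.
Proof. by congr (_, _); apply: functional_extensionality => -[|q]. Qed.

Definition setr i (g : reads -> option bool) := W1 i (fun r =>
  Some (sy (g r) false)) Stay.

Lemma runs_setr i s g o : tps s i = reg o ->
  runs (setr i g) 1 s
    (fun s' => tps s' i = reg (g (look x s)) /\ fr [:: i] s s').
Proof.
move=> e; apply: runs_post (runs_W1 _ _ _ _) _ => s' [-> F]; split=> //.
by rewrite e /stept /=; congr (_, _); apply: functional_extensionality => -[|q].
Qed.

Lemma runs_Skip s : runs (Skip _ _) 1 s (fun s' => fr [::] s s' /\ tps s' = tps s).
Proof.
have e : tps (perf (noop I sym) s) = tps s.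
  apply: functional_extensionality => k.
  by rewrite /= /stept /=; case: (tps s k).
apply: runs_Do; split=> //; split=> // [w|k _]; last by rewrite e.
by rewrite /=; apply/minn_idPl.
Qed.

Definition erase i := Seq (toend i)
  (While (nb_ i) (W1 i (fun=> Some blank) GoLeft)).

Lemma runs_erase i s c p : tps s i = st c p -> p <= (size c).+1 ->
  runs (erase i) (6 * size c + 6) s
    (fun s' => tps s' i = blank0 /\ fr [:: i] s s').
Proof.
move=> e hp; eapply runs_le.
  apply: runs_Seq; first exact: runs_toend e hp. move=> s1 [e1 F1].
  pose J k s' := exists c', [/\ tps s' i = st c' (size c'),
    k = size c' & fr [:: i] s s'].
  apply: runs_post; first apply: (@runs_loop _ _ _ _ _ _ _ 1 J (size c)).
  - by move=> k s' [c' [e' hk _]]; rewrite (look_nb e') -hk /=.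
  - by move=> s' [c' [e' hk _]]; rewrite (look_nb e'); case: c' hk {e'}.
  - move=> k s' [c' [e' hk F]]; apply: runs_post (runs_W1 _ _ _ _) _ => s2 [e2 F2].
    exists k => //; case/lastP: c' e' hk => // c' b e' hk.
    move: hk; rewrite size_rcons => -[hk].
    exists c'; split=> //; last by frs.
    rewrite e2 e' size_rcons /stept /=; congr (_, _).
    apply: functional_extensionality => -[|q] //=.
    rewrite eqSS -cats1 onth_cat; case: ltngtP => h //.
    + by rewrite !onth_default //=; lia.
    + by rewrite h onth_default.
  - by exists c.
  - move=> s' [c' [e' hk F]]; split=> //.
    by rewrite e'; case: c' hk {e'} => //; rewrite st_nil.
by lia.
Qed.

End Strings.

Arguments runs_W1 {I T t0 nb x}.
Arguments runs_mv {I T t0 nb x}.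
Arguments goR {I T t0 nb x i s c p}.
Arguments goL {I T t0 nb x i s c p}.
Arguments runs_rewind {I T t0 nb x i s c p}.
Arguments runs_toend {I T t0 nb x i s c p}.
Arguments runs_app {I T t0 nb x i s} g {c}.
Arguments runs_setr {I T t0 nb x i s} g {o}.
Arguments runs_Skip {I T t0 nb x}.
Arguments runs_erase {I T t0 nb x i s c p}.
Arguments look_nb {I T t0} x {i s c p}.
Arguments look_bit {I T t0} x {i s c p}.

(** * Reading the string w = P ++ x *)

Section Core.

Variables (I T : finType) (t0 : T) (nb : nat).
Notation sym := (sym T).
Notation sy := (sy t0).
Notation blank := (blank t0).
Notation blank0 := (blank0 t0).
Notation st := (st t0).
Notation reg := (reg t0).
Notation store := (store I sym).
Notation reads := (reads I sym).
Notation frag := (frag I sym).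
Variable x : seq bool.
Notation runs := (@runs I sym blank nb x).
Notation Skip := (Skip I sym).
Notation toend := (toend T).
Notation rewind := (rewind T).
Notation mv := (mv T).
Notation setr := (setr t0).
Notation erase := (erase t0).
Notation app := (app t0).
Implicit Types (i j X P W R : I) (s : store) (c : seq bool).

Lemma st_set a b b' c p :
  (fun q => if q == (size a).+1 then sy (Some b') false else (st (a ++ b :: c) p).1
    q)
  = (st (a ++ b' :: c) p).1.
Proof.
apply: functional_extensionality => -[|q] //=.
by rewrite eqSS !onth_cat; case: ltngtP => h //;
  [case: (q - size a) (subn_gt0 (size a) q) => //; rewrite h | rewrite h subnn].
Qed.

Definition setb i b d := W1 i (fun=> Some (sy (Some b) false)) d.

Lemma runs_setb i b0 b d s a c : tps s i = st (a ++ b0 :: c) (size a).+1 ->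
  runs (setb i b d) 1 s (fun s' =>
    tps s' i = st (a ++ b :: c) (shift d (size a).+1) /\ fr [:: i] s s').
Proof.
move=> e; lst (runs_W1 i (fun=> Some (sy (Some b) false)) d s); move=> s' [-> F];
  split=> //.
by rewrite e; exact: (f_equal (fun f => (f, shift d (size a).+1)) (st_set a b0 b c
  _)).
Qed.

Definition borrow X := While (fun r : reads => bit (rtp r X) == Some false)
  (setb X true GoLeft).

(** The condition [last true a] says that [a] is empty or ends in a one. In the empty case the
    number was zero and the blank cell 0 stops the loop, which is how the caller notices a borrow
    out of [X]. *)
Lemma runs_borrow X s a n : tps s X = st (a ++ nseq n false) (size a + n) ->
  last true a ->
  runs (borrow X) (2 * n).+1 s (fun s' =>
    tps s' X = st (a ++ nseq n true) (size a) /\ fr [:: X] s s').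
Proof.
move=> e ha.
pose J k s' := [/\ tps s' X = st (a ++ nseq k false ++ nseq (n - k) true) (size a +
  k), k <= n & fr [:: X] s s'].
eapply runs_le.
  lst (@runs_loop _ _ blank nb x (fun r : reads =>
    bit (rtp r X) == Some false) (setb X true GoLeft) 1 J n).
  - move=> k s' [e' hk _]; rewrite addnS in e'; rewrite (look_bit x e').
    by rewrite onth_cat ltnNge leq_addr addKn onth_cat size_nseq ltnSn onth_nseq
      ltnSn.
  - move=> s' [e' _ _]; rewrite addn0 in e'.
    case/lastP: a {J e} ha e' => [|a b] ha e'; first by rewrite /= e'.
    move: ha; rewrite last_rcons => hb; rewrite size_rcons in e';
      rewrite (look_bit x e').
    by rewrite cat_rcons onth_cat ltnn subnn /= hb.
  - move=> k s' [e' hk F].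
    rewrite -rcons_nseq cat_rcons addnS -[in size a + k](size_nseq k false)
      -size_cat catA in e'.
    lst (runs_setb true GoLeft e'); move=> s2 [e2 F2].
    exists k => //; split; [|lia|by frs].
    rewrite e2 /= size_cat size_nseq -catA; congr (st (_ ++ (_ ++ _)) _).
    by have -> : n - k = (n - k.+1).+1 by lia.
  - by split=> //; rewrite subnn cats0.
  - by move=> s' [e' _ F]; rewrite subn0 addn0 in e'.
by lia.
Qed.

Lemma borrow_val a n :
  bits_val (a ++ true :: nseq n false) = (bits_val (a ++ false :: nseq n true)).+1.
Proof.
rewrite !bits_val_cat /= !size_nseq -addnS; congr (_ + _).
rewrite -[true :: _]/([:: true] ++ _) -[false :: _]/([:: false] ++ _) !bits_val_cat.
by rewrite bits_val_nseq0 /= !size_nseq -addnS bits_val_nseq1 addn0 /bits_val /=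
  mul1n.
Qed.

(* Decrements X once for each symbol of P, until a borrow out of X shows that
   the head of P has reached the address that was on X. *)
Definition seek X P R := While (fun r : reads => nb_ P r && ~~ nb_ R r)
  (Seq (borrow X) (If (nb_ X)
    (Seq (setb X false Stay) (Seq (toend X) (mv P GoRight)))
    (setr R (fun r => bit (rtp r P))))).

Lemma look_reg R s o : tps s R = reg o -> nb_ R (look x s) = o.
Proof. by rewrite /nb_ /= => ->. Qed.

Lemma runs_seek X P R s p c : X != P -> X != R -> P != R ->
  tps s P = st p 1 -> tps s X = st c (size c) -> tps s R = blank0 ->
  runs (seek X P R) (size p * (6 * size c + 20)).+1 s (fun s' =>
    fr [:: X; P; R] s s' /\ exists q c', [/\ tps s' P = st p q, q <= (size p).+1,
      size c' = size c &
      [/\ bits_val c < size p, tps s' R = reg (onth p (bits_val c))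
        & tps s' X = st c' 0] \/
      [/\ bits_val c' + size p = bits_val c, tps s' R = blank0
        & tps s' X = st c' (size c')]]).
Proof.
move=> XP XR PR eP eX eR.
(* There are [k] symbols of the prefix left, and the number on [X] has been lowered by the count of
   those passed. *)
pose A k s' c' := [/\ tps s' P = st p (size p - k).+1, k <= size p,
  tps s' X = st c' (size c'), tps s' R = reg None &
  bits_val c' + (size p - k) = bits_val c].
(* The second alternative is the success case: the symbol is on [R], and the measure has dropped
   straight to 0. *)
pose J k s' := fr [:: X; P; R] s s' /\ exists2 c', size c' = size c &
  A k s' c' \/ [/\ k = 0, exists q, tps s' P = st p q /\ q <= (size p).+1,
    bits_val c < size p, tps s' R = reg (onth p (bits_val c))
    & tps s' X = st c' 0].
eapply runs_le.
  lst (@runs_loop _ _ blank nb x (fun r : reads =>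
    nb_ P r && ~~ nb_ R r) _ (6 * size c + 19) J (size p)).
  - move=> k s' [_ [c' _ [[hP hk _ hR _]|[]//]]].
    by rewrite (look_reg hR) (look_nb x hP) /= andbT; lia.
  - move=> s' [_ [c' _ [[hP hk _ hR _]|[_ _ h hR _]]]].
      by rewrite (look_nb x hP) subn0 ltnn andbF.
    by rewrite (look_reg hR) onthTE h andbF.
  - move=> k s' [F [c' hc [[hP hk hX hR hv]|[]//]]].
    case: (nseq0P c') => [[n En]|[[a n] /= En]]; rewrite En in hc hX hv.
      eapply runs_le.
        sq (runs_borrow (a := [::]) (n := n)) => //; first by rewrite hX size_nseq.
        move=> s1 [/= hX1 F1]; apply: runs_If; rewrite (look_nb x hX1) /=.
        have hR1 : tps s1 R = reg None by keep.
        lst (runs_setr _ hR1).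
        move=> s2 [hR2 F2]; exists 0 => //; split; first by frs.
        exists (nseq n true); first by rewrite size_nseq -hc size_nseq.
        have hP1 : tps s1 P = st p (size p - k.+1).+1 by keep.
        move: hv; rewrite bits_val_nseq0 add0n => hv.
        right; split=> //.
        + by exists (size p - k.+1).+1; split; [keep|lia].
        + by rewrite -hv; lia.
        + by rewrite hR2 /= hP1 -hv.
        + by keep.
      by rewrite -hc size_nseq; lia.
    eapply runs_le.
      sq (runs_borrow (a := rcons a true) (n := n)).
      + by rewrite hX cat_rcons size_cat size_rcons /= size_nseq addSnnS.
      + by rewrite last_rcons.
      move=> s1 [hX1 F1]; apply: runs_If.
      rewrite (look_nb x hX1) size_rcons size_cat size_rcons leq_addr /=.
      rewrite cat_rcons size_rcons in hX1.
      sq (runs_setb false Stay hX1); move=> s2 [/= hX2 F2].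
      have Es : size (a ++ false :: nseq n true) = size c.
        by rewrite -hc !size_cat /= !size_nseq.
      sq (runs_toend hX2); first by rewrite size_cat /= size_nseq; lia.
      move=> s3 [hX3 F3].
      have hP3 : tps s3 P = st p (size p - k.+1).+1 by keep.
      lst (runs_mv P GoRight s3).
      move=> s4 [hP4 F4]; exists k => //; split; first by frs.
      exists (a ++ false :: nseq n true) => //; left; split.
      + by rewrite hP4 hP3 /=; congr (st _ _); lia.
      + by lia.
      + by rewrite -hX3; keep.
      + by rewrite -hR; keep.
      + by move: hv; rewrite borrow_val; lia.
    rewrite size_cat /= size_nseq; move: hc; rewrite size_cat /= size_nseq; lia.
  - split; [by frs|exists c => //; left; split; rewrite ?subnn ?addn0 ?reg_None //].
  - move=> s' [F [c' hc [[hP hk hX hR hv]|[_ [q [hP hq]] h1 h2 h3]]]]; split=> //.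
      exists (size p).+1, c'; rewrite subn0 in hP hv; split=> //.
      by right; split=> //; rewrite -reg_None.
    by exists q, c'; split=> //; left.
by lia.
Qed.

Lemma runs_WA g d s : runs (WA g d) 1 s (fun s' => [/\ tps s' = tps s,
  adr s' = (if g (look x s) is Some b then
    if apo s < size (adr s) then set_nth false (adr s) (apo s) b else adr s
    else adr s),
  apo s' = minn (shift d (apo s)) (size (adr s)) & wf s']).
Proof.
apply: runs_Do; split=> //; last exact: wf_perf.
by apply: functional_extensionality => k; rewrite /= /stept /=; case: (tps s k).
Qed.

Lemma runs_zeros X s a n c :
  tps s X = st (a ++ nseq n false ++ c) (size a + n) -> last true a ->
  runs (While (fun r : reads => bit (rtp r X) == Some false) (mv X GoLeft))
    (2 * n).+1 s (fun s' =>
    tps s' X = st (a ++ nseq n false ++ c) (size a) /\ fr [:: X] s s').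
Proof.
move=> e ha.
pose J k s' := [/\ tps s' X = st (a ++ nseq n false ++ c) (size a + k),
  k <= n & fr [:: X] s s'].
eapply runs_le.
  lst (@runs_loop _ _ blank nb x (fun r : reads =>
    bit (rtp r X) == Some false) (mv X GoLeft) 1 J n).
  - move=> k s' [e' hk _]; rewrite addnS in e'; rewrite (look_bit x e').
    by rewrite onth_cat ltnNge leq_addr addKn onth_cat size_nseq hk onth_nseq hk.
  - move=> s' [e' _ _]; rewrite addn0 in e'.
    case/lastP: a {J e} ha e' => [|a b] ha e'; first by rewrite /= e'.
    move: ha; rewrite last_rcons => hb; rewrite size_rcons in e';
      rewrite (look_bit x e').
    by rewrite cat_rcons onth_cat ltnn subnn /= hb.
  - move=> k s' [e' hk F]; lst (runs_mv _ _ _); move=> s2 [e2 F2].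
    exists k => //; split; [by rewrite e2 e' addnS|lia|by frs].
  - by [].
  - by move=> s' [e' _ F]; rewrite addn0 in e'.
by lia.
Qed.

(** The address tape has a fixed number [l] of cells, while the number on [X] may be shorter or
    longer. Its last [l] bits are copied from the right, padded with zeros, the unary tape [W]
    counting them. A one found in the rest puts the address past the input, and then [R] keeps its
    blank. *)
Definition load X W R :=
  Seq (toend W) (Seq (WA (fun=> None) Stay)
  (Seq (While (fun r : reads => rad r) (WA (fun=> None) GoRight))
  (Seq (WA (fun=> None) GoLeft)
  (Seq (While (nb_ W)
    (Seq (WA (fun r => Some (odflt false (bit (rtp r X)))) GoLeft)
      (Seq (mv X GoLeft) (mv W GoLeft))))
  (Seq (While (fun r => bit (rtp r X) == Some false) (mv X GoLeft))
  (If (nb_ X) Skip (setr R (fun r => rin r)))))))).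

(** The first summand is the part of the number that [load] scans for a one, the second the padded
    part that it copies. *)
Lemma bits_val_pad l c :
  bits_val c = bits_val (take (size c - l) c) * 2 ^ l
             + bits_val (drop (size c) (nseq l false ++ c)).
Proof.
have E : bits_val c = bits_val (nseq l false ++ c) by rewrite bits_val_cat
  bits_val_nseq0.
rewrite {1}E -{1}(cat_take_drop (size c) (nseq l false ++ c)) bits_val_cat
  size_drop.
rewrite size_cat size_nseq addnK; congr (_ * _ + _).
rewrite take_cat size_nseq; case: ltnP => h.
  rewrite -[nseq l false](cat_take_drop (size c)) take_cat size_take size_nseq h
    ltnn subnn take0 cats0.
  rewrite (eqP (ltnW h : size c - l == 0)) take0 /=.
  by rewrite -(subnKC (ltnW h)) nseqD take_size_cat ?size_nseq // bits_val_nseq0.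
by rewrite bits_val_cat bits_val_nseq0.
Qed.

Lemma runs_load X W R s c : X != W -> X != R -> W != R ->
  tps s W = st (nseq (size (adr s)) true) 0 -> tps s X = st c (size c) ->
  tps s R = blank0 -> size x <= 2 ^ size (adr s) ->
  runs (load X W R) (16 * size (adr s) + 2 * size c + 30) s (fun s' =>
    [/\ frz [:: X; W; R] s s', tps s' W = tps s W,
      tps s' R = reg (onth x (bits_val c)) &
      exists2 q, q <= size c & tps s' X = st c q]).
Proof.
move=> XW XR WR eW eX eR hx; set l := size (adr s).
eapply runs_le.
  sq (runs_toend eW) => //. move=> s1 [eW1 F1]; rewrite size_nseq in eW1.
  (* This idle action clamps the address head, so that the store is well-formed from here on. *)
  sq (runs_WA _ _ _). move=> s2 [t2 a2 p2 w2].
  have A2 : adr s2 = adr s by case: F1 a2 => ->.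
  pose J1 k s' := [/\ tps s' = tps s1, adr s' = adr s, apo s' = l - k & k <= l].
  eapply runs_Seq.
    eapply (runs_le (t' := (2 * l).+1)).
    lst (@runs_loop _ _ blank nb x (fun r : reads => rad r) _ 1 J1 (l - apo s2)).
    - by move=> k s' [_ a' p' hk]; rewrite /= onthTE a' p' /l; lia.
    - by move=> s' [_ a' p' hk]; rewrite /= onthTE a' p' /l; lia.
    - move=> k s' [t' a' p' hk]; lst (runs_WA _ _ _); move=> s3 [t3 a3 p3 _].
      exists k => //; split; [by rewrite t3|by rewrite a3| |by lia].
      by rewrite p3 p' a' /= -/l; lia.
    - split; [by []|by []| |lia].
      by move: w2; rewrite /wf A2 -/l; lia.
    - by move=> s' h; exact: h.
    by lia.
  move=> s3 [t3 a3 p3 _].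
  sq (runs_WA _ _ _). move=> s4 [t4 a4 p4 w4].
  have {}p4 : apo s4 = l.-1 by rewrite p4 a3 p3 /= -/l; lia.
  have {}t4 : tps s4 = tps s1 by rewrite t4 t3.
  have {}a4 : adr s4 = adr s by rewrite a4 a3.
  (* The last [l] bits of [pad] are what the address tape will contain; the invariant says that its
     cells from [k] on are already correct. *)
  pose pad := nseq l false ++ c.
  pose J k s' := [/\ tps s' W = st (nseq l true) k /\ k <= l,
    wf s' /\ apo s' = k.-1,
    size (adr s') = l, drop k (adr s') = drop (size c + k) pad &
    tps s' X = st c (size c - (l - k)) /\ frz [:: X; W] s s'].
  eapply runs_Seq.
    lst (@runs_loop _ _ blank nb x (nb_ W) _ 3 J l).
    - by move=> k s' [[hW hk] _ _ _ _]; rewrite (look_nb x hW) size_nseq.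
    - by move=> s' [[hW hk] _ _ _ _]; rewrite (look_nb x hW).
    - move=> k s' [[hW hk] [w' p'] z' d' [hX F]].
      eapply runs_le.
        sq (runs_WA _ _ _); move=> s5 [t5 a5 p5 w5].
        have hX5 : tps s5 X = st c (size c - (l - k.+1)) by rewrite t5.
        sq (runs_mv X GoLeft s5); move=> s6 [hX6 F6].
        have hW6 : tps s6 W = st (nseq l true) k.+1 by keep; rewrite t5.
        lst (runs_mv W GoLeft s6); move=> s7 [hW7 F7].
        have F67 : fr [:: X; W] s5 s7 by frs.
        have A7 : adr s7 = set_nth false (adr s') k (odflt false (bit (rtp (look x
          s') X))).
          by case: F67 => -> _ _; rewrite a5 p' /= z' hk.
        exists k => //; split.
        + by rewrite hW7 hW6; split=> //; lia.
        + by split; [apply: fr_wf F67 w5 | case: F67 => _ -> // _;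
          rewrite p5 p' z' /=; lia].
        + by rewrite A7 size_set_nth z'; lia.
        + have hz : k < size (adr s7) by rewrite A7 size_set_nth z'; lia.
          have hp : size c + k < size pad by rewrite /pad size_cat size_nseq; lia.
          rewrite (drop_nth false hz) (drop_nth false hp) -addnS -d' A7 nth_set_nth
            /= eqxx.
          congr (_ :: _); last first.
            apply: (@eq_from_nth _ false); first by rewrite !size_drop size_set_nth
              z'; lia.
            move=> i _; rewrite !nth_drop nth_set_nth /=; case: eqP => // h; lia.
          rewrite hX /pad nth_cat size_nseq /=.
          case: ltnP => h; first by rewrite (eqP (_ : size c - (l - k.+1) == 0))
            ?nth_nseq ?h //=; lia.
          have -> : size c - (l - k.+1) = (size c + k - l).+1 by lia.
          by rewrite /= odflt_onth.
        + split; last first.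
            have F5 : frz [:: X; W] s' s5 by split;
              rewrite ?t5 // a5 p' /= z' hk size_set_nth z'; lia.
            by frzs.
          rewrite (fr_tps F7); last by dist.
          by rewrite hX6 hX5 /=; congr (st _ _); lia.
      by [].
    - split; rewrite ?a4 ?t4 //.
      + by rewrite drop_oversize // drop_oversize // size_cat size_nseq; lia.
      + rewrite subnn subn0; split; first by rewrite -eX; keep.
        split; first by rewrite a4.
        by move=> k hk; rewrite t4; apply: (fr_tps F1); move: hk;
          rewrite !inE negb_or => /andP[].
    - by move=> s' h; exact: h.
  move=> s5 [[hW5 _] [w5 p5] z5 d5 [hX5 F5]].
  rewrite drop0 addn0 in d5; rewrite subn0 in hX5.
  have hR5 : tps s5 R = reg None by rewrite reg_None -eR; keep.
  have bv := bits_val_pad l c; rewrite -/pad -d5 in bv.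
  have Ec := cat_take_drop (size c - l) c.
  have hs : size (take (size c - l) c) = size c - l by rewrite size_take;
    case: ltngtP => //; lia.
  instantiate (1 := 2 * size c + 3).
  case: (nseq0P (take (size c - l) c)) => [[n En]|[[a n] /= En]];
    rewrite En in Ec bv hs.
    rewrite size_nseq in hs.
    eapply runs_le.
    eapply runs_Seq.
      by apply: (runs_zeros (a := [::]) (n := n) (c := drop (size c - l) c)) => //=;
        rewrite Ec hX5 hs.
    move=> s6 [/= hX6 F6]; rewrite Ec in hX6; apply: runs_If;
      rewrite (look_nb x hX6) /=.
    have hR6 : tps s6 R = reg None by keep.
    have a6 : adr s6 = adr s5 by case: F6.
    lst (runs_setr _ hR6); move=> s7 [hR7 F7]; split.
    - by frzs.
    - by rewrite eW -hW5; keep.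
    - by rewrite hR7 /= a6 bv bits_val_nseq0.
    - by exists 0 => //; keep.
    by lia.
  rewrite size_cat /= size_nseq in hs.
  eapply runs_le.
  eapply runs_Seq.
    apply: (runs_zeros (X := X) (a := rcons a true) (n := n) (c := drop (size c - l)
      c)).
      by rewrite catA cat_rcons Ec hX5 size_rcons; congr (st _ _); lia.
    by rewrite last_rcons.
  move=> s6 [hX6 F6]; rewrite catA cat_rcons Ec in hX6; apply: runs_If;
    rewrite (look_nb x hX6) size_rcons /=.
  have -> : size a < size c by lia.
  lst (runs_Skip s6); move=> s7 [F7 t7]; split.
  - by frzs.
  - by rewrite t7 eW -hW5; keep.
  - rewrite t7 (_ : tps s6 R = reg None); last by keep.
    (* A one above the last [l] bits makes the address at least [2 ^ l], which is beyond the
       input. *)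
    rewrite onth_default //; apply: leq_trans hx _; rewrite bv -/l.
    rewrite borrow_val mulSn; lia.
  - by exists (size a).+1; [lia|rewrite t7 hX6 size_rcons].
  by lia.
by rewrite size_nseq; lia.
Qed.

End Core.

Arguments runs_setb {I T t0 nb x i b0} b d {s a c}.
Arguments runs_borrow {I T t0 nb x X s a n}.
Arguments runs_seek {I T t0 nb x X P R s p c}.
Arguments runs_WA {I T t0 nb x}.
Arguments runs_zeros {I T t0 nb x X s a n c}.
Arguments runs_load {I T t0 nb x X W R s c}.
Arguments look_reg {I T t0} x {R s o}.

(** * Random access to the simulated input *)

Section Core2.

Variables (I T : finType) (t0 : T) (nb : nat).
Notation sym := (sym T).
Notation sy := (sy t0).
Notation blank := (blank t0).
Notation blank0 := (blank0 t0).
Notation st := (st t0).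
Notation reg := (reg t0).
Notation store := (store I sym).
Notation reads := (reads I sym).
Notation frag := (frag I sym).
Variable x : seq bool.
Notation runs := (@runs I sym blank nb x).
Notation Skip := (Skip I sym).
Notation toend := (toend T).
Notation rewind := (rewind T).
Notation mv := (mv T).
Notation setr := (setr t0).
Notation erase := (erase t0).
Notation app := (app t0).
Notation load := (load t0).
Notation seek := (seek t0).
Implicit Types (i j X P W R : I) (s : store) (c : seq bool).

(* R receives the symbol of P ++ x at the address on X. *)
Definition core X P W R := Seq (setr R (fun=> None)) (Seq (mv P GoRight)
  (Seq (toend X) (Seq (seek X P R) (Seq (If (nb_ R) Skip (load X W R))
  (Seq (erase X) (rewind P)))))).

Definition core_time (l p c : nat) := p * (6 * c + 20) + 16 * l + 20 * c + 2 * p +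
  60.

Lemma runs_core X P W R s p c q o :
  X != P -> X != W -> X != R -> P != W -> P != R -> W != R ->
  tps s P = st p 0 -> tps s W = st (nseq (size (adr s)) true) 0 ->
  tps s X = st c q -> q <= (size c).+1 -> tps s R = reg o ->
  size x <= 2 ^ size (adr s) ->
  runs (core X P W R) (core_time (size (adr s)) (size p) (size c)) s (fun s' =>
    [/\ frz [:: X; R] s s', tps s' X = blank0 &
        tps s' R = reg (onth (p ++ x) (bits_val c))]).
Proof.
move=> XP XW XR PW PR WR eP eW eX hq eR hx.
eapply runs_le.
  sq (runs_setr _ eR); move=> s0 [eR0 F0].
  have eP0 : tps s0 P = st p 0 by keep.
  sq (runs_mv P GoRight s0); move=> s1 [eP1 F1]; rewrite eP0 /= -/(st p 1) in eP1.
  have eX1 : tps s1 X = st c q by keep.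
  sq (runs_toend eX1 hq); move=> s2 [eX2 F2].
  have eP2 : tps s2 P = st p 1 by keep.
  have eR2 : tps s2 R = blank0 by rewrite -reg_None; keep.
  sq (runs_seek XP XR PR eP2 eX2 eR2).
  move=> s3 [F3 [q' [c' [eP3 hq' hc' alt]]]].
  have W3 : tps s3 W = tps s W by keep.
  have A3 : size (adr s3) = size (adr s).
    by case: F0 F1 F2 F3 => a0 _ _ [a1 _ _] [a2 _ _] [a3 _ _]; rewrite a3 a2 a1 a0.
  pose K s' := [/\ frz [:: X; P; W; R] s3 s', tps s' W = tps s W,
    tps s' P = tps s3 P,
    tps s' R = reg (onth (p ++ x) (bits_val c)) & exists2 q,
      q <= size c' & tps s' X = st c' q].
  eapply (@runs_Seq _ _ _ _ _ _ _ _ _ _ K).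
    apply: runs_If; case: alt => [[h eR3 eX3]|[h eR3 eX3]].
      rewrite (look_reg x eR3) onthTE h.
      eapply runs_le.
        lst (runs_Skip s3); move=> s4 [F4 t4]; split; rewrite ?t4 //; first by frzs.
          by rewrite onth_cat h.
        by exists 0.
      by instantiate (1 := 16 * size (adr s) + 2 * size c + 30); lia.
    have eN : tps s3 R = reg None by rewrite reg_None.
    rewrite (look_reg x eN).
    eapply runs_le.
      have hx3 : size x <= 2 ^ size (adr s3) by rewrite A3.
      have eW3 : tps s3 W = st (nseq (size (adr s3)) true) 0 by rewrite W3 eW A3.
      lst (runs_load XW XR WR eW3 eX3 eR3 hx3).
      move=> s4 [F4 eW4 eR4 eX4]; split=> //; [by frzs|by rewrite eW4|by keep|].
      rewrite eR4 onth_cat ltnNge -h leq_addl /=; congr (reg (onth _ _)).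
      by rewrite addnK.
    by rewrite A3 hc'.
  move=> s4 [F4 eW4 eP4 eR4 [q4 hq4 eX4]].
  have E5 := @runs_erase I T t0 nb x X s4 c' q4 eX4 (leqW hq4); rewrite hc' in E5.
  sq E5.
  move=> s5 [eX5 F5].
  have eP5 : tps s5 P = st p q' by rewrite -eP3 -eP4; keep.
  lst (runs_rewind eP5 hq'); move=> s6 [eP6 F6]; split; [|by keep|by keep].
  apply: (@frz_drop _ _ _ W); last by rewrite -eW4; keep.
  apply: (@frz_drop _ _ _ P); last by rewrite eP.
  by frzs.
by rewrite /core_time; lia.
Qed.

(** The head of [A] must return to its place, because it is the head of a simulated tape. Its cell,
    possibly the blank one past the end, is marked before the pass and searched for afterwards. *)
Definition copy A X :=
  Seq (W1 A (fun r => Some (sy (bit (rtp r A)) true)) Stay)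
  (Seq (mv A GoLeft) (Seq (While (nb_ A) (mv A GoLeft)) (Seq (mv A GoRight)
  (Seq (While (nb_ A) (Seq (app X (fun r => bit (rtp r A) == Some true)) (mv A
    GoRight)))
  (Seq (While (fun r : reads => ~~ mkd (rtp r A)) (mv A GoLeft))
  (W1 A (fun r => Some (sy (bit (rtp r A)) false)) Stay)))))).

Definition mst (a : seq bool) (p0 p : nat) : tape sym :=
  (fun q => if q is q'.+1 then sy (onth a q') (q == p0) else blank, p).

Lemma look_mst A s a p0 p : tps s A = mst a p0 p ->
  nb_ A (look x s) = (0 < p <= size a).
Proof. by rewrite /nb_ /= => ->; case: p => //= p; rewrite onthTE. Qed.

Lemma runs_copy A X s a c p : A != X ->
  tps s A = st a p -> 0 < p <= (size a).+1 -> tps s X = st c (size c).+1 ->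
  runs (copy A X) (8 * size a + 12) s (fun s' =>
    fr [:: X] s s' /\ tps s' X = st (c ++ a) (size (c ++ a)).+1).
Proof.
move=> AX eA hp eX; eapply runs_le.
  sq (runs_W1 _ _ _ _); move=> s1 [eA1 F1].
  have {}eA1 : tps s1 A = mst a p p.
    case: p hp eA eA1 => // p hp eA ->; rewrite eA; congr (_, _).
    by apply: functional_extensionality => -[|q] //=; rewrite !eqSS eA /=;
      case: eqP => [->|].
  sq (runs_mv _ _ _); move=> s2 [eA2 F2].
  have eX2 : tps s2 X = st c (size c).+1 by keep.
  pose J k s' := [/\ tps s' A = mst a p k, k <= size a & fr [:: A] s2 s'].
  eapply runs_Seq.
    eapply (runs_le (t' := (2 * size a).+1)).
    lst (@runs_loop _ _ blank nb x (nb_ A) (mv A GoLeft) 1 J p.-1).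
    - by move=> k s' [e' hk _]; rewrite (look_mst e').
    - by move=> s' [e' hk _]; rewrite (look_mst e').
    - move=> k s' [e' hk F]; lst (runs_mv _ _ _); move=> s3 [e3 F3].
      by exists k => //; split; [rewrite e3 e'|lia|frs].
    - by split; [rewrite eA2 eA1|lia|frs].
    - by move=> s' h; exact: h.
    by lia.
  move=> s3 [eA3 _ F3].
  sq (runs_mv _ _ _); move=> s4 [eA4 F4].
  have eX4 : tps s4 X = st c (size c).+1 by keep.
  pose J2 k s' := [/\ tps s' A = mst a p (size a - k).+1, k <= size a,
    tps s' X = st (c ++ take (size a - k) a) (size c + (size a - k)).+1
    & fr [:: A; X] s4 s'].
  eapply runs_Seq.
    lst (@runs_loop _ _ blank nb x (nb_ A) _ 2 J2 (size a)).
    - by move=> k s' [e' hk _ _]; rewrite (look_mst e'); lia.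
    - by move=> s' [e' hk _ _]; rewrite (look_mst e'); lia.
    - move=> k s' [e' hk eX' F]; eapply runs_le.
        have hs : size a - k.+1 < size a by lia.
        have hz : size (c ++ take (size a - k.+1) a) = size c + (size a - k.+1).
          by rewrite size_cat size_take hs.
        rewrite -hz in eX'.
        sq (runs_app (fun r => bit (rtp r A) == Some true) eX'); move=> s5 [eX5 F5].
        have eA5 : tps s5 A = mst a p (size a - k.+1).+1 by keep.
        lst (runs_mv _ _ _); move=> s6 [eA6 F6].
        have E : size a - k = (size a - k.+1).+1 by lia.
        exists k => //; split; [by rewrite eA6 eA5 E|lia| |by frs].
        rewrite (fr_tps F6) ?eX5; last by dist.
        rewrite hz E -addnS rcons_cat; congr (st (c ++ _) _).
        rewrite /= e' /= (take_nth false hs); congr rcons.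
        by move: hs; rewrite -onthTE -(odflt_onth false); case: (onth a _) => [[]|].
      by [].
    - by rewrite /J2 subnn addn0 take0 cats0 eA4 eA3.
    - by move=> s' h; exact: h.
  move=> s5 [eA5 _ eX5 F5]; rewrite subn0 in eA5 eX5; rewrite take_size in eX5.
  pose J3 k s' := [/\ tps s' A = mst a p (p + k),
    p + k <= (size a).+1 & fr [:: A] s5 s'].
  eapply runs_Seq.
    eapply (runs_le (t' := (2 * size a).+1)).
    lst (@runs_loop _ _ blank nb x (fun r : reads =>
      ~~ mkd (rtp r A)) (mv A GoLeft) 1 J3 ((size a).+1 - p)).
    - move=> k s' [e' hk _]; rewrite /= e' addnS /= /mkd /=; lia.
    - move=> s' [e' hk _]; rewrite /= e' addn0 /=; case: (p) hp => //= n _.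
      by rewrite /mkd /= eqxx.
    - move=> k s' [e' hk F]; lst (runs_mv _ _ _); move=> s6 [e6 F6].
      by exists k => //; split; [rewrite e6 e' addnS|lia|frs].
    - split; [by rewrite eA5; congr (mst _ _ _); lia|lia|by frs].
    - by move=> s' h; exact: h.
    by lia.
  move=> s6 [eA6 _ F6]; rewrite addn0 in eA6.
  lst (runs_W1 _ _ _ _); move=> s7 [eA7 F7]; split; last first.
    by rewrite size_cat -eX5; keep.
  apply: (@fr_drop _ _ _ A); first by frs.
  rewrite eA7 eA6 eA; congr (_, _); apply: functional_extensionality => q /=.
  case: p hp {eA eA1 J J2 J3 eA2 eA3 eA5} eA6 => // p hp eA6.
  rewrite eA6 /=; case: eqP => [->//|]; case: q => //= q; rewrite eqSS;
    by case: eqP => // ->.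
by lia.
Qed.

(* With b, the address read is 2 ^ size a plus that on A. *)
Definition vread (b : bool) A X P W R := Seq (mv X GoRight)
  (Seq (if b then app X (fun=> true) else Skip) (Seq (copy A X) (core X P W R))).

Definition vread_time (l p a : nat) := core_time l p a.+1 + 8 * a + 14.

Lemma runs_vread b A X P W R s a n p o :
  A != X -> A != P -> A != W -> A != R ->
  X != P -> X != W -> X != R -> P != W -> P != R -> W != R ->
  tps s A = st a n -> 0 < n <= (size a).+1 ->
  tps s P = st p 0 -> tps s W = st (nseq (size (adr s)) true) 0 ->
  tps s X = blank0 -> tps s R = reg o ->
  size x <= 2 ^ size (adr s) ->
  runs (vread b A X P W R) (vread_time (size (adr s)) (size p) (size a)) s (fun s'
    =>
    frz [:: R] s s' /\
    tps s' R = reg (onth (p ++ x) (bits_val (nseq b true ++ a)))).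
Proof.
move=> AX AP AW AR XP XW XR PW PR WR eA hn eP eW eX eR hx.
eapply runs_le.
  sq (runs_mv _ _ _); move=> s1 [eX1 F1].
  have {}eX1 : tps s1 X = st [::] 1 by rewrite eX1 eX st_nil.
  eapply (@runs_Seq _ _ _ _ _ _ _ 1 _ _ (fun s2 => fr [:: X] s s2 /\
    tps s2 X = st (nseq b true) (size (nseq b true)).+1)).
    case: b; first by lst (runs_app (fun=> true) eX1); move=> s2 [eX2 F2];
      split=> //; frs.
    by lst (runs_Skip s1); move=> s2 [F2 t2]; split; [frs|rewrite t2 eX1].
  move=> s2 [F2 eX2].
  have eA2 : tps s2 A = st a n by keep.
  sq (runs_copy AX eA2 hn eX2); move=> s3 [F3 eX3].
  have eP3 : tps s3 P = st p 0 by keep.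
  have A3 : adr s3 = adr s by case: F2 F3 => a2 _ _ [a3 _ _]; rewrite a3 a2.
  have eW3 : tps s3 W = st (nseq (size (adr s3)) true) 0 by rewrite A3; keep.
  have eR3 : tps s3 R = reg o by keep.
  have hx3 : size x <= 2 ^ size (adr s3) by rewrite A3.
  have C := @runs_core X P W R s3 p _ _ o XP XW XR PW PR WR eP3 eW3 eX3 (leqnn _)
    eR3 hx3.
  rewrite A3 in C; lst C; move=> s4 [F4 eX4 eR4]; split=> //.
  by apply: (@frz_drop _ _ _ X); [frzs|rewrite eX4 eX].
rewrite /vread_time /core_time size_cat size_nseq; case: b => /=;
  rewrite ?addn0 ?add1n; nia.
Qed.

End Core2.

Arguments runs_core {I T t0 nb x X P W R s p c q o}.
Arguments runs_copy {I T t0 nb x A X s a c p}.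
Arguments runs_vread {I T t0 nb x} b {A X P W R s a n p o}.

(** * Writing a query and finding the length of the address tape *)

Section Query.

Variables (I T : finType) (t0 : T) (nb : nat).
Notation sym := (sym T).
Notation sy := (sy t0).
Notation blank := (blank t0).
Notation blank0 := (blank0 t0).
Notation st := (st t0).
Notation reg := (reg t0).
Notation store := (store I sym).
Notation reads := (reads I sym).
Notation frag := (frag I sym).
Variable x : seq bool.
Notation runs := (@runs I sym blank nb x).
Notation Skip := (Skip I sym).
Notation toend := (toend T).
Notation rewind := (rewind T).
Notation mv := (mv T).
Notation setr := (setr t0).
Notation erase := (erase t0).
Notation app := (app t0).
Notation load := (load t0).
Notation seek := (seek t0).
Notation vread := (vread t0).
Implicit Types (i j X P W R : I) (s : store) (c : seq bool).


Definition emit G P := Seq (mv G GoRight)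
  (Seq (While (nb_ G) (Seq (app P (fun=> true))
    (Seq (app P (fun r => bit (rtp r G) == Some true)) (mv G GoRight))))
  (Seq (app P (fun=> false)) (rewind G))).

Lemma onth_true (g : seq bool) (i : nat) : i < size g ->
  (onth g i == Some true) = nth false g i.
Proof. by rewrite -onthTE -odflt_onth; case: (onth g i) => [[]|]. Qed.

Lemma runs_emit G P s g c : G != P -> tps s G = st g 0 ->
  tps s P = st c (size c).+1 ->
  runs (emit G P) (6 * size g + 5) s (fun s' => fr [:: P] s s' /\
    tps s' P = st (c ++ self_delimiting g) (size (c ++ self_delimiting g)).+1).
Proof.
move=> GP eG eP; eapply runs_le.
  sq (runs_mv _ _ _); move=> s1 [eG1 F1].
  pose fl g := flatten [seq [:: true; b] | b <- g] : seq bool.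
  have fl_rcons h b : fl (rcons h b) = rcons (rcons (fl h) true) b.
    by rewrite /fl map_rcons flatten_rcons -!cats1 -catA.
  pose J k s' := [/\ tps s' G = st g (size g - k).+1, k <= size g,
    tps s' P = st (c ++ fl (take (size g - k) g)) (size (c ++ fl (take (size g - k)
      g))).+1
    & fr [:: G; P] s1 s'].
  eapply runs_Seq.
    lst (@runs_loop _ _ blank nb x (nb_ G) _ 3 J (size g)).
    - by move=> k s' [e' hk _ _]; rewrite (look_nb x e'); lia.
    - by move=> s' [e' hk _ _]; rewrite (look_nb x e'); lia.
    - move=> k s' [e' hk eP' F]; eapply runs_le.
        sq (runs_app (fun=> true) eP'); move=> s2 [eP2 F2].
        have eP2' : tps s2 P = st (rcons (c ++ fl (take (size g - k.+1) g)) true)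
           (size (rcons (c ++ fl (take (size g - k.+1) g)) true)).+1 by rewrite
             size_rcons.
        have eG2 : tps s2 G = st g (size g - k.+1).+1 by keep.
        sq (runs_app (fun r => bit (rtp r G) == Some true) eP2');
          move=> s3 [eP3 F3].
        lst (runs_mv _ _ _); move=> s4 [eG4 F4].
        have hs : size g - k.+1 < size g by lia.
        have E : size g - k = (size g - k.+1).+1 by lia.
        exists k => //; split; [|lia| |by frs].
          by rewrite eG4 (fr_tps F3) ?eG2 ?E //; dist.
        rewrite (fr_tps F4) ?eP3; last by dist.
        rewrite E (take_nth false hs) fl_rcons -!rcons_cat !size_rcons.
        congr (st (rcons _ _) _).
        by rewrite /= eG2 /= onth_true.
      by [].
    - split; rewrite ?subnn ?take0 ?cats0 //; first by rewrite eG1 eG.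
      by keep.
    - by move=> s' h; exact: h.
  move=> s2 [eG2 _ eP2 F2]; rewrite subn0 take_size in eG2 eP2.
  sq (runs_app (fun=> false) eP2); move=> s3 [eP3 F3].
  have eG3 : tps s3 G = st g (size g).+1 by keep.
  lst (runs_rewind eG3 (leqnn _)).
  move=> s4 [eG4 F4]; split.
    apply: (@fr_drop _ _ _ G); [by frs|by rewrite eG4].
  rewrite (fr_tps F4) ?eP3; last by dist.
  by rewrite /self_delimiting -rcons_cat size_rcons.
by lia.
Qed.

Definition put_prefix (t : gate_type) Gu Gv P := Seq (mv P GoRight) (Seq (emit Gu P)
  (Seq (app P (fun=> nth false (type_code t) 0))
  (Seq (app P (fun=> nth false (type_code t) 1))
  (Seq (emit Gv P) (rewind P))))).

Definition query_prefix t (gu gv : seq bool) :=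
  self_delimiting gu ++ type_code t ++ self_delimiting gv.

Lemma size_self_delimiting g : size (self_delimiting g) = (2 * size g).+1.
Proof. by rewrite /self_delimiting size_rcons; congr _.+1; elim: g => //= b g ->;
  lia. Qed.

Lemma size_query_prefix t gu gv :
  size (query_prefix t gu gv) = 2 * (size gu + size gv) + 4.
Proof. by rewrite /query_prefix !size_cat !size_self_delimiting; case: t => /=; lia.
Qed.

Lemma runs_prefix t Gu Gv P s gu gv : Gu != P -> Gv != P ->
  tps s Gu = st gu 0 -> tps s Gv = st gv 0 -> tps s P = blank0 ->
  runs (put_prefix t Gu Gv P) (12 * (size gu + size gv) + 30) s (fun s' =>
    fr [:: P] s s' /\ tps s' P = st (query_prefix t gu gv) 0).
Proof.
move=> uP vP eu ev eP; eapply runs_le.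
  sq (runs_mv _ _ _); move=> s1 [eP1 F1].
  have {}eP1 : tps s1 P = st [::] 1 by rewrite eP1 eP st_nil.
  have eu1 : tps s1 Gu = st gu 0 by keep.
  sq (runs_emit uP eu1 eP1); move=> s2 [F2 eP2]; rewrite cat0s in eP2.
  sq (runs_app (fun=> nth false (type_code t) 0) eP2); move=> s3 [eP3 F3].
  rewrite -(size_rcons _ (nth false (type_code t) 0)) in eP3.
  sq (runs_app (fun=> nth false (type_code t) 1) eP3); move=> s4 [eP4 F4].
  rewrite -(size_rcons _ (nth false (type_code t) 1)) in eP4.
  have ev4 : tps s4 Gv = st gv 0 by keep.
  sq (runs_emit vP ev4 eP4); move=> s5 [F5 eP5].
  have Ep : rcons (rcons (self_delimiting gu) (nth false (type_code t) 0)) (nth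
    false (type_code t) 1) ++
    self_delimiting gv = query_prefix t gu gv.
    by rewrite /query_prefix -!cats1 -!catA; case: t {eP3 eP4 eP5}.
  rewrite Ep in eP5.
  lst (runs_rewind eP5 (leqnn _)); move=> s6 [eP6 F6]; split=> //; by frs.
by rewrite size_query_prefix; lia.
Qed.

(** The [e] zeros on [A] play two parts: with a one in front they are the address [2 ^ e] to be
    probed, and in the end they are the initial address tape of the decider. *)
Definition init_addr A X P W R := Seq (mv A GoRight) (Seq (vread true A X P W R)
  (Seq (While (nb_ R) (Seq (While (nb_ A) (mv A GoRight))
     (Seq (W1 A (fun=> Some (sy (Some false) false)) Stay) (vread true A X P W R))))
  (Seq (rewind A) (mv A GoRight)))).

Definition init_addr_time (l p a : nat) := a.+1 * (vread_time l p a + 2 * a + 10).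

Lemma vread_time_mono l p a a' : a <= a' -> vread_time l p a <= vread_time l p a'.
Proof.
move=> h; rewrite /vread_time /core_time.
have : p * (6 * a.+1 + 20) <= p * (6 * a'.+1 + 20) by rewrite leq_mul2l; lia.
lia.
Qed.

Lemma runs_init_addr A X P W R s p :
  A != X -> A != P -> A != W -> A != R ->
  X != P -> X != W -> X != R -> P != W -> P != R -> W != R ->
  tps s A = blank0 ->
  tps s P = st p 0 -> tps s W = st (nseq (size (adr s)) true) 0 ->
  tps s X = blank0 -> tps s R = blank0 ->
  size x <= 2 ^ size (adr s) ->
  let n := clog (size (p ++ x)) in
  runs (init_addr A X P W R) (init_addr_time (size (adr s)) (size p) n) s
    (fun s' => frz [:: A; R] s s' /\ tps s' A = st (nseq n false) 1 /\
       exists o, tps s' R = reg o).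
Proof.
move=> AX AP AW AR XP XW XR PW PR WR eA eP eW eX eR hx n.
set l := size (adr s); set v := vread_time l (size p) n.
pose K q (m : nat) s' := [/\ frz [:: A; R] s s',
  0 < q <= m.+1 & tps s' A = st (nseq m false) q].
have V m q s1 o : m <= n -> K q m s1 -> tps s1 R = reg o ->
    runs (vread true A X P W R) v s1
      (fun s' => K q m s' /\ tps s' R = reg (onth (p ++ x) (2 ^ m))).
  move=> hm [F1 hq eA1] eR1.
  have z1 : size (adr s1) = size (adr s) by case: F1.
  have eP1 : tps s1 P = st p 0 by keep.
  have eX1 : tps s1 X = blank0 by keep.
  have eW1 : tps s1 W = st (nseq (size (adr s1)) true) 0 by rewrite z1; keep.
  have hx1 : size x <= 2 ^ size (adr s1) by rewrite z1.
  have hq1 : 0 < q <= (size (nseq m false)).+1 by rewrite size_nseq.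
  have C := @runs_vread _ _ t0 nb x true _ _ _ _ _ _ _ _ _ _ AX AP AW AR XP XW XR PW
    PR WR eA1 hq1 eP1 eW1 eX1 eR1 hx1.
  eapply runs_le.
    lst C; move=> s2 [F2 eR2]; split.
      by split; [frzs|by []|keep].
    rewrite eR2; congr (reg (onth _ _)).
    by rewrite bits_val_cat size_nseq bits_val_nseq0 addn0 mul1n.
  by rewrite size_nseq z1; apply: vread_time_mono.
eapply runs_le.
  sq (runs_mv _ _ _); move=> s1 [eA1 F1].
  have K1 : K 1 0 s1 by split=> //; [frzs|rewrite eA1 eA /= st_nil].
  eapply runs_Seq; first by apply: (V _ _ _ None _ K1) => //; rewrite reg_None;
    keep.
  move=> s2 [K2 eR2].
  pose J k s' := exists m q, [/\ k = n - m, m <= n,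
    K q m s' & tps s' R = reg (onth (p ++ x) (2 ^ m))].
  (* A probe at [2 ^ m] succeeds exactly as long as [m] is below the logarithm, so the loop stops at
     the right length. *)
  have lt m : (2 ^ m < size (p ++ x)) = (m < n).
    apply/idP/idP => h; rewrite ltnNge; apply/negP => h'.
      have := up_logP (size (p ++ x)) (isT : 1 < 2); rewrite -/(clog _) -/n => h2.
      have := leq_pexp2l (isT : 0 < 2) h'; olia.
    by have := up_log_min (isT : 1 < 2) h'; rewrite -/(clog _) -/n; olia.
  eapply runs_Seq.
    lst (@runs_loop _ _ blank nb x (nb_ R) _ (v + 2 * n + 3) J n).
    - move=> k s' [m [q [hk hm _ hR]]]; rewrite (look_reg x hR) onthTE lt; olia.
    - move=> s' [m [q [hk hm _ hR]]]; rewrite (look_reg x hR) onthTE lt; olia.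
    - move=> k s' [m [q [hk hm [F hq eA'] hR]]]; eapply runs_le.
        have hq' : 0 < q <= (size (nseq m false)).+1 by rewrite size_nseq.
        sq (goR eA' hq'); move=> s3 [eA3 F3]; rewrite size_nseq in eA3.
        sq (runs_W1 _ _ _ _); move=> s4 [eA4 F4].
        have hR4 : tps s4 R = reg (onth (p ++ x) (2 ^ m)) by keep.
        have K4 : K m.+1 m.+1 s4.
          split; [by frzs|olia|].
          rewrite eA4 eA3 -rcons_nseq /stept /=.
          have H := st_rcons t0 (nseq m false) false; rewrite size_nseq in H.
          exact: (f_equal (fun f => (f, m.+1)) H).
        have hm1 : m < n by olia.
        lst (V _ _ _ _ hm1 K4 hR4).
        move=> s5 [K5 R5]; exists k => //; exists m.+1, m.+1; split=> //; olia.
      by rewrite size_nseq; olia.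
    - by exists 0, 1; rewrite subn0.
    - by move=> s' h; exact: h.
  move=> s3 [m [q [hk hm [F3 hq eA3] R3]]].
  have Em : m = n by olia.
  rewrite {m hk hm}Em in hq eA3 R3.
  have hq3 : q <= (size (nseq n false)).+1 by rewrite size_nseq; olia.
  sq (runs_rewind eA3 hq3).
  move=> s4 [eA4 F4].
  lst (runs_mv _ _ _); move=> s5 [eA5 F5]; split; first by frzs.
  split; first by rewrite eA5 eA4.
  by eexists; keep; exact: R3.
by rewrite size_nseq /init_addr_time -/v; nia.
Qed.

End Query.

Arguments runs_emit {I T t0 nb x G P s g c}.
Arguments runs_prefix {I T t0 nb x} t {Gu Gv P s gu gv}.
Arguments runs_init_addr {I T t0 nb x A X P W R s p}.

(** * Simulating the decider *)

Lemma onth_set_nth (s : seq bool) i b j : i < size s ->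
  onth (set_nth false s i b) j = if j == i then Some b else onth s j.
Proof.
move=> hi; have z : size (set_nth false s i b) = size s.
  by rewrite size_set_nth (maxn_idPr hi).
case: (ltnP j (size s)) => hj; last by rewrite !onth_default ?z //; case: eqP => //;
  lia.
by rewrite !onthE !(nth_map false) ?z // nth_set_nth /=; case: eqP.
Qed.

Section Steps.

Variables (M : ratm) (w : seq bool).

Fixpoint nsteps n (c c' : config M) : Prop :=
  if n is n'.+1 then exists2 c1, Defs.next w c c1 & nsteps n' c1 c' else c = c'.

Lemma nsteps_rcons n c c1 c2 : nsteps n c c1 -> Defs.next w c1 c2 -> nsteps n.+1 c
  c2.
Proof.
elim: n c => [|n IH] c /=; first by move=> -> h; exists c2.
by move=> [c' h1 h2] h; exists c' => //; apply: IH.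
Qed.

Lemma run_nsteps s b c : @run M w s b c -> nsteps s (init M w) c.
Proof. by elim=> {s b c} // s b c c' _ IH n; apply: nsteps_rcons IH n. Qed.

End Steps.

Section Sim.

Variables (D : ratm) (I : finType) (nb : nat).
Hypothesis detD : deterministic D.

Definition dT : finType := (rm_symbol D * rm_state D)%type.
(** The payload of a blank cell. Fresh tapes therefore already represent the blank tapes of [D], and
    a fresh [Q] its start state. *)
Definition d0 : dT := (rm_blank D, rm_start D).
Definition role : finType := (bool * bool * bool + 'I_(rm_tapes D))%type.
(* A, X, P and R hold D's address tape, its copy for vread, the query prefix and
   the symbol D reads, Q holds the state of D, G the number of a gate, and Z stays
   blank; U is for unary counters and spare. *)
Definition rA : role := inl (true, true, true).
Definition rX : role := inl (true, true, false).
Definition rP : role := inl (true, false, true).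
Definition rR : role := inl (true, false, false).
Definition rQ : role := inl (false, true, true).
Definition rZ : role := inl (false, true, false).
Definition rG : role := inl (false, false, true).
Definition rU : role := inl (false, false, false).

Notation sym := (sym dT).
Notation sy := (sy d0).
Notation blank := (blank d0).
Notation blank0 := (blank0 d0).
Notation st := (st d0).
Notation reg := (reg d0).
Notation store := (store I sym).
Notation reads := (reads I sym).
Notation frag := (frag I sym).
Variable x : seq bool.
Notation runs := (@runs I sym blank nb x).
Notation Skip := (Skip I sym).
Notation rewind := (rewind dT).
Notation mv := (mv dT).

Variable e : role -> I.
Hypothesis e_inj : injective e.
Variable W : I.
Hypothesis eW : forall r, e r != W.

Notation A := (e rA).
Notation X := (e rX).
Notation P := (e rP).
Notation R := (e rR).
Notation Q := (e rQ).
Notation dj j := (e (inr j)).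

Let AX : A != X. Proof. by rewrite (inj_eq e_inj). Qed.
Let AP : A != P. Proof. by rewrite (inj_eq e_inj). Qed.
Let AR : A != R. Proof. by rewrite (inj_eq e_inj). Qed.
Let AQ : A != Q. Proof. by rewrite (inj_eq e_inj). Qed.
Let XP : X != P. Proof. by rewrite (inj_eq e_inj). Qed.
Let XR : X != R. Proof. by rewrite (inj_eq e_inj). Qed.
Let XQ : X != Q. Proof. by rewrite (inj_eq e_inj). Qed.
Let PR : P != R. Proof. by rewrite (inj_eq e_inj). Qed.
Let PQ : P != Q. Proof. by rewrite (inj_eq e_inj). Qed.
Let RQ : R != Q. Proof. by rewrite (inj_eq e_inj). Qed.
Let AW := eW rA.
Let XW := eW rX.
Let PW := eW rP.
Let QW := eW rQ.
Let WR : W != R. Proof. by rewrite eq_sym. Qed.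
Let Dj j : dj j != A /\ dj j != X.
Proof. by rewrite !(inj_eq e_inj). Qed.

Definition djs : seq I := [seq dj j | j <- enum 'I_(rm_tapes D)].

Lemma role_djs r : (if r is inl _ then true else false) -> e r \notin djs.
Proof. by case: r => // b _; apply/mapP => -[j _ /e_inj]. Qed.

Let Xd : X \notin djs. Proof. exact: role_djs. Qed.
Let Pd : P \notin djs. Proof. exact: role_djs. Qed.
Let Rd : R \notin djs. Proof. exact: role_djs. Qed.
Let Wd : W \notin djs.
Proof. by apply/mapP => -[j _ /eqP]; rewrite eq_sym (negPf (eW _)). Qed.

Definition dstate (r : reads) : rm_state D := (rtp r Q).2.2.

Definition dact (r : reads) : option (action (rm_state D) (rm_symbol D) (rm_tapes
  D)) :=
  [pick a in rm_delta (dstate r) (bit (rtp r R)) (bit (rtp r A))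
                      [ffun j => (rtp r (dj j)).2.1]].

Definition dgo (r : reads) : bool := ~~ rm_final (dstate r) && dact r.

(* The mark on Q records a left move, after which the head of A has to be
   brought back if it has reached the blank cell 0. *)
Definition dstep : frag := Do (fun r =>
  if dact r is Some a then let: (q, b, d, ws, ds) := a in
    Act None Stay (fun i =>
      if i == Q then
        (Some ((None, if d is GoLeft then true else false), (rm_blank D, q)), Stay)
      else if i == A then
        (if bit (rtp r A) is Some _ then Some (sy (Some b) false) else None,
         if (d, bit (rtp r A)) is (GoRight, None) then Stay else d)
      else if [pick j | dj j == i] is Some j then
        (Some ((None, false), (ws j, rm_start D)), ds j)
      else (None, Stay))
  else noop I sym).

Definition dfix : frag :=
  If (fun r => mkd (rtp r Q) && ~~ nb_ A r) (mv A GoRight) Skip.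

(** Cell 0 of [A] is the left marker, hence the successor in the head position. On the tapes of [D]
    only the symbol component of the payload counts. *)
Definition sim (c : config D) (s : store) : Prop :=
  [/\ (tps s Q).2 = 0 /\ dstate (look x s) = cf_state c,
      tps s A = st (cf_addr c) (cf_apos c).+1,
      cf_apos c <= size (cf_addr c)
    & forall j, (tps s (dj j)).2 = cf_pos c j /\
        forall p, ((tps s (dj j)).1 p).2.1 = cf_tape c j p].

Lemma sim_look w c s : sim c s -> tps s R = reg (onth w (bits_val (cf_addr c))) ->
  dact (look x s) =
  [pick a in rm_delta (cf_state c) (scan_input w c) (scan_addr c) (scan_tapes c)].
Proof.
move=> [[q0 qs] eA le dt] eR; rewrite /dact qs.
have -> : bit (rtp (look x s) R) = scan_input w c by rewrite /= eR.
have -> : bit (rtp (look x s) A) = scan_addr c by rewrite /= eA.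
have -> // : [ffun j => (rtp (look x s) (dj j)).2.1] = scan_tapes c.
apply/ffunP => j; rewrite !ffunE /=.
by have [h1 h2] := dt j; rewrite /scan h1 h2.
Qed.

Lemma sim_next w c c' s : sim c s ->
  tps s R = reg (onth w (bits_val (cf_addr c))) -> Defs.next w c c' ->
  dgo (look x s) /\
  runs (Seq dstep dfix) 3 s (fun s' => sim c' s' /\ frz (A :: Q :: djs) s s').
Proof.
move=> S eR [nf [a ad ->]]; have L := sim_look S eR.
have Ea : dact (look x s) = Some a.
  (* By determinism the action picked is the one that the given step takes. *)
  rewrite L; case: pickP => [a' a'd|/(_ a)]; last by rewrite ad.
  have := detD (cf_state c) (scan_input w c) (scan_addr c) (scan_tapes c).
  by move=> /card_le1_eqP /(_ _ _ a'd ad) ->.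
case: (S) => [[q0 qs] eA le dt].
split; first by rewrite /dgo Ea qs; move: nf; rewrite /final => ->.
case: a ad Ea => [[[[q b] d] ws] ds] ad Ea.
eapply runs_le.
  pose K s1 := [/\ adr s1 = adr s,
    tps s1 Q = stept (Some ((None, if d is GoLeft then true else false),
      (rm_blank D, q)), Stay) (tps s Q),
    tps s1 A = st (if cf_apos c < size (cf_addr c) then
       set_nth false (cf_addr c) (cf_apos c) b else cf_addr c)
       (shift (if (d, cf_apos c < size (cf_addr c)) is (GoRight,
         false) then Stay else d) (cf_apos c).+1),
    forall j, tps s1 (dj j) = stept (Some ((None, false), (ws j, rm_start D)),
      ds j) (tps s (dj j))
    & forall k, k \notin A :: Q :: djs -> tps s1 k = tps s k].
  eapply (@runs_Seq _ _ _ _ _ _ _ _ _ _ K).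
    apply: runs_Do; rewrite Ea; split=> //=.
    - by rewrite eqxx.
    - rewrite (negPf AQ) eqxx eA /scan /= -!onthTE.
      case E: (onth _ _) => [b'|] /=.
        have h : cf_apos c < size (cf_addr c) by rewrite -onthTE E.
        rewrite /stept /=; congr (_, _).
        apply: functional_extensionality => -[|p] //=; rewrite eqSS.
        by rewrite onth_set_nth //; case: eqP.
      by [].
    - move=> j; rewrite !(inj_eq e_inj) /=.
      case: pickP => [j' /eqP/e_inj[->]//|/(_ j)]; by rewrite eqxx.
    - move=> k; rewrite !inE !negb_or => /and3P[kA kQ kd].
      rewrite (negPf kA) (negPf kQ); case: pickP => [j /eqP jk|_].
        by case/negP: kd; apply/mapP; exists j; rewrite ?mem_enum.
      by rewrite /stept /=; case: (tps s k).
  move=> s1 {K} [a1 Q1 A1 d1 F1].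
  have F : frz (A :: Q :: djs) s s1 by split; rewrite ?a1.
  have m1 : mkd (rtp (look x s1) Q) = (if d is GoLeft then true else false).
    by rewrite /= Q1 /scan /stept /= eqxx.
  have q1 : (tps s1 Q).2 = 0 /\ dstate (look x s1) = q.
    by rewrite /dstate /= Q1 /stept /scan /= q0 eqxx.
  set ad' := (X in st X _) in A1.
  have z : size ad' = size (cf_addr c).
    by rewrite /ad'; case: ifP => // h; rewrite size_set_nth (maxn_idPr h).
  have dj1 j : (tps s1 (dj j)).2 = shift (ds j) (cf_pos c j) /\
    forall p, ((tps s1 (dj j)).1 p).2.1 = (if p == cf_pos c j then ws j else cf_tape
      c j p).
    have [h1 h2] := dt j; rewrite d1 /stept /= h1; split=> // p.
    by case: eqP.
  apply: runs_If; rewrite m1 (look_nb x A1) z.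
  case: ifP => [h|h].
    lst (runs_mv _ _ _); move=> s2 [A2 F2]; split; last first.
      by apply: frz_back (fr_frz F2) _ F; move=> k; rewrite inE => /eqP ->;
        rewrite mem_head.
    have Q2 : tps s2 Q = tps s1 Q by keep.
    case: d {ad a1 Ea} A1 m1 h Q1 A2 => //= A1 m1 h Q1 A2.
    (* Only a left move from the first cell of the address tape leads to the marker; the head of [D]
       stays put in that case. *)
    have p0 : cf_apos c = 0 by move: h; rewrite le andbT -leqNgt leqn0 => /eqP.
    split.
    + by rewrite /dstate /= Q2.
    + by rewrite A2 A1; congr (st _ _); rewrite /= p0 min0n.
    + by rewrite /= z geq_minr.
    + by move=> j /=; rewrite (fr_tps F2) ?inE //; case: (Dj j).
  lst (runs_Skip s1); move=> s2 [F2 t2]; split; last first.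
    by apply: frz_back (fr_frz F2) _ F.
  split.
  + by rewrite /dstate /= t2.
  + rewrite t2 A1 /= -/ad'; congr (st _ _); move: h le; clear.
    by case: d => /=; case: ltnP => /=; lia.
  + by rewrite /= z geq_minr.
  + by move=> j /=; rewrite t2.
by [].
Qed.

Lemma sim_halted w c s : sim c s ->
  tps s R = reg (onth w (bits_val (cf_addr c))) -> halted w c -> ~~ dgo (look x s).
Proof.
move=> S eR hc; have L := sim_look S eR; case: (S) => [[q0 qs] _ _ _].
apply/negP => /andP[]; rewrite qs L; case: pickP => // a ad nf _.
by case: (hc (perform a c)); split=> //; exists a.
Qed.

Lemma next_addr w c c' : @Defs.next D w c c' -> size (cf_addr c') = size (cf_addr
  c).
Proof.
case=> _ [[[[[q b] d] ws] ds] _ ->] /=; case: ifP => // h.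
by rewrite size_set_nth (maxn_idPr h).
Qed.

(** The input symbol is looked up afresh after every step, since any step may change the address;
    [dgo] and [dstep] rely on an up-to-date [R]. *)
Definition simulate := Seq (vread d0 false A X P W R)
  (While dgo (Seq (Seq dstep dfix) (vread d0 false A X P W R))).

Definition simulate_time (l p a n : nat) := n.+1 * (vread_time l p a + 5).

Lemma runs_simulate s p o n c c' :
  tps s P = st p 0 -> tps s W = st (nseq (size (adr s)) true) 0 ->
  tps s X = blank0 -> tps s R = reg o -> size x <= 2 ^ size (adr s) ->
  sim c s -> nsteps (p ++ x) n c c' -> halted (p ++ x) c' ->
  runs simulate (simulate_time (size (adr s)) (size p) (size (cf_addr c)) n) s
    (fun s' => frz (A :: R :: Q :: djs) s s' /\ dstate (look x s') = cf_state c').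
Proof.
move=> eP eWt eX eR hx S hn hc.
set v := vread_time (size (adr s)) (size p) (size (cf_addr c)).
have V s1 c1 : frz (A :: R :: Q :: djs) s s1 -> sim c1 s1 ->
   size (cf_addr c1) = size (cf_addr c) -> (exists o, tps s1 R = reg o) ->
   runs (vread d0 false A X P W R) v s1 (fun s2 =>
     [/\ frz (A :: R :: Q :: djs) s s2,
     sim c1 s2 & tps s2 R = reg (onth (p ++ x) (bits_val (cf_addr c1)))]).
  move=> F1 S1 z1 [o1 eR1]; case: (S1) => [[q0 qs] A1 le dt].
  have zz : size (adr s1) = size (adr s) by case: F1.
  have eP1 : tps s1 P = st p 0 by keep.
  have eX1 : tps s1 X = blank0 by keep.
  have eW1 : tps s1 W = st (nseq (size (adr s1)) true) 0.
    by rewrite zz; rewrite (frz_tps F1) //; dist.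
  have hx1 : size x <= 2 ^ size (adr s1) by rewrite zz.
  have hq1 : 0 < (cf_apos c1).+1 <= (size (cf_addr c1)).+1 by [].
  have C := @runs_vread _ _ d0 nb x false _ _ _ _ _ _ _ _ _ _ AX AP AW AR XP XW XR
    PW PR WR A1 hq1 eP1 eW1 eX1 eR1 hx1.
  rewrite zz z1 -/v in C; lst C; move=> s2 [F2 eR2]; split=> //.
    by apply: frz_back F2 _ F1; subs.
  have A2 : tps s2 A = tps s1 A by rewrite (frz_tps F2) ?inE.
  have Q2 : tps s2 Q = tps s1 Q by rewrite (frz_tps F2) // inE eq_sym.
  split; rewrite ?A2 //; first by rewrite /dstate /= Q2.
  by move=> j; rewrite (frz_tps F2) // inE (inj_eq e_inj).
pose J k s' := exists c1, [/\ nsteps (p ++ x) k c1 c',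
  frz (A :: R :: Q :: djs) s s',
  sim c1 s', tps s' R = reg (onth (p ++ x) (bits_val (cf_addr c1)))
  & size (cf_addr c1) = size (cf_addr c)].
eapply runs_le.
  eapply runs_Seq; first by apply: (V s c) => //; exists o.
  move=> s1 [F1 S1 R1].
  lst (@runs_loop _ _ blank nb x dgo _ (3 + v) J n).
  - move=> k s' [c1 [/= [c2 n12 _] F' S' R' z']].
    by case: (sim_next S' R' n12).
  - by move=> s' [c1 [/= -> F' S' R' z']]; apply: sim_halted S' R' hc.
  - move=> k s' [c1 [/= [c2 n12 n2] F' S' R' z']].
    have [_ N] := sim_next S' R' n12.
    sq N; move=> s2 [S2 F2].
    have FF : frz (A :: R :: Q :: djs) s s2.
      apply: frz_back F2 _ F' => k'; rewrite !inE => /or3P[] ->; by rewrite ?orbT.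
    have R2 : tps s2 R = tps s' R.
      by rewrite (frz_tps F2) // !inE !negb_or Rd RQ eq_sym AR.
    have z2 : size (cf_addr c2) = size (cf_addr c) by rewrite (next_addr n12) z'.
    have R2e : exists o, tps s2 R = reg o by eexists; rewrite R2 R'.
    have z2' : size (cf_addr c2) = size (cf_addr c) by rewrite z2.
    lst (V s2 c2 FF S2 z2' R2e).
    by move=> s3 [F3 S3 R3]; exists k => //; exists c2.
  - by exists c.
  - by move=> s' [c1 [/= <- F' [[_ qs] _ _ _] _ _]].
by rewrite /simulate_time -/v; move: (v); clear => v; lia.
Qed.

Definition query_run t Gu Gv := Seq (put_prefix d0 t Gu Gv P)
  (Seq (init_addr d0 A X P W R) simulate).

Definition ask t Gu Gv u : frag :=
  Seq (query_run t Gu Gv) (If (fun r => rm_final (dstate r)) Skip (Halt I sym u)).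

Definition qts := A :: R :: Q :: P :: djs.

Definition query_time (l p a n : nat) :=
  6 * p + 30 + init_addr_time l p a + simulate_time l p a n + 10.

Lemma runs_query t Gu Gv s gu gv n c' : Gu != P -> Gv != P ->
  tps s Gu = st gu 0 -> tps s Gv = st gv 0 ->
  tps s W = st (nseq (size (adr s)) true) 0 -> size x <= 2 ^ size (adr s) ->
  (forall r, r != rG -> tps s (e r) = blank0) ->
  let p := query_prefix t gu gv in
  nsteps (p ++ x) n (init D (p ++ x)) c' -> halted (p ++ x) c' ->
  runs (query_run t Gu Gv)
    (6 * size p + 30 + init_addr_time (size (adr s)) (size p) (clog (size (p ++ x)))
     + simulate_time (size (adr s)) (size p) (clog (size (p ++ x))) n) s
    (fun s' => frz qts s s' /\ dstate (look x s') = cf_state c').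
Proof.
move=> uP vP eu ev eWt hx fresh p hn hc.
have eA : tps s A = blank0 by apply: fresh.
have eX : tps s X = blank0 by apply: fresh.
have eP : tps s P = blank0 by apply: fresh.
have eR : tps s R = blank0 by apply: fresh.
have eQ : tps s Q = blank0 by apply: fresh.
have ed j : tps s (dj j) = blank0 by apply: fresh.
eapply runs_le.
  sq (runs_prefix t uP vP eu ev eP); move=> s1 [F1 eP1].
  have a1 : adr s1 = adr s by case: F1.
  have A1 : tps s1 A = blank0 by keep.
  have X1 : tps s1 X = blank0 by keep.
  have R1 : tps s1 R = blank0 by keep.
  have W1 : tps s1 W = st (nseq (size (adr s1)) true) 0 by rewrite a1; keep.
  have h1 : size x <= 2 ^ size (adr s1) by rewrite a1.
  have C := @runs_init_addr _ _ d0 nb x _ _ _ _ _ _ _ AX AP AW AR XP XW XR PW PR WR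
    A1 eP1 W1 X1 R1 h1.
  rewrite a1 in C; sq C; move=> s2 [F2 [A2 [o R2]]].
  have a2 : size (adr s2) = size (adr s) by case: F2 => ->; rewrite a1.
  have P2 : tps s2 P = st p 0 by keep.
  have X2 : tps s2 X = blank0 by keep.
  have W2 : tps s2 W = st (nseq (size (adr s2)) true) 0 by rewrite a2; keep.
  have h2 : size x <= 2 ^ size (adr s2) by rewrite a2.
  have Q2 : tps s2 Q = blank0 by keep.
  have S2 : sim (init D (p ++ x)) s2.
    split; rewrite ?Q2 //=; first by rewrite /dstate /= Q2.
    move=> j; have -> : tps s2 (dj j) = blank0 => //.
    by rewrite (frz_tps F2) ?(fr_tps F1) // !inE !(inj_eq e_inj).
  have C2 := runs_simulate P2 W2 X2 R2 h2 S2 hn hc.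
  rewrite a2 /= size_nseq in C2; lst C2; move=> s3 [F3 Q3]; split=> //.
  apply: frz_back F3 _ (frz_back F2 _ (frz_sub (fr_frz F1) _)).
  - by rewrite /qts => k; rewrite !inE => /or4P[] ->; rewrite ?orbT.
  - by rewrite /qts => k; rewrite !inE => /orP[] ->; rewrite ?orbT.
  - by rewrite /qts => k; rewrite !inE => ->; rewrite ?orbT.
by rewrite /p size_query_prefix; clear; lia.
Qed.

Section QueryDE.

Variables (u : bool) (t : gate_type) (Gu Gv : I) (s : store) (gu gv : seq bool).
Variables (n : nat) (c' : config D).
Hypotheses (uP : Gu != P) (vP : Gv != P).
Hypotheses (eu : tps s Gu = st gu 0) (ev : tps s Gv = st gv 0).
Hypotheses (eWt : tps s W = st (nseq (size (adr s)) true) 0)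
  (hx : size x <= 2 ^ size (adr s)).
Hypothesis fresh : forall r, r != rG -> tps s (e r) = blank0.
Notation p := (query_prefix t gu gv).
Hypotheses (hn : nsteps (p ++ x) n (init D (p ++ x)) c') (hc : halted (p ++ x) c').

Let T := 6 * size p + 30 + init_addr_time (size (adr s)) (size p) (clog (size (p ++
  x)))
     + simulate_time (size (adr s)) (size p) (clog (size (p ++ x))) n.

Lemma must_query : @must I sym blank nb x u (ask t Gu Gv u) (T + 2) s
  (fun s' => final c' /\ frz qts s s').
Proof.
have r := runs_query uP vP eu ev eWt hx fresh hn hc.
apply: must_Seq (runs_must r) _ => s1 [F1 q1].
apply: must_Cond => // b; rewrite inE q1 => /eqP ->; rewrite -/(final c').
case: (final c'); last exact: (must_mono (leq0n _) (fun _ q =>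
  q) (must_Halt _ _ _)).
apply: must_mono (runs_must (runs_Skip s1)) => // s2 [F2 _]; split=> //.
by apply: frz_back (fr_frz F2) _ F1.
Qed.

Lemma may_query : final c' ->
  exists2 s', @may I sym blank nb x u (ask t Gu Gv u) s s' & frz qts s s'.
Proof.
move=> fc; have [s1 e1 [F1 q1]] := runs_may u (runs_query uP vP eu ev eWt hx fresh
  hn hc).
have [s2 e2 [F2 _]] := runs_may u (@runs_Skip _ _ d0 nb x s1).
exists s2; last by apply: frz_back (fr_frz F2) _ F1.
apply: may_Seq e1 _; apply: (@may_Cond _ _ _ _ _ _ _ _ _ _ true) => //.
by rewrite inE q1 -/(final c') fc.
Qed.

End QueryDE.

End Sim.

(** * Guesses and tests *)

Section Guess.

Variables (I T : finType) (t0 : T) (nb : nat).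
Notation sym := (sym T).
Notation sy := (sy t0).
Notation blank := (blank t0).
Notation blank0 := (blank0 t0).
Notation st := (st t0).
Notation reg := (reg t0).
Notation store := (store I sym).
Notation reads := (reads I sym).
Notation frag := (frag I sym).
Variable x : seq bool.
Notation runs := (@runs I sym blank nb x).
Notation Skip := (Skip I sym).
Notation toend := (toend T).
Notation rewind := (rewind T).
Notation mv := (mv T).
Notation setr := (setr t0).
Notation erase := (erase t0).
Notation app := (app t0).
Notation load := (load t0).
Notation seek := (seek t0).
Notation vread := (vread t0).
Implicit Types (i j X P W R : I) (s : store) (c : seq bool).



Notation must := (@must I sym blank nb x).
Notation may := (@may I sym blank nb x).

(** A round appends a bit or nothing, so the unary tape [U] bounds the length of the guess without
    fixing it. *)
Definition guess_loop U G := While (nb_ U)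
  (Seq (Branch (Branch (app G (fun=> true)) (app G (fun=> false))) Skip) (mv U
    GoRight)).

Definition guess U G := Seq (mv U GoRight) (Seq (mv G GoRight)
  (Seq (guess_loop U G) (Seq (rewind U) (rewind G)))).

Lemma must_guess u U G s n : U != G ->
  tps s U = st (nseq n true) 0 -> tps s G = blank0 ->
  must u (guess U G) (10 * n + 10) s (fun s' => fr [:: G] s s' /\
    exists2 g, size g <= n & tps s' G = st g 0).
Proof.
move=> UG eU eG.
pose J k s' := [/\ tps s' U = st (nseq n true) (n - k).+1, k <= n, fr [:: U;
  G] s s' &
  exists2 g, size g <= n - k & tps s' G = st g (size g).+1].
have loop s0 : J n s0 -> must u (guess_loop U G) (n * 5).+1 s0 (J 0).
  apply: (@must_loop _ _ blank nb x u (nb_ U) _ 4 J n).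
  - by move=> k s' [e' hk _ _]; rewrite (look_nb x e') size_nseq; olia.
  - by move=> s' [e' hk _ _]; rewrite (look_nb x e') size_nseq; olia.
  - move=> k s' [e' hk F [g hg eg]].
    apply: (@must_Seq _ _ _ _ _ _ _ _ 3 1 _ (fun s2 =>
      [/\ tps s2 U = tps s' U, fr [:: U; G] s s2 &
      exists2 g, size g <= n - k & tps s2 G = st g (size g).+1])).
      have app1 b : runs (app G (fun=> b)) 1 s' (fun s2 =>
        [/\ tps s2 U = tps s' U, fr [:: U; G] s s2 &
          exists2 g, size g <= n - k & tps s2 G = st g (size g).+1]).
        lst (runs_app (fun=> b) eg); move=> s2 [e2 F2]; split; [by keep|by frs|].
        by exists (rcons g b); rewrite size_rcons //; olia.
      apply: must_Cond => // b _; case: b; last first.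
        apply: (must_mono (isT : 1 <= 2) _ (runs_must (runs_Skip s'))) =>
          s2 [F2 t2].
        by rewrite t2; split=> //; [frs|exists g => //; olia].
      by apply: must_Cond => // b _; case: b; apply: runs_must.
    move=> s2 [U2 F2 [g2 hg2 eg2]]; apply: (must_mono (leqnn _) _ (runs_must
      (runs_mv U GoRight s2))) => s3 [U3 F3].
    split; [by rewrite U3 U2 e' /=; congr (st _ _); olia|olia|by frs|].
    by exists g2 => //; keep.
(* The last summand is the slack left for rewinding [G], whose cost depends on the guess but is at
   most [2 * n + 2]. *)
apply: (@must_mono _ _ _ _ _ _ _ (1 + (1 + ((n * 5).+1 + ((2 * n + 2) + (10 * n + 10
  - ((n * 5) + 5 + (2 * n))))))) _ _ _); [olia|by move=> s' h; exact: h|].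
apply: must_Seq (runs_must (runs_mv U GoRight s)) _ => s1 [U1 F1].
apply: must_Seq (runs_must (runs_mv G GoRight s1)) _ => s2 [G2 F2].
have {}G2 : tps s2 G = st [::] 1 by rewrite G2 (fr_tps F1) ?eG /= ?st_nil //; dist.
have {}U1 : tps s2 U = st (nseq n true) 1 by rewrite (fr_tps F2) ?U1 ?eU //; dist.
apply: must_Seq.
  apply: loop; split=> //; [by rewrite subnn|by frs|by exists [::]].
move=> s3 [U3 _ F3 [g hg G3]]; rewrite subn0 in U3 hg.
have hU : n.+1 <= (size (nseq n true)).+1 by rewrite size_nseq.
have R3 := @runs_rewind _ _ t0 nb x _ _ _ _ U3 hU; rewrite size_nseq in R3.
apply: must_Seq (runs_must R3) _ => s4 [U4 F4].
have G4 : tps s4 G = st g (size g).+1 by keep.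
apply: (must_mono _ _ (runs_must (runs_rewind G4 (leqnn _)))); first by olia.
move=> s5 [G5 F5]; split; last by exists g.
apply: (@fr_drop _ _ _ U); [by frs|by rewrite eU; keep].
Qed.

(** Induction on the rounds left: as long as [g'] has bits the next one is appended, and the
    remaining rounds are skipped. *)
Lemma may_guess_loop u U G s n k g g' : U != G -> k <= n -> size g' <= k ->
  tps s U = st (nseq n true) (n - k).+1 -> tps s G = st g (size g).+1 ->
  exists2 s', may u (guess_loop U G) s s' & [/\ fr [:: U; G] s s',
    tps s' U = st (nseq n true) n.+1 & tps s' G = st (g ++ g') (size (g ++ g')).+1].
Proof.
move=> UG; elim: k g g' s => [|k IH] g g' s hk hg' eU eG.
  exists s; first by apply: may_While0; rewrite (look_nb x eU) size_nseq subn0 ltnn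
    andbF.
  by rewrite subn0 in eU; case: g' hg' => //; rewrite cats0.
have [s2 [g2 [h2 [e2 [g3 E3 hg3]] may2]]] : exists s2 g2, [/\ fr [:: G] s s2,
    tps s2 G = st g2 (size g2).+1 /\ (exists2 g3,
      g ++ g' = g2 ++ g3 & size g3 <= k) &
    may u (Branch (Branch (app G (fun=> true)) (app G (fun=> false))) Skip) s s2].
  case: g' hg' => [|b g'] hg'.
    have [s2 e2 [F2 t2]] := runs_may u (@runs_Skip _ _ t0 nb x s).
    exists s2, g; split; last by apply: (@may_Cond _ _ _ _ _ _ _ _ _ _ false).
      by frs.
    by split; [rewrite t2|exists [::]].
  have [s2 e2 [G2 F2]] := runs_may u (@runs_app _ _ t0 nb x _ _ (fun=> b) _ eG).
  exists s2, (rcons g b); split=> //.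
    by split=> //; [rewrite G2 size_rcons|exists g' => //; rewrite cat_rcons].
  apply: (@may_Cond _ _ _ _ _ _ _ _ _ _ true) => //.
  by apply: (@may_Cond _ _ _ _ _ _ _ _ _ _ b); [case: (b)|case: (b) e2].
have U2 : tps s2 U = st (nseq n true) (n - k.+1).+1 by keep.
have [s3 e3 [U3 F3]] := runs_may u (@runs_mv _ _ t0 nb x U GoRight s2).
have {}U3 : tps s3 U = st (nseq n true) (n - k).+1.
  by rewrite U3 U2 /=; congr (st _ _); olia.
have G3 : tps s3 G = st g2 (size g2).+1 by keep.
have [s4 e4 [F4 U4 G4]] := IH g2 g3 s3 (ltnW hk) hg3 U3 G3.
exists s4; last by split=> //; [frs|rewrite E3].
apply: may_WhileS (may_Seq may2 e3) e4.
by rewrite (look_nb x eU) size_nseq; olia.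
Qed.

Lemma may_guess u U G s n g : U != G -> size g <= n ->
  tps s U = st (nseq n true) 0 -> tps s G = blank0 ->
  exists2 s', may u (guess U G) s s' & fr [:: G] s s' /\ tps s' G = st g 0.
Proof.
move=> UG hg eU eG.
have [s1 e1 [U1 F1]] := runs_may u (@runs_mv _ _ t0 nb x U GoRight s).
have [s2 e2 [G2 F2]] := runs_may u (@runs_mv _ _ t0 nb x G GoRight s1).
have {}G2 : tps s2 G = st [::] 1 by rewrite G2 (fr_tps F1) ?eG /= ?st_nil //; dist.
have {}U2 : tps s2 U = st (nseq n true) (n - n).+1.
  by rewrite subnn (fr_tps F2) ?U1 ?eU //; dist.
have [s3 e3 [F3 U3 G3]] := @may_guess_loop u U G s2 n n [::] g UG (leqnn n) hg U2
  G2.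
have hU : n.+1 <= (size (nseq n true)).+1 by rewrite size_nseq.
have [s4 e4 [U4 F4]] := runs_may u (@runs_rewind _ _ t0 nb x _ _ _ _ U3 hU).
have {}G3 : tps s4 G = st g (size g).+1 by keep.
have [s5 e5 [G5 F5]] := runs_may u (@runs_rewind _ _ t0 nb x _ _ _ _ G3 (leqnn _)).
exists s5; first exact: may_Seq e1 (may_Seq e2 (may_Seq e3 (may_Seq e4 e5))).
split=> //; apply: (@fr_drop _ _ _ U); [by frs|by rewrite eU; keep].
Qed.

Definition compare G1 G2 := Seq (mv G1 GoRight) (Seq (mv G2 GoRight)
  (While (fun r : reads => (bit (rtp r G1) == bit (rtp r G2)) && nb_ G1 r)
    (Seq (mv G1 GoRight) (mv G2 GoRight)))).

(** The heads stop at the first position where the strings differ or the first one has ended. The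
    symbols there agree only if both strings have ended, that is, if they are equal. *)
Lemma runs_compare G1 G2 s g1 g2 : G1 != G2 ->
  tps s G1 = st g1 0 -> tps s G2 = st g2 0 ->
  runs (compare G1 G2) (3 * size g1 + 3) s (fun s' => [/\ fr [:: G1; G2] s s',
    (bit (rtp (look x s') G1) == bit (rtp (look x s') G2)) = (g1 == g2) &
    exists p, [/\ p <= (size g1).+1, p <= (size g2).+1,
      tps s' G1 = st g1 p & tps s' G2 = st g2 p]]).
Proof.
move=> G12 e1 e2.
have ex : exists i : nat, ~~ ((onth g1 i == onth g2 i) && onth g1 i).
  by exists (size g1); rewrite !onthTE ltnn andbF.
case: (ex_minnP ex) => k hk hmin.
have lt (i : nat) : i < k -> (onth g1 i == onth g2 i) /\ onth g1 i.
  move=> ik; apply/andP; rewrite -[_ && _]negbK; apply/negP => /hmin;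
    by rewrite leqNgt ik.
have hk1 : k <= size g1 by apply: hmin; rewrite onthTE ltnn andbF.
have hk2 : k <= size g2.
  rewrite leqNgt; apply/negP => /lt[/eqP E]; by rewrite E onthTE ltnn.
eapply runs_le.
  sq (runs_mv _ _ _); move=> s1 [e11 F1].
  sq (runs_mv _ _ _); move=> s2 [e22 F2].
  have E1 : tps s2 G1 = st g1 1 by rewrite (fr_tps F2) ?e11 ?e1 //; dist.
  have E2 : tps s2 G2 = st g2 1 by rewrite e22 (fr_tps F1) ?e2 //; dist.
  pose J (j : nat) s' := [/\ j <= k, fr [:: G1;
    G2] s2 s', tps s' G1 = st g1 (k - j).+1 &
     tps s' G2 = st g2 (k - j).+1].
  eapply (runs_le (t' := (3 * size g1).+1)).
  lst (@runs_loop _ _ blank nb x _ _ 2 J k).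
  - move=> j s' [hj F h1 h2]; rewrite /nb_ (look_bit x h1) (look_bit x h2).
    by apply/andP; apply: lt; olia.
  - by move=> s' [hj F h1 h2]; rewrite /nb_ (look_bit x h1) (look_bit x h2) subn0.
  - move=> j s' [hj F h1 h2]; eapply runs_le.
      sq (runs_mv _ _ _); move=> s3 [e3 F3].
      have h3 : tps s3 G2 = tps s' G2 by keep.
      lst (runs_mv _ _ _); move=> s4 [e4 F4]; exists j => //; split.
      + exact: ltnW.
      + by frs.
      + by rewrite (fr_tps F4) ?e3 ?h1 /=; [congr (st _ _); olia|dist].
      + by rewrite e4 h3 h2 /=; congr (st _ _); olia.
    by [].
  - by split=> //; rewrite subnn.
  - move=> s' [_ F h1 h2]; rewrite subn0 in h1 h2; split; first by frs.
      rewrite (look_bit x h1) (look_bit x h2).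
      apply/idP/eqP => [h|->//]; move: hk; rewrite h /= onthTE -leqNgt => hs.
      apply: eq_from_onth => i; case: (ltnP i k) => ik;
        first by case: (lt i ik) => /eqP.
      have Ek : k = size g1 by apply/eqP; rewrite eqn_leq hk1.
      have h2s : size g2 <= k.
        by move: h; rewrite (onth_default hs) => /eqP/esym;
          move: (onthTE g2 k) => + E; rewrite E => /esym/negbT; rewrite -leqNgt.
      by rewrite !onth_default ?(leq_trans _ ik) // -Ek.
    by exists k.+1.
  by move: hk1; clear; lia.
by clear; lia.
Qed.

Definition differ u G1 G2 : frag := Seq (compare G1 G2)
  (Seq (If (fun r : reads => bit (rtp r G1) == bit (rtp r G2)) (Halt I sym u) Skip)
  (Seq (rewind G1) (rewind G2))).

Section Differ.

Variables (u : bool) (G1 G2 : I) (s : store) (g1 g2 : seq bool).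
Hypotheses (G12 : G1 != G2) (e1 : tps s G1 = st g1 0) (e2 : tps s G2 = st g2 0).

Lemma must_differ :
  must u (differ u G1 G2) (5 * size g1 + 2 * size g2 + 20) s
    (fun s' => g1 <> g2 /\ fr [::] s s').
Proof.
apply: (must_mono (_ : 3 * size g1 + 3 + (2 + ((2 * size g1 + 2) + (2 * size g2 +
  2))) <= _) (fun _ q => q)).
  by clear; lia.
apply: must_Seq (runs_must (runs_compare G12 e1 e2)) _ =>
  s1 [F1 h1 [p [hp1 hp2 E1 E2]]].
apply: (@must_Seq _ _ _ _ _ _ _ _ _ _ _ (fun s2 => g1 <> g2 /\ fr [:: G1;
  G2] s s2 /\ tps s2 = tps s1)).
  apply: must_Cond => // b; rewrite inE h1 => /eqP ->; case: eqP => [E|ne].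
    exact: (must_mono (leq0n _) (fun _ q => q) (must_Halt _ _ _)).
  apply: (must_mono (leqnn _) _ (runs_must (runs_Skip s1))) => s2 [F2 t2].
  by split=> //; split=> //; frs.
move=> s2 [ne [F2 t2]].
have {}E1 : tps s2 G1 = st g1 p by rewrite t2.
have {}E2 : tps s2 G2 = st g2 p by rewrite t2.
apply: must_Seq (runs_must (runs_rewind E1 hp1)) _ => s3 [H3 F3].
have {}E2 : tps s3 G2 = st g2 p by keep.
apply: (must_mono (leqnn _) _ (runs_must (runs_rewind E2 hp2))) => s4 [H4 F4].
split=> //; apply: (@fr_drop _ _ _ G1); last by rewrite e1; keep.
apply: (@fr_drop _ _ _ G2); last by rewrite e2.
by apply: fr_back F4 _ (fr_back F3 _ (fr_sub F2 _)); subs.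
Qed.

Lemma may_differ : g1 <> g2 -> exists2 s', may u (differ u G1 G2) s s' & fr [::] s
  s'.
Proof.
move=> ne; have [s1 f1 [F1 h1 [p [hp1 hp2 E1 E2]]]] := runs_may u (runs_compare G12
  e1 e2).
have [s2 f2 [F2 t2]] := runs_may u (@runs_Skip _ _ t0 nb x s1).
have {}E1 : tps s2 G1 = st g1 p by rewrite t2.
have {}E2 : tps s2 G2 = st g2 p by rewrite t2.
have [s3 f3 [H3 F3]] := runs_may u (@runs_rewind _ _ t0 nb x _ _ _ _ E1 hp1).
have {}E2 : tps s3 G2 = st g2 p by keep.
have [s4 f4 [H4 F4]] := runs_may u (@runs_rewind _ _ t0 nb x _ _ _ _ E2 hp2).
exists s4.
  apply: may_Seq f1 (may_Seq _ (may_Seq f3 f4)).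
  by apply: (@may_Cond _ _ _ _ _ _ _ _ _ _ false) => //;
    rewrite inE h1 (introF eqP ne).
apply: (@fr_drop _ _ _ G1); last by rewrite e1; keep.
apply: (@fr_drop _ _ _ G2); last by rewrite e2.
by frs.
Qed.

End Differ.

(** With the blank tape [Z] as an empty prefix, the lookup reads [x] itself. *)
Definition bitread u b G X Z W R : frag :=
  Seq (Seq (mv G GoRight) (Seq (vread false G X Z W R) (rewind G)))
  (If (fun r : reads => bit (rtp r R) == Some b) Skip (Halt I sym u)).

Section Bitread.

Variables (u b : bool) (G X Z W R : I) (s : store) (g : seq bool).
Hypotheses (GX : G != X) (GZ : G != Z) (GW : G != W) (GR : G != R)
  (XZ : X != Z) (XW : X != W) (XR : X != R) (ZW : Z != W) (ZR : Z != R) (WR : W !=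
    R).
Hypotheses (eG : tps s G = st g 0) (eX : tps s X = blank0) (eZ : tps s Z = blank0)
  (eW : tps s W = st (nseq (size (adr s)) true) 0) (eR : tps s R = blank0)
  (hx : size x <= 2 ^ size (adr s)).

Lemma runs_bitread :
  runs (Seq (mv G GoRight) (Seq (vread false G X Z W R) (rewind G)))
    (1 + (vread_time (size (adr s)) 0 (size g) + (2 * size g + 2))) s
    (fun s' => frz [:: R] s s' /\ tps s' R = reg (onth x (bits_val g))).
Proof.
sq (runs_mv _ _ _); move=> s1 [G1 F1].
have {}G1 : tps s1 G = st g 1 by rewrite G1 eG.
have a1 : adr s1 = adr s by case: F1.
have Z1 : tps s1 Z = st [::] 0 by rewrite st_nil; keep.
have X1 : tps s1 X = blank0 by keep.
have W1 : tps s1 W = st (nseq (size (adr s1)) true) 0 by rewrite a1; keep.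
have R1 : tps s1 R = reg None by rewrite reg_None; keep.
have h1 : size x <= 2 ^ size (adr s1) by rewrite a1.
have C := @runs_vread _ _ t0 nb x false _ _ _ _ _ _ _ _ _ _ GX GZ GW GR XZ XW XR ZW
  ZR WR G1 isT Z1 W1 X1 R1 h1.
rewrite a1 in C; sq C; move=> s2 [F2 R2].
have G2 : tps s2 G = st g 1 by keep.
lst (runs_rewind G2 (isT : 1 <= (size g).+1)).
move=> s3 [G3 F3]; split; last by keep.
by apply: (@frz_drop _ _ _ G); [frzs|rewrite eG].
Qed.

Lemma must_bitread :
  must u (bitread u b G X Z W R) (vread_time (size (adr s)) 0 (size g) + 2 * size g
    + 10) s
    (fun s' => onth x (bits_val g) = Some b /\ frz [:: R] s s').
Proof.
apply: (must_mono (_ : 1 + (vread_time (size (adr s)) 0 (size g) + (2 * size g + 2))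
  + 2 <= _) (fun _ q => q)).
  by clear; lia.
apply: must_Seq (runs_must runs_bitread) _ => s1 [F1 R1].
have B1 : bit (rtp (look x s1) R) = onth x (bits_val g) by rewrite /= R1.
apply: must_Cond => // b'; rewrite inE B1 => /eqP ->; case: eqP => [E|ne].
  apply: (must_mono (leqnn _) _ (runs_must (runs_Skip s1))) => s2 [F2 t2].
  by split=> //; frzs.
exact: (must_mono (leq0n _) (fun _ q => q) (must_Halt _ _ _)).
Qed.

Lemma may_bitread : onth x (bits_val g) = Some b ->
  exists2 s', may u (bitread u b G X Z W R) s s' & frz [:: R] s s'.
Proof.
move=> E; have [s1 f1 [F1 R1]] := runs_may u runs_bitread.
have [s2 f2 [F2 t2]] := runs_may u (@runs_Skip _ _ t0 nb x s1).
exists s2; last by frzs.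
apply: may_Seq f1 _; apply: (@may_Cond _ _ _ _ _ _ _ _ _ _ true) => //.
by rewrite inE /= R1 /= E eqxx.
Qed.

End Bitread.

End Guess.

(** * Evaluating gates *)

Section Evaluate.

Variables (D : ratm) (K nb : nat).
Hypothesis detD : deterministic D.
Definition tid : finType := ('I_K.+1 * role D)%type.
(* Each node v of the search has tapes of its own, so that none is ever cleaned. *)
Definition tix (v : nat) (r : role D) : tid := (inord v, r).
Notation I := tid.

Notation T := (dT D).
Notation t0 := (d0 D).
Notation sym := (sym T).
Notation blank := (blank t0).
Notation blank0 := (blank0 t0).
Notation st := (st t0).
Notation store := (store I sym).
Notation frag := (frag I sym).
Variable x : seq bool.
Notation must := (@must I sym blank nb x).
Notation may := (@may I sym blank nb x).
Notation V := (@V I sym blank nb x).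
Notation bnd := (@bnd I sym blank nb x).
Notation Skip := (Skip I sym).
Notation G v := (tix v (rG D)).

Variables (kU base B l am smax : nat).
Hypotheses (kUb : 0 < kU < base) (hx : size x <= 2 ^ l).
Notation W := (tix 0 (rU D)).
Notation U := (tix kU (rU D)).

Variable q : seq bool -> gate_type -> seq bool -> Prop.
(** All that the search has to know of the decider. Both [am], for the length of its address tape,
    and [smax], for its running time, stay parameters, so that the analysis applies to short inputs
    as well as to long ones. *)
Hypothesis oracle : forall gu t gv, size gu <= B -> size gv <= B ->
  let w := query_prefix t gu gv ++ x in
  clog (size w) <= am /\
  exists n (c' : config D), [/\ n <= smax, nsteps w n (init D w) c', halted w c' &
    (final c' <-> q gu t gv)].

Definition env (s : store) := [/\ size (adr s) = l, tps s W = st (nseq l true) 0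
  & tps s U = st (nseq B true) 0].

(** Nodes are allocated in increasing order. A search started at [lo] touches an interval of indices
    only, which leaves earlier guesses intact and later nodes fresh. *)
Definition node_frame lo hi (s s' : store) := size (adr s') = size (adr s) /\
  forall i : I, (i.1 < lo) || (hi <= i.1) -> tps s' i = tps s i.

Definition fresh lo (s : store) := forall i : I, lo <= i.1 -> tps s i = blank0.

Lemma frm_trans lo hi mid s s' s'' :
  node_frame lo mid s s' -> node_frame lo hi s' s'' -> mid <= hi -> node_frame lo hi
    s s''.
Proof.
move=> [a t] [a' t'] h; split; first by rewrite a'.
by move=> i hi'; rewrite t' // t //; move: hi' h; clear; lia.
Qed.

Lemma frm_sub lo hi lo' hi' s s' : lo' <= lo -> hi <= hi' ->
  node_frame lo hi s s' -> node_frame lo' hi' s s'.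
Proof. by move=> h h' [a t]; split=> // i hi2; apply: t; move: hi2 h h'; clear; lia.
Qed.

Lemma frz_frm X lo hi s s' : all (fun k : I => lo <= k.1 < hi) X ->
  frz X s s' -> node_frame lo hi s s'.
Proof.
move=> /allP h [a t]; split=> // i hi'; apply: t; apply/negP => /h.
by move: hi'; clear; lia.
Qed.

Lemma frm_fresh lo hi s s' : lo <= hi -> node_frame lo hi s s' -> fresh lo s ->
  fresh hi s'.
Proof.
by move=> le [_ t] f i h; rewrite t ?h ?orbT //; apply: f; apply: leq_trans h.
Qed.

Lemma tix1 v r : v <= K -> (tix v r).1 = v :> nat.
Proof. by move=> h; rewrite inordK. Qed.

Lemma tix_inj v : injective (tix v).
Proof. by move=> r r' []. Qed.

Lemma tix_neq v v' r r' : v <= K -> v' <= K -> v != v' -> tix v r != tix v' r'.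
Proof.
by move=> h h' ne; apply: contra ne => /eqP/(f_equal (fun i : I => i.1 : nat));
  rewrite /= !inordK // => ->.
Qed.

Lemma frm_env lo hi s s' : base <= lo -> base <= K -> node_frame lo hi s s' -> env s
  -> env s'.
Proof.
move=> h hK [a t] [e1 e2 e3]; case/andP: kUb => k1 k2; split; first by rewrite a.
  by rewrite t // tix1 // (leq_trans _ h) // ltnW // (leq_ltn_trans _ k2).
by rewrite t // tix1 ?(leq_trans k2) // (leq_trans (ltnW k2)).
Qed.

Lemma frm_G lo hi s s' v : v < lo -> v <= K -> node_frame lo hi s s' -> tps s' (G v)
  = tps s (G v).
Proof. by move=> h hK [a t]; rewrite t // tix1 // h. Qed.

Definition node_query u t v w : frag :=
  Seq (guess t0 U (G w)) (ask (tix w) W t (G v) (G w) u).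

Definition node_list w := G w :: qts (tix w).

Lemma node_list_frm w s s' : w <= K -> frz (node_list w) s s' -> node_frame w w.+1 s
  s'.
Proof.
move=> hw; apply: frz_frm; rewrite /node_list /qts /= !inordK ?ltnS //= leqnn /=.
by apply/allP => k /mapP[j _ ->] /=; rewrite inordK ?ltnS // !leqnn.
Qed.

Definition node_time := 10 * B + 10 + query_time l (4 * B + 4) am smax.

Lemma query_time_mono p p' a a' n n' : p <= p' -> a <= a' -> n <= n' ->
  query_time l p a n <= query_time l p' a' n'.
Proof.
move=> hp ha hn.
have c c1 c1' : c1 <= c1' -> core_time l p c1 <= core_time l p' c1'.
  by move=> hc; rewrite /core_time; have := @leq_mul p (6 * c1 + 20) p' (6 * c1' +
    20) hp; move: hc hp; clear; lia.
have v : vread_time l p a <= vread_time l p' a'.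
  by rewrite /vread_time; have := c a.+1 a'.+1 ha; move: ha; clear; lia.
rewrite /query_time /init_addr_time /simulate_time.
apply: leq_add => //; apply: leq_add; first apply: leq_add.
- by move: hp; clear; lia.
- by apply: leq_mul => //; move: ha v; clear; lia.
- by apply: leq_mul => //; move: v; clear; lia.
Qed.

Section Node.

Variables (u : bool) (t : gate_type) (v w : nat) (s : store) (g : seq bool).
Hypotheses (vw : v < w) (wK : w <= K) (bw : base <= w).
Hypotheses (es : env s) (fs : fresh w s) (gs : size g <= B) (eg : tps s (G v) = st g
  0).

Let vK : v <= K. Proof. exact: leq_trans (ltnW vw) wK. Qed.
Let w0 : 0 < w. Proof. by case/andP: kUb => _ h; apply: leq_trans bw;
  case: (base) h. Qed.
Let UG : U != G w.
Proof.
by case/andP: kUb => h1 h2; apply: tix_neq => //; move: vw wK bw h1 h2; clear; lia.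
Qed.
Let eW r : tix w r != W.
Proof. by apply: tix_neq => //; rewrite -lt0n. Qed.
Let GW r : G v != tix w r.
Proof. by apply: tix_neq => //; rewrite ltn_eqF. Qed.

Lemma guessed s1 h : fr [:: G w] s s1 -> tps s1 (G w) = st h 0 ->
  [/\ adr s1 = adr s, tps s1 (G v) = st g 0, tps s1 W = st (nseq (size (adr s1))
    true) 0,
    size x <= 2 ^ size (adr s1) & forall r, r != rG D -> tps s1 (tix w r) = blank0].
Proof.
case: es => e1 e2 e3 F1 eh; have a1 : adr s1 = adr s by case: F1.
split=> //.
- by rewrite (fr_tps F1) // inE.
- by rewrite a1 e1 (fr_tps F1) // inE eq_sym.
- by rewrite a1 e1.
- by move=> r hr; rewrite (fr_tps F1) ?inE ?(inj_eq (@tix_inj w)) // fs // tix1.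
Qed.

Lemma must_node : must u (node_query u t v w) node_time s (fun s' =>
  exists h, [/\ size h <= B, q g t h, tps s' (G w) = st h 0 & frz (node_list w) s
    s']).
Proof.
case: (es) => e1 e2 e3.
have bG : tps s (G w) = blank0 by apply: fs; rewrite tix1.
rewrite /node_time; eapply must_Seq; first by eapply must_guess;
  [exact: UG|exact: e3|exact: bG].
move=> s1 [F1 [h hh eh]].
have [a1 eg1 eW1 hx1 fr1] := guessed F1 eh.
have [ham [n [c' [hn n1 hc fq]]]] := @oracle g t h gs hh.
have H := @must_query D I nb detD x (tix w) (@tix_inj w) W eW u t (G v) (G w) s1 g h
  n c'
  (GW _) _ eg1 eh eW1 hx1 fr1 n1 hc.
apply: (must_mono _ _ (H _)); last by rewrite (inj_eq (@tix_inj w)).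
  rewrite a1 e1 /=; apply: (@leq_trans (query_time l (size (query_prefix t g h))
    (clog (size (query_prefix t g h ++ x))) n)).
    by rewrite /query_time leq_add2l.
  by apply: query_time_mono => //; rewrite size_query_prefix; move: gs hh; clear;
    lia.
move=> s2 [/fq qh F2]; exists h; split=> //.
  rewrite (frz_tps F2) // /qts !inE !(inj_eq (@tix_inj w)) /=.
  by apply/mapP => -[j _ /tix_inj].
apply: frz_trans (fr_frz F1) (frz_sub F2 _) _; first by move=> k hk;
  rewrite inE hk orbT.
by move=> k; rewrite !inE => /eqP ->; rewrite eqxx.
Qed.

Lemma may_node h : size h <= B -> q g t h -> exists2 s',
  may u (node_query u t v w) s s' &
  tps s' (G w) = st h 0 /\ frz (node_list w) s s'.
Proof.
move=> hh qh; case: (es) => e1 e2 e3.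
have bG : tps s (G w) = blank0 by apply: fs; rewrite tix1.
have [s1 f1 [F1 eh]] := may_guess nb x u UG hh e3 bG.
have [a1 eg1 eW1 hx1 fr1] := guessed F1 eh.
have [ham [n [c' [hn n1 hc fq]]]] := @oracle g t h gs hh.
have [|s2 f2 F2] := @may_query D I nb detD x (tix w) (@tix_inj w) W eW u t (G v) (G
  w) s1 g h n c'
  (GW _) _ eg1 eh eW1 hx1 fr1 n1 hc (proj2 fq qh).
  by rewrite (inj_eq (@tix_inj w)).
exists s2; first exact: may_Seq f1 f2.
split.
  rewrite (frz_tps F2) // /qts !inE !(inj_eq (@tix_inj w)) /=.
  by apply/mapP => -[j _ /tix_inj].
apply: frz_trans (fr_frz F1) (frz_sub F2 _) _; first by move=> k hk;
  rewrite inE hk orbT.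
by move=> k; rewrite !inE => /eqP ->; rewrite eqxx.
Qed.

Lemma frz_fresh s' r : frz (node_list w) s s' -> tix w r \notin node_list w ->
  tps s' (tix w r) = blank0.
Proof. by move=> F h; rewrite (frz_tps F h) fs // tix1. Qed.

(** A query restores [X] and does not touch [Z] and [U] of its node, so these are available for
    reading an input bit. *)
Lemma noded s' : frz (node_list w) s s' ->
  [/\ size (adr s') = l, tps s' (tix w (rX D)) = blank0,
   tps s' (tix w (rZ D)) = blank0, tps s' (tix w (rU D)) = blank0 &
   tps s' W = st (nseq (size (adr s')) true) 0].
Proof.
move=> F; have [e1 e2 e3] := es.
have a' : size (adr s') = l by case: F => ->.
have ni c : (inl c : role D) \notin [:: rG D; rA D; rR D; rQ D; rP D] ->
    tix w (inl c : role D) \notin node_list w.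
  rewrite /node_list /qts !inE !(inj_eq (@tix_inj w)) !negb_or =>
    /and5P[-> -> -> -> ->] /=.
  by apply/mapP => -[j _ /tix_inj].
split=> //; try by apply: frz_fresh F _; apply: ni.
rewrite a' -e2; apply: (frz_tps F); rewrite /node_list /qts !inE !(eq_sym W) !(negPf
  (eW _)) /=.
by apply/mapP => -[j _ /eqP]; rewrite eq_sym (negPf (eW _)).
Qed.

End Node.

(** For type [IN] the second number of a tuple is a bit position, so it is guessed and verified just
    like the number of a child. *)
Definition leaf u v w (b : bool) : frag := Seq (node_query u IN v w)
  (bitread t0 u b (G w) (tix w (rX D)) (tix w (rZ D)) W (tix w (rU D))).

Definition leaf_time := node_time + (vread_time l 0 B + 2 * B + 10).

Definition leaf_val g (b : bool) :=
  exists h, [/\ size h <= B, q g IN h & onth x (bits_val h) = Some b].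

Section Leaf.

Variables (u : bool) (v w : nat) (s : store) (g : seq bool) (b : bool).
Hypotheses (vw : v < w) (wK : w <= K) (bw : base <= w).
Hypotheses (es : env s) (fs : fresh w s) (gs : size g <= B) (eg : tps s (G v) = st g
  0).

Let vK : v <= K. Proof. exact: leq_trans (ltnW vw) wK. Qed.
Let w0 : 0 < w. Proof. by case/andP: kUb => _ h; apply: leq_trans bw;
  case: (base) h. Qed.
Let UG : U != G w.
Proof.
by case/andP: kUb => h1 h2; apply: tix_neq => //; move: vw wK bw h1 h2; clear; lia.
Qed.
Let eW r : tix w r != W.
Proof. by apply: tix_neq => //; rewrite -lt0n. Qed.
Let GW r : G v != tix w r.
Proof. by apply: tix_neq => //; rewrite ltn_eqF. Qed.


Let ti r r' : r != r' -> tix w r != tix w r'.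
Proof. by move=> h; rewrite (inj_eq (@tix_inj w)). Qed.

Let We r : W != tix w r. Proof. by rewrite eq_sym eW. Qed.

Lemma must_leaf : must u (leaf u v w b) leaf_time s (fun s' =>
  leaf_val g b /\ node_frame w w.+1 s s').
Proof.
rewrite /leaf_time /leaf; refine (must_Seq (must_node vw wK bw es fs gs eg) _).
move=> s1 [h [hh qh eh F1]].
have [a1 eX eZ eU eW1] := noded wK bw es fs F1.
have hx1 : size x <= 2 ^ size (adr s1) by rewrite a1.
have H := @must_bitread I T t0 nb x u b _ _ _ _ _ _ _ (@ti (rG D) (rX D) isT) (@ti
  (rG D) (rZ D) isT) (eW _)
  (@ti (rG D) (rU D) isT) (@ti (rX D) (rZ D) isT) (eW _)
  (@ti (rX D) (rU D) isT) (eW _) (@ti (rZ D) (rU D) isT) (We _) eh eX eZ eW1 eU hx1.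
apply: (must_mono _ _ H).
  rewrite a1; have := vread_time_mono l 0 hh; move: hh; clear; lia.
move=> s2 [hb F2]; split; first by exists h.
apply: frm_trans (node_list_frm wK F1) _ (leqnn _).
by apply: (frz_frm _ F2); rewrite /= inordK ?ltnS // !leqnn.
Qed.

Lemma may_leaf : leaf_val g b -> exists2 s', may u (leaf u v w b) s s' & node_frame
  w w.+1 s s'.
Proof.
move=> [h [hh qh hb]].
have [s1 f1 [eh F1]] := may_node u vw wK bw es fs gs eg hh qh.
have [a1 eX eZ eU eW1] := noded wK bw es fs F1.
have hx1 : size x <= 2 ^ size (adr s1) by rewrite a1.
have [s2 f2 F2] := may_bitread nb u (@ti (rG D) (rX D) isT) (@ti (rG D) (rZ D) isT)
  (eW _)
  (@ti (rG D) (rU D) isT) (@ti (rX D) (rZ D) isT) (eW _)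
  (@ti (rX D) (rU D) isT) (eW _) (@ti (rZ D) (rU D) isT) (We _) eh eX eZ eW1 eU hx1
    hb.
exists s2; first exact: may_Seq f1 f2.
apply: frm_trans (node_list_frm wK F1) _ (leqnn _).
by apply: (frz_frm _ F2); rewrite /= inordK ?ltnS // !leqnn.
Qed.

End Leaf.

Lemma must_Branch u p1 p2 t s Q : must u p1 t s Q -> must u p2 t s Q ->
  must u (Branch p1 p2) t.+1 s Q.
Proof. by move=> h1 h2; apply: must_Cond => // -[] _. Qed.

Lemma may_Branch1 u (p1 p2 : frag) s s' : may u p1 s s' -> may u (Branch p1 p2) s
  s'.
Proof. by move=> h; apply: (@may_Cond _ _ _ _ _ _ _ _ _ _ true). Qed.

Lemma may_Branch2 u (p1 p2 : frag) s s' : may u p2 s s' -> may u (Branch p1 p2) s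
  s'.
Proof. by move=> h; apply: (@may_Cond _ _ _ _ _ _ _ _ _ _ false). Qed.

(** Bounds the fresh nodes that a certificate of depth [d] takes; the case of two certified children
    dictates the recurrence. *)
Fixpoint nodes d := if d is d'.+1 then (nodes d' + nodes d').+2 else 1.

(** The summand [7 * B + 20] pays for [differ] on two strings of length at most [B], and the final 3
    for the three branchings. *)
Fixpoint check_time d := if d is d'.+1 then
  leaf_time + 2 * node_time + 7 * B + 20 + 2 * check_time d' + 3 else leaf_time.

(* One child suffices for a true OR or a false AND, both children are needed
   for a true AND or a false OR. *)
Fixpoint check u d (b : bool) v lo : frag := if d is d'.+1 then
  Branch (leaf u v lo b)
  (Branch (Seq (node_query u NOT v lo) (check u d' (~~ b) lo lo.+1))
  (Branch (Seq (node_query u (if b then OR else AND) v lo) (check u d' b lo lo.+1))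
  (Seq (node_query u (if b then AND else OR) v lo)
  (Seq (node_query u (if b then AND else OR) v lo.+1)
  (Seq (differ T u (G lo) (G lo.+1))
  (Seq (check u d' b lo lo.+2) (check u d' b lo.+1 (lo.+2 + nodes d'))))))))
  else leaf u v lo b.

(** What [check] verifies, stated without the machine. In the last case two distinct children stand
    for all of them, which is sound in the region of fan-in 2. *)
Fixpoint certified d (b : bool) g : Prop := if d is d'.+1 then
  [\/ leaf_val g b,
      exists h, [/\ size h <= B, q g NOT h & certified d' (~~ b) h],
      exists h, [/\ size h <= B, q g (if b then OR else AND) h & certified d' b h]
    | exists h h', [/\ size h <= B /\ size h' <= B,
        q g (if b then AND else OR) h /\ q g (if b then AND else OR) h', h <> h',
        certified d' b h & certified d' b h']]
  else leaf_val g b.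

Lemma node_next w s s' : base <= w -> w <= K -> env s -> fresh w s ->
  frz (node_list w) s s' -> [/\ node_frame w w.+1 s s', env s' & fresh w.+1 s'].
Proof.
move=> bw wK es fs F; have f := node_list_frm wK F; split=> //.
  exact: frm_env bw (leq_trans bw wK) f es.
exact: frm_fresh (leqnSn w) f fs.
Qed.

Lemma must_check u d b v lo s g : v < lo -> lo + nodes d <= K.+1 -> base <= lo ->
  env s -> fresh lo s -> size g <= B -> tps s (G v) = st g 0 ->
  must u (check u d b v lo) (check_time d) s
    (fun s' => certified d b g /\ node_frame lo (lo + nodes d) s s').
Proof.
elim: d b v lo s g => [|d IH] b v lo s g vlo hK blo es fs gs eg.
  rewrite addn1 in hK *; exact: must_leaf.
have loK : lo <= K by move: hK => /=; clear; lia.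
have bK : base <= K by apply: leq_trans loK.
have hK1 : lo.+1 + nodes d <= K.+1 by move: hK => /=; clear; lia.
rewrite /= -/(check _ _ _ _ _).
set c := (if b then AND else OR); set c' := (if b then OR else AND).
apply: (must_mono (_ : (leaf_time + 2 * node_time + 7 * B + 20 + 2 * check_time
  d).+3 <= _) (fun _ q => q)).
  by clear; lia.
have one t b' : must u (Seq (node_query u t v lo) (check u d b' lo lo.+1))
    (node_time + check_time d) s (fun s' => (exists h, [/\ size h <= B,
      q g t h & certified d b' h]) /\
    node_frame lo (lo + (nodes d + nodes d).+2) s s').
  apply: must_Seq (must_node vlo loK blo es fs gs eg) _ => s1 [h [hh qh eh F1]].
  have [f1 e1 n1] := node_next blo loK es fs F1.
  apply: (must_mono (leqnn _) _ (IH b' lo lo.+1 s1 h (leqnn _) hK1 (leqW blo) e1 n1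
    hh eh)).
  move=> s2 [vh f2]; split; first by exists h.
  apply: (@frm_trans lo _ lo.+1) f1 (frm_sub _ _ f2) _; by clear; lia.
apply: must_Branch.
  apply: (must_mono _ _ (must_leaf vlo loK blo es fs gs eg)); first by clear; lia.
  move=> s' [h f]; split; first by constructor 1.
  by apply: frm_sub f; clear; lia.
apply: must_Branch.
  apply: (must_mono _ _ (one NOT (~~ b))); first by clear; lia.
  by move=> s' [h f]; split=> //; constructor 2.
apply: must_Branch.
  apply: (must_mono _ _ (one c' b)); first by clear; lia.
  by move=> s' [h f]; split=> //; constructor 3.
apply: (must_mono (_ : node_time + (node_time + ((7 * B + 20) + (check_time d +
  check_time d))) <= _) (fun _ q => q)).
  by clear; lia.
apply: must_Seq (must_node vlo loK blo es fs gs eg) _ => s1 [h [hh qh eh F1]].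
have [f1 e1 n1] := node_next blo loK es fs F1.
have eg1 : tps s1 (G v) = st g 0 by rewrite (frm_G vlo (leq_trans (ltnW vlo) loK)
  f1).
have lo1K : lo.+1 <= K by move: hK => /=; clear; lia.
apply: must_Seq (must_node (leqW vlo) lo1K (leqW blo) e1 n1 gs eg1) _ =>
  s2 [h' [hh' qh' eh' F2]].
have [f2 e2 n2] := node_next (leqW blo) lo1K e1 n1 F2.
have eh2 : tps s2 (G lo) = st h 0 by rewrite (frm_G (leqnn _) loK f2).
have nG : G lo != G lo.+1 by apply: tix_neq => //; rewrite ltn_eqF.
apply: (must_Seq (must_mono (_ : _ <= 7 * B + 20) (fun _ q =>
  q) (must_differ x nG eh2 eh'))).
  by move: hh hh'; clear; lia.
move=> s3 [ne F3].
have f3 : node_frame lo.+2 lo.+2 s2 s3 by apply: (frz_frm _ (fr_frz F3)).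
have e3 := frm_env (leqW (leqW blo)) bK f3 e2.
have n3 := frm_fresh (leqnn _) f3 n2.
have eh3 : tps s3 (G lo) = st h 0 by rewrite (frm_G _ loK f3).
have eh3' : tps s3 (G lo.+1) = st h' 0 by rewrite (frm_G _ lo1K f3).
have hK2 : lo.+2 + nodes d <= K.+1 by move: hK => /=; clear; lia.
apply: (must_Seq (IH b lo lo.+2 s3 h _ hK2 (leqW (leqW blo)) e3 n3 hh eh3)) => //.
move=> s4 [vh f4].
have le4 : lo.+2 <= lo.+2 + nodes d by clear; lia.
have e4 := frm_env (leqW (leqW blo)) bK f4 e3.
have n4 := frm_fresh le4 f4 n3.
have eh4 : tps s4 (G lo.+1) = st h' 0 by rewrite (frm_G _ lo1K f4).
have hK3 : lo.+2 + nodes d + nodes d <= K.+1 by move: hK => /=; clear; lia.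
have lt4 : lo.+1 < lo.+2 + nodes d by clear; lia.
apply: (must_mono (leqnn _) _ (IH b lo.+1 _ s4 h' lt4 hK3 _ e4 n4 hh' eh4)).
  move=> s5 [vh' f5]; split; first by constructor 4; exists h, h'.
  have bd : lo.+2 + nodes d <= lo + (nodes d + nodes d).+2 by clear; lia.
  apply: (frm_trans (mid := lo.+2 + nodes d)) _ (frm_sub _ _ f5) _; [|by clear;
    lia|by clear; lia|done].
  apply: (frm_trans (mid := lo.+2)) _ (frm_sub _ (leqnn _) f4) _; [|by clear;
    lia|by clear; lia].
  apply: (frm_trans (mid := lo.+2)) _ (frm_sub _ (leqnn _) f3) _; [|by clear;
    lia|by []].
  apply: (frm_trans (mid := lo.+1)) f1 (frm_sub _ _ f2) _; by clear; lia.
by move: blo; clear; lia.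
Qed.

Lemma may_check u d b v lo s g : v < lo -> lo + nodes d <= K.+1 -> base <= lo ->
  env s -> fresh lo s -> size g <= B -> tps s (G v) = st g 0 -> certified d b g ->
  exists2 s', may u (check u d b v lo) s s' & node_frame lo (lo + nodes d) s s'.
Proof.
elim: d b v lo s g => [|d IH] b v lo s g vlo hK blo es fs gs eg.
  rewrite addn1 in hK * => /= vg.
  exact: (may_leaf u vlo hK blo es fs gs eg vg).
have loK : lo <= K by move: hK => /=; clear; lia.
have bK : base <= K by apply: leq_trans loK.
have hK1 : lo.+1 + nodes d <= K.+1 by move: hK => /=; clear; lia.
have one t b' h : size h <= B -> q g t h -> certified d b' h ->
    exists2 s', may u (Seq (node_query u t v lo) (check u d b' lo lo.+1)) s s' &
    node_frame lo (lo + (nodes d + nodes d).+2) s s'.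
  move=> hh qh vh; have [s1 m1 [eh F1]] := may_node u vlo loK blo es fs gs eg hh qh.
  have [f1 e1 n1] := node_next blo loK es fs F1.
  have [s2 m2 f2] := IH b' lo lo.+1 s1 h (leqnn _) hK1 (leqW blo) e1 n1 hh eh vh.
  exists s2; first exact: may_Seq m1 m2.
  apply: (@frm_trans lo _ lo.+1) f1 (frm_sub _ _ f2) _; by clear; lia.
move=> /= [vg|[h [hh qh vh]]|[h [hh qh vh]]|[h [h' [[hh hh'] [qh qh'] ne vh vh']]]].
- have [s' m' f'] := may_leaf u vlo loK blo es fs gs eg vg.
  exists s'; first exact: may_Branch1.
  by apply: frm_sub f'; clear; lia.
- have [s' m' f'] := one _ _ _ hh qh vh.
  by exists s' => //; apply: may_Branch2; apply: may_Branch1.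
- have [s' m' f'] := one _ _ _ hh qh vh.
  by exists s' => //; apply: may_Branch2; apply: may_Branch2; apply: may_Branch1.
have [s1 m1 [eh F1]] := may_node u vlo loK blo es fs gs eg hh qh.
have [f1 e1 n1] := node_next blo loK es fs F1.
have eg1 : tps s1 (G v) = st g 0 by rewrite (frm_G vlo (leq_trans (ltnW vlo) loK)
  f1).
have lo1K : lo.+1 <= K by move: hK => /=; clear; lia.
have [s2 m2 [eh' F2]] := may_node u (leqW vlo) lo1K (leqW blo) e1 n1 gs eg1 hh' qh'.
have [f2 e2 n2] := node_next (leqW blo) lo1K e1 n1 F2.
have eh2 : tps s2 (G lo) = st h 0 by rewrite (frm_G (leqnn _) loK f2).
have nG : G lo != G lo.+1 by apply: tix_neq => //; rewrite ltn_eqF.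
have [s3 m3 F3] := may_differ nb x u nG eh2 eh' ne.
have f3 : node_frame lo.+2 lo.+2 s2 s3 by apply: (frz_frm _ (fr_frz F3)).
have e3 := frm_env (leqW (leqW blo)) bK f3 e2.
have n3 := frm_fresh (leqnn _) f3 n2.
have eh3 : tps s3 (G lo) = st h 0 by rewrite (frm_G _ loK f3).
have eh3' : tps s3 (G lo.+1) = st h' 0 by rewrite (frm_G _ lo1K f3).
have hK2 : lo.+2 + nodes d <= K.+1 by move: hK => /=; clear; lia.
have [s4 m4 f4] := IH b lo lo.+2 s3 h (leqW (leqnn _)) hK2 (leqW (leqW blo)) e3 n3
  hh eh3 vh.
have le4 : lo.+2 <= lo.+2 + nodes d by clear; lia.
have e4 := frm_env (leqW (leqW blo)) bK f4 e3.
have n4 := frm_fresh le4 f4 n3.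
have eh4 : tps s4 (G lo.+1) = st h' 0 by rewrite (frm_G _ lo1K f4).
have hK3 : lo.+2 + nodes d + nodes d <= K.+1 by move: hK => /=; clear; lia.
have lt4 : lo.+1 < lo.+2 + nodes d by clear; lia.
have bl4 : base <= lo.+2 + nodes d by move: blo; clear; lia.
have [s5 m5 f5] := IH b lo.+1 _ s4 h' lt4 hK3 bl4 e4 n4 hh' eh4 vh'.
exists s5.
  do 3!apply: may_Branch2.
  exact: may_Seq m1 (may_Seq m2 (may_Seq m3 (may_Seq m4 m5))).
apply: (frm_trans (mid := lo.+2 + nodes d)) _ (frm_sub _ _ f5) _; [|by clear;
  lia|by clear; lia|by clear; lia].
apply: (frm_trans (mid := lo.+2)) _ (frm_sub _ (leqnn _) f4) _; [|by clear;
  lia|by clear; lia].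
apply: (frm_trans (mid := lo.+2)) _ (frm_sub _ (leqnn _) f3) _; [|by clear;
  lia|by []].
apply: (frm_trans (mid := lo.+1)) f1 (frm_sub _ _ f2) _; by clear; lia.
Qed.

(* The gate on G v lies r layers above the last one. *)
Fixpoint lay u t r v d : frag := Seq (node_query u t v v.+1)
  (if r is r'.+1 then Seq (Tick I sym) (lay (~~ u) (dual t) r' v.+1 d)
   else Seq (check u d (~~ u) v.+1 v.+2) (Halt I sym (~~ u))).

(** The existential player, [u = false], claims that the gate has value true and the universal
    player that it has value false; hence the [~~ u] in the certificate at the end. *)
Fixpoint winning u t r d g : Prop :=
  if r is r'.+1 then
    exists h, [/\ size h <= B, q g t h & ~ winning (~~ u) (dual t) r' d h]
  else exists h, [/\ size h <= B, q g t h & certified d (~~ u) h].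

Fixpoint lay_time r d := if r is r'.+1 then node_time + (lay_time r' d).+1 else
  node_time + check_time d.

Lemma must_val u p t s (Q : store -> Prop) f (io : option (fs p) -> option (fs f))
  (i : 'I_nb.+1) :
  must u p t s Q -> wf s -> emb io -> odd i = u ->
  V i (io (Some (fe p))) s -> exists s', [/\ wf s', Q s' & V i (io None) s'].
Proof. by move=> m w em oi; case: (m w f io i em oi). Qed.

Lemma must_bnd u p t s (Q : store -> Prop) f (io : option (fs p) -> option (fs f))
  (i : 'I_nb.+1) r :
  must u p t s Q -> wf s -> emb io -> odd i = u ->
  (forall s', wf s' -> Q s' -> bnd r i (io None) s') ->
  bnd (t + r) i (io (Some (fe p))) s.
Proof. by move=> m w em oi; case: (m w f io i em oi) => _; apply. Qed.

(** Induction on the layers left. At a change of layer [V_Tick] negates the claim exactly where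
    [winning] negates the position of the opponent. The bounds on [i + r] and on
    [v.+2 + r + nodes d] guarantee that neither block numbers nor fresh nodes run out. *)
Lemma lay_correct u t r v d s g f (io : option (fs (lay u t r v d)) -> option (fs
  f)) (i : 'I_nb.+1) :
  emb io -> odd i = u -> i + r <= nb -> wf s -> env s -> fresh v.+1 s -> base <= v
    ->
  v.+2 + r + nodes d <= K.+1 -> size g <= B -> tps s (G v) = st g 0 ->
  (V i (io (Some (fe (lay u t r v d)))) s <-> winning u t r d g) /\
  bnd (lay_time r d) i (io (Some (fe (lay u t r v d)))) s.
Proof.
elim: r u t v s g io i => [|r IH] u t v s g io i em oi ir w es fs bv hK gs eg.
- have v1K : v.+1 <= K by move: hK; clear; lia.
  have M := must_node (leqnn v.+1) v1K (leqW bv) es fs gs eg.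
  have C s1 h : size h <= B -> tps s1 (G v.+1) = st h 0 -> frz (node_list v.+1) s s1
    ->
    must u (check u d (~~ u) v.+1 v.+2) (check_time d) s1
      (fun s' => certified d (~~ u) h /\ node_frame v.+2 (v.+2 + nodes d) s1 s') /\
    (certified d (~~ u) h -> exists2 s', may u (check u d (~~ u) v.+1 v.+2) s1 s' &
       node_frame v.+2 (v.+2 + nodes d) s1 s').
    move=> hh eh F1; have [f1 e1 n1] := node_next (leqW bv) v1K es fs F1.
    have hK1 : v.+2 + nodes d <= K.+1 by move: hK; rewrite addn0.
    split; first exact: (must_check (ltnSn _) hK1 (leqW (leqW bv)) e1 n1 hh eh).
    exact: (may_check u (ltnSn _) hK1 (leqW (leqW bv)) e1 n1 hh eh).
  split; last first.
    apply: (must_bnd (M u t) w (emb_seq1 em) oi) => s1 w1 [h [hh qh eh F1]].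
    have [C1 _] := C s1 h hh eh F1.
    rewrite -[check_time d]addn0.
    apply: (must_bnd C1 w1 (emb_seq1 (emb_seq2 em)) oi) => s2 w2 _.
    have [s' [Es hs _]] := emb_seq2 (emb_seq2 em) tt.
    by rewrite Es; apply: bnd_halt hs.
  split.
    move=> /(must_val (M u t) w (emb_seq1 em) oi)[s1 [w1 [h [hh qh eh F1]] v1]].
    have [C1 _] := C s1 h hh eh F1.
    have [s2 [w2 [vh _] _]] := must_val C1 w1 (emb_seq1 (emb_seq2 em)) oi v1.
    by exists h.
  move=> [h [hh qh vh]].
  have [s1 m1 [eh F1]] := may_node u (leqnn v.+1) v1K (leqW bv) es fs gs eg hh qh.
  have [_ /(_ vh)[s2 m2 _]] := C s1 h hh eh F1.
  have [w1 h1] := m1 w; have [w2 h2] := m2 w1.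
  apply: (h1 _ _ i (emb_seq1 em) oi); apply: (h2 _ _ i (emb_seq1 (emb_seq2 em)) oi).
  by apply: V_Halt oi (emb_seq2 (emb_seq2 em)).
have v1K : v.+1 <= K by move: hK; clear; lia.
have M := must_node (leqnn v.+1) v1K (leqW bv) es fs gs eg.
have ib : i < nb by move: ir; clear; lia.
have S s1 h : wf s1 -> size h <= B -> tps s1 (G v.+1) = st h 0 -> frz (node_list
  v.+1) s s1 ->
    let io' := (fun o => io (omap inr o)) in
    (V i (io' (Some (fe (Seq (Tick I sym) (lay (~~ u) (dual t) r v.+1 d))))) s1 <->
     ~ winning (~~ u) (dual t) r d h) /\
    bnd (lay_time r d).+1 i (io' (Some (fe (Seq (Tick I sym) (lay (~~ u) (dual t) r
      v.+1 d))))) s1.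
  move=> w1 hh eh F1 io'; have [f1 e1 n1] := node_next (leqW bv) v1K es fs F1.
  have em1 := emb_seq1 (emb_seq2 em); have em2 := emb_seq2 (emb_seq2 em).
  have vi : (inord i.+1 : 'I_nb.+1) = i.+1 :> nat by rewrite inordK ?ltnS.
  have [|||A1 A2] := IH (~~ u) (dual t) v.+1 s1 h _ (inord i.+1) em2 _ _ w1 e1 n1
    (leqW bv) _ hh eh.
  - by rewrite vi /= oi.
  - by rewrite vi; move: ir; clear; lia.
  - by move: hK; clear; lia.
  split; last exact (bnd_Tick em1 w1 ib A2).
  by rewrite -A1; exact (V_Tick _ _ em1 w1 ib).
split; last first.
  apply: (must_bnd (M u t) w (emb_seq1 em) oi) => s1 w1 [h [hh qh eh F1]].
  exact: (proj2 (S s1 h w1 hh eh F1)).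
split.
  move=> /(must_val (M u t) w (emb_seq1 em) oi)[s1 [w1 [h [hh qh eh F1]] v1]].
  by exists h; split=> //; apply: (proj1 (proj1 (S s1 h w1 hh eh F1))).
move=> [h [hh qh vh]].
have [s1 m1 [eh F1]] := may_node u (leqnn v.+1) v1K (leqW bv) es fs gs eg hh qh.
have [w1 h1] := m1 w; apply: (h1 _ _ i (emb_seq1 em) oi).
by apply: (proj2 (proj1 (S s1 h w1 hh eh F1))).
Qed.

End Evaluate.

(** * Unary counters *)

Section Setup.

Variables (I T : finType) (t0 : T) (nb : nat).
Notation sym := (sym T).
Notation sy := (sy t0).
Notation blank := (blank t0).
Notation blank0 := (blank0 t0).
Notation st := (st t0).
Notation reg := (reg t0).
Notation store := (store I sym).
Notation reads := (reads I sym).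
Notation frag := (frag I sym).
Variable x : seq bool.
Notation runs := (@runs I sym blank nb x).
Notation Skip := (Skip I sym).
Notation toend := (toend T).
Notation rewind := (rewind T).
Notation mv := (mv T).
Notation setr := (setr t0).
Notation erase := (erase t0).
Notation app := (app t0).
Notation load := (load t0).
Notation seek := (seek t0).
Notation vread := (vread t0).
Implicit Types (i j X P W R : I) (s : store) (c : seq bool).



Lemma runs_append_true i s n : tps s i = st (nseq n true) n.+1 ->
  runs (app i (fun=> true)) 1 s (fun s' =>
    tps s' i = st (nseq n.+1 true) n.+2 /\ fr [:: i] s s').
Proof.
move=> e; have e' : tps s i = st (nseq n true) (size (nseq n true)).+1 by rewrite
  size_nseq.
by lst (runs_app (fun=> true) e'); move=> s' []; rewrite rcons_nseq size_nseq.
Qed.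

(** The machine learns [clog n] from the length of its address tape, by one pass of the head, which
    is left at the right end. *)
Definition unary_log W := Seq (mv W GoRight)
  (Seq (While (fun r : reads => rad r) (Seq (app W (fun=> true)) (WA (fun=> None)
    GoRight)))
  (rewind W)).

Lemma runs_unary_log W s : wf s -> apo s = 0 -> tps s W = blank0 ->
  runs (unary_log W) (10 * size (adr s) + 10) s (fun s' =>
    frz [:: W] s s' /\ tps s' W = st (nseq (size (adr s)) true) 0).
Proof.
move=> w a0 eW; set l := size (adr s); eapply runs_le.
  sq (runs_mv _ _ _); move=> s1 [W1 F1].
  have {}W1 : tps s1 W = st [::] 1 by rewrite W1 eW st_nil.
  pose J k s' := [/\ tps s' W = st (nseq (l - k) true) (l - k).+1, apo s' = l - k,
    k <= l, frz [:: W] s1 s' & size (adr s') = l].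
  eapply runs_Seq.
    lst (@runs_loop _ _ blank nb x (fun r : reads => rad r) _ 2 J l).
    - by move=> k s' [_ p' hk _ z']; rewrite /= onthTE p' z'; move: hk; clear; lia.
    - by move=> s' [_ p' hk _ z']; rewrite /= onthTE p' z' subn0 ltnn.
    - move=> k s' [hW p' hk F z']; eapply runs_le.
        sq (runs_append_true hW); move=> s2 [W2 F2].
        have p2 : apo s2 = l - k.+1.
          have w' : wf s' by rewrite /wf p' z' leq_subr.
          by case: F2 => _ /(_ w') ->.
        have z2 : size (adr s2) = l by case: F2 => ->.
        lst (runs_WA _ _ _); move=> s3 [t3 a3 p3 _]; exists k => //.
        have E : (l - k.+1).+1 = l - k by rewrite -subSn.
        split; [by rewrite t3 W2 E|rewrite p3 p2 z2 /= E; apply/minn_idPl;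
          exact: leq_subr|exact: ltnW| |by rewrite a3].
        by split; [rewrite a3 z2 -z'; case: F => ->|move=> k' hk';
          rewrite t3 (fr_tps F2) // (frz_tps F)].
      by [].
    - split; rewrite ?subnn //; first by case: F1 => _ /(_ w) ->.
      by case: F1 => ->.
    - by move=> s' h; exact: h.
  move=> s2 [W2 _ _ F2 z2]; rewrite subn0 in W2.
  have hl : l.+1 <= (size (nseq l true)).+1 by rewrite size_nseq.
  lst (runs_rewind W2 hl); move=> s3 [W3 F3]; split=> //; frzs.
by rewrite size_nseq; clear; lia.
Qed.

Fixpoint append_ones i (c : nat) : frag :=
  if c is c'.+1 then Seq (app i (fun=> true)) (append_ones i c') else Skip.

Lemma runs_append_ones i (c : nat) s n : tps s i = st (nseq n true) n.+1 ->
  runs (append_ones i c) c.+1 s (fun s' =>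
    tps s' i = st (nseq (n + c) true) (n + c).+1 /\ fr [:: i] s s').
Proof.
elim: c n s => [|c IH] n s e /=.
  by lst (runs_Skip s); move=> s' [F t]; rewrite t addn0; split=> //; frs.
eapply (runs_le (t := 1 + c.+1)); last by [].
sq (runs_append_true e); move=> s1 [e1 F1]; lst (IH _ _ e1).
by rewrite addnS addSn => s2 [e2 F2]; split=> //; frs.
Qed.

Definition add_ones i (c : nat) := Seq (mv i GoRight) (Seq (While (nb_ i) (mv i
  GoRight))
  (Seq (append_ones i c) (rewind i))).

Lemma runs_add_ones i (c : nat) s n : tps s i = st (nseq n true) 0 ->
  runs (add_ones i c) (4 * n + 3 * c + 10) s (fun s' =>
    tps s' i = st (nseq (n + c) true) 0 /\ fr [:: i] s s').
Proof.
move=> e; eapply runs_le.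
  sq (runs_mv _ _ _); move=> s1 [e1 F1].
  have {}e1 : tps s1 i = st (nseq n true) 1 by rewrite e1 e.
  sq (goR e1 isT); move=> s2 [e2 F2]; rewrite size_nseq in e2.
  sq (runs_append_ones c e2); move=> s3 [e3 F3].
  have h : (n + c).+1 <= (size (nseq (n + c) true)).+1 by rewrite size_nseq.
  lst (runs_rewind e3 h); move=> s4 [e4 F4]; split=> //; frs.
by rewrite !size_nseq; clear; lia.
Qed.

Definition mul_ones W i j := Seq (mv i GoRight) (Seq (mv j GoRight)
  (Seq (While (nb_ i) (Seq (mv W GoRight)
     (Seq (While (nb_ W) (Seq (app j (fun=> true)) (mv W GoRight)))
     (Seq (rewind W) (mv i GoRight)))))
  (Seq (rewind i) (rewind j)))).

Lemma runs_mul_ones W i j s a l : W != i -> W != j -> i != j ->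
  tps s W = st (nseq l true) 0 -> tps s i = st (nseq a true) 0 -> tps s j = blank0
    ->
  runs (mul_ones W i j) (a * (5 * l + 10) + 2 * (a + a * l) + 10) s (fun s' =>
    tps s' j = st (nseq (a * l) true) 0 /\ fr [:: j] s s').
Proof.
move=> Wi Wj ij eW ei ej; eapply runs_le.
  sq (runs_mv _ _ _); move=> s1 [i1 F1].
  have {}i1 : tps s1 i = st (nseq a true) 1 by rewrite i1 ei.
  sq (runs_mv _ _ _); move=> s2 [j2 F2].
  have {}j2 : tps s2 j = st [::] 1 by rewrite j2 (fr_tps F1) ?ej ?st_nil //; dist.
  pose J k s' := [/\ tps s' i = st (nseq a true) (a - k).+1, k <= a,
    tps s' W = st (nseq l true) 0,
     tps s' j = st (nseq ((a - k) * l) true) ((a - k) * l).+1 & fr [:: W; i;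
       j] s s'].
  eapply runs_Seq.
    lst (@runs_loop _ _ blank nb x (nb_ i) _ (5 * l + 8) J a).
    - by move=> k s' [e' hk _ _ _]; rewrite (look_nb x e') size_nseq; move: hk;
      clear; lia.
    - by move=> s' [e' hk _ _ _]; rewrite (look_nb x e') size_nseq subn0 ltnn andbF.
    - move=> k s' [e' hk W' j' F]; eapply runs_le.
        sq (runs_mv _ _ _); move=> s3 [W3 F3].
        have {}W3 : tps s3 W = st (nseq l true) 1 by rewrite W3 W'.
        set b := (a - k.+1) * l in j'.
        pose J2 m s' := [/\ tps s' W = st (nseq l true) (l - m).+1, m <= l,
          tps s' j = st (nseq (b + (l - m)) true) (b + (l - m)).+1 & fr [:: W;
            j] s3 s'].
        eapply runs_Seq.
          lst (@runs_loop _ _ blank nb x (nb_ W) _ 2 J2 l).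
          + by move=> m s4 [e4 hm _ _]; rewrite (look_nb x e4) size_nseq; move: hm;
            clear; lia.
          + by move=> s4 [e4 hm _ _]; rewrite (look_nb x e4) size_nseq subn0 ltnn
            andbF.
          + move=> m s4 [e4 hm j4 F4]; eapply runs_le.
              sq (runs_append_true j4); move=> s5 [j5 F5].
              have W5 : tps s5 W = st (nseq l true) (l - m.+1).+1 by keep.
              lst (runs_mv _ _ _); move=> s6 [W6 F6]; exists m => //.
              have E : (l - m.+1).+1 = l - m by rewrite -subSn.
              split; [by rewrite W6 W5 E|exact: ltnW| |by frs].
              by rewrite (fr_tps F6) ?j5 ?addnS -?E ?addnS //; dist.
            by [].
          + split; rewrite ?subnn ?addn0 //; first by keep.
          + by move=> s4 h; exact: h.
        move=> s4 [W4 _ j4 F4]; rewrite subn0 in W4 j4.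
        have hl : l.+1 <= (size (nseq l true)).+1 by rewrite size_nseq.
        have C := @runs_rewind _ _ t0 nb x _ _ _ _ W4 hl; rewrite size_nseq in C.
        sq C; move=> s5 [W5 F5].
        have i5 : tps s5 i = st (nseq a true) (a - k.+1).+1 by keep.
        lst (runs_mv _ _ _); move=> s6 [i6 F6]; exists k => //.
        have E : a - k = (a - k.+1).+1 by rewrite -subSn.
        split; [by rewrite i6 i5 E|exact: ltnW|by keep| |by frs].
        rewrite E mulSn addnC -/b; keep.
      by clear; lia.
    - by split; rewrite ?subnn //; [keep|keep|frs].
    - by move=> s' h; exact: h.
  move=> s3 [i3 _ W3 j3 F3]; rewrite subn0 in i3 j3.
  have h3 : a.+1 <= (size (nseq a true)).+1 by rewrite size_nseq.
  have C := @runs_rewind _ _ t0 nb x _ _ _ _ i3 h3; rewrite size_nseq in C.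
  sq C; move=> s4 [i4 F4].
  have j4 : tps s4 j = st (nseq (a * l) true) (a * l).+1 by keep.
  have h4 : (a * l).+1 <= (size (nseq (a * l) true)).+1 by rewrite size_nseq.
  lst (runs_rewind j4 h4); move=> s5 [j5 F5]; split=> //.
  apply: (@fr_drop _ _ _ W); last by rewrite eW; keep.
  apply: (@fr_drop _ _ _ i); last by rewrite ei; keep.
  by apply: fr_back F5 _ (fr_back F4 _ (fr_sub F3 _)); subs.
by rewrite size_nseq; clear; lia.
Qed.

(** The string written is [bits 0], the number of the output gate, where the game starts. *)
Definition put_false (G : I) := Seq (mv G GoRight) (Seq (app G (fun=> false))
  (rewind G)).

Lemma runs_put_false G s : tps s G = blank0 ->
  runs (put_false G) 6 s (fun s' => tps s' G = st [:: false] 0 /\ fr [:: G] s s').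
Proof.
move=> e; eapply runs_le.
  sq (runs_mv _ _ _); move=> s1 [e1 F1].
  have {}e1 : tps s1 G = st [::] 1 by rewrite e1 e st_nil.
  sq (runs_app (fun=> false) e1); move=> s2 [e2 F2].
  lst (runs_rewind e2 (leqnn _)); move=> s3 [e3 F3]; split=> //; frs.
by [].
Qed.

End Setup.

Arguments runs_add_ones {I T t0 nb x i} c {s n}.
Arguments runs_mul_ones {I T t0 nb x W i j s a l}.
Arguments runs_put_false {I T t0 nb x G s}.

(** * Preparing the length bound and the start of the game *)

Section Prepare.

Variables (D : ratm) (K nb : nat).
Notation I := (tid D K).
Notation T := (dT D).
Notation t0 := (d0 D).
Notation sym := (sym T).
Notation blank := (blank t0).
Notation blank0 := (blank0 t0).
Notation st := (st t0).
Notation store := (store I sym).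
Notation frag := (frag I sym).
Variable x : seq bool.
Notation runs := (@runs I sym blank nb x).
Notation Skip := (Skip I sym).
Notation G v := (tix K v (rG D)).
Notation N v := (tix K v (rU D)).
Notation env := (@env D K).
Notation node_frame := (@node_frame D K).
Notation fresh := (@fresh D K).

(** Tape [N 0] holds [l] and tape [N j.+1] receives [l ^ j], all in unary. *)
Fixpoint powers k : frag :=
  if k is k'.+1 then Seq (powers k') (mul_ones t0 (N 0) (N k) (N k.+1))
  else add_ones t0 (N 1) 1.

Fixpoint powers_time l k := if k is k'.+1 then
    powers_time l k' + (l ^ k' * (5 * l + 10) + 2 * (l ^ k' + l ^ k' * l) + 10)
  else 20.

Lemma fresh_frm lo hi s s' i : node_frame lo hi s s' -> hi <= i -> i <= K ->
  tps s' (N i) = tps s (N i).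
Proof. by move=> [_ t] h1 h2; rewrite t // tix1 // h1 orbT. Qed.

Lemma runs_powers k s l : k < K -> tps s (N 0) = st (nseq l true) 0 -> fresh 1 s ->
  runs (powers k) (powers_time l k) s (fun s' => node_frame 1 k.+2 s s' /\
    tps s' (N k.+1) = st (nseq (l ^ k) true) 0).
Proof.
elim: k => [|k IH] hk e0 fs /=.
  have e1 : tps s (N 1) = st (nseq 0 true) 0 by rewrite fs ?tix1 // st_nil.
  eapply runs_le; first by lst (runs_add_ones 1 e1); move=> s' [e F]; split;
    [apply: (frz_frm _ (fr_frz F)); rewrite /= inordK|exact: e].
  by [].
apply: runs_Seq (IH (ltnW hk) e0 fs) _ => s1 [f1 e1].
have n12 : N k.+1 != N k.+2 by apply: tix_neq => //; rewrite ?ltn_eqF // ltnW.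
have n1 : N 0 != N k.+1 by apply: tix_neq => //; exact: ltnW.
have n2 : N 0 != N k.+2 by apply: tix_neq.
have e01 : tps s1 (N 0) = st (nseq l true) 0 by case: f1 => _ ->; rewrite ?tix1.
have b2 : tps s1 (N k.+2) = blank0 by rewrite (fresh_frm f1) // fs // tix1.
lst (runs_mul_ones n1 n2 n12 e01 e1 b2); rewrite expnSr => s2 [e2 F2]; split=> //.
apply: frm_trans f1 _ (leqnSn _); apply: (frz_frm _ (fr_frz F2)).
by rewrite /= inordK ?ltnS ?leqnn.
Qed.

Definition setup k c : frag := Seq (unary_log t0 (N 0)) (Seq (powers k)
  (Seq (add_ones t0 (N k.+1) c) (put_false t0 (G k.+2)))).

Definition setup_time l k c := (10 * l + 10) + (powers_time l k + ((4 * l ^ k + 3 *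
  c + 10) + 6)).

Lemma runs_setup k c : k.+1 < K -> let s := @istore I sym blank (size x) in
  let l := clog (size x) in
  runs (setup k c) (setup_time l k c) s (fun s' => [/\
    env k.+1 (l ^ k + c) l s', fresh k.+3 s' & tps s' (G k.+2) = st [:: false] 0]).
Proof.
move=> hk s l.
have z : size (adr s) = l by rewrite size_nseq.
have fs v : fresh v s by [].
apply: runs_Seq.
  have C := @runs_unary_log I T t0 nb x (N 0) s (leq0n _) erefl erefl;
    rewrite z in C; exact: C.
move=> s1 [F1 e1].
have f1 : node_frame 0 1 s s1 by apply: (frz_frm _ F1); rewrite /= inordK.
have n1 : fresh 1 s1 by apply: frm_fresh f1 (fs 0).
apply: runs_Seq (runs_powers (ltnW hk) e1 n1) _ => s2 [f2 e2].
have n2 : fresh k.+2 s2 by apply: frm_fresh f2 n1.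
apply: runs_Seq (runs_add_ones c e2) _ => s3 [e3 F3].
have f3 : node_frame k.+1 k.+2 s2 s3.
  by apply: (frz_frm _ (fr_frz F3)); rewrite /= inordK ?ltnS ?leqnn // ltnW.
have n3 : fresh k.+2 s3 by move=> i h; case: f3 => _ ->; rewrite ?h ?orbT // n2.
have b3 : tps s3 (G k.+2) = blank0 by rewrite n3 // tix1.
lst (runs_put_false b3); move=> s4 [e4 F4].
have f4 : node_frame k.+2 k.+3 s3 s4.
  by apply: (frz_frm _ (fr_frz F4)); rewrite /= inordK ?ltnS ?leqnn.
split=> //; last exact: frm_fresh (leqnSn _) f4 n3.
split.
- by case: F1 f2 f3 f4 => a1 _ [a2 _] [a3 _] [a4 _]; rewrite a4 a3 a2 a1.
- case: f2 f3 f4 => _ t2 [_ t3] [_ t4].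
  by rewrite t4 ?tix1 // t3 ?tix1 // t2 ?tix1 // e1 z.
- by case: f4 => _ ->; rewrite ?tix1 ?ltnSn // ltnW.
Qed.

End Prepare.

(** * Values of gates *)

Lemma fixed_bitsS w n : fixed_bits w.+1 n = rcons (fixed_bits w n./2) (odd n).
Proof.
rewrite /fixed_bits -[w.+1]addn1 iotaD map_cat /= add0n addn1 subnn divn1 cats1.
congr rcons; apply/eq_in_map => i; rewrite mem_iota add0n => /andP[_ hi].
by rewrite -divn2 -divnMA -expnS -subSn.
Qed.

Lemma fixed_bitsK w n : n < 2 ^ w -> bits_val (fixed_bits w n) = n.
Proof.
elim: w n => [|w IH] n; first by case: n.
move=> h; rewrite fixed_bitsS bits_val_rcons IH;
  first by rewrite addnC odd_double_half.
by rewrite -divn2 ltn_divLR // mulnC -expnS.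
Qed.

Lemma bitsK : cancel bits bits_val.
Proof. by move=> n; apply: fixed_bitsK; apply: trunc_log_ltn. Qed.

Lemma bits_inj : injective bits. Proof. exact: can_inj bitsK. Qed.

Lemma size_bits n : size (bits n) = (trunc_log 2 n).+1.
Proof. by rewrite size_map size_iota. Qed.

(** The maximum with 1 is for the number 0, whose numeral has one bit although it is below
    [2 ^ 0]. *)
Lemma size_bits_le n k : n < 2 ^ k -> size (bits n) <= maxn k 1.
Proof.
move=> h; rewrite size_bits; case: n h => [|n] h; first by rewrite leq_max orbT.
rewrite leq_max; apply/orP; left; rewrite -(ltn_exp2l _ _ (isT : 1 < 2)).
by apply: leq_ltn_trans h; apply: trunc_logP.
Qed.

(** Every bit is announced by a one and the end by a zero, so this is a prefix code and the
    remainders agree as well. *)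
Lemma self_delimiting_inj a b r r' :
  self_delimiting a ++ r = self_delimiting b ++ r' -> a = b /\ r = r'.
Proof.
rewrite /self_delimiting; elim: a b => [|x a IH] [|y b] //=; first by case.
by case=> -> /IH[-> ->].
Qed.

Lemma query_prefix_inj t t' gu gu' gv gv' r r' :
  query_prefix t gu gv ++ r = query_prefix t' gu' gv' ++ r' ->
  [/\ t = t', gu = gu', gv = gv' & r = r'].
Proof.
rewrite /query_prefix -!catA => /self_delimiting_inj[-> H].
have [-> H'] : t = t' /\ self_delimiting gv ++ r = self_delimiting gv' ++ r'.
  by move: H; case: t; case: t' => //= -[].
by have [-> ->] := self_delimiting_inj H'.
Qed.

Definition query_holds (C : Defs.family) (x : seq bool) gu t gv :=
  DCL_language C (query_prefix t gu gv ++ x).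

Lemma query_holdsP (C : Defs.family) x gu t gv : 0 < size x ->
  query_holds C x gu t gv <->
  exists a : gate (C (size x)), [/\ gu = bits (gateno a), gtype a = t &
    if t is IN then gv = bits (bitno a)
    else exists2 b, b \in children a & gv = bits (gateno b)].
Proof.
move=> x0; split.
  move=> [h [t' [g [z [z0 E [a [ha ta ga]]]]]]].
  have : query_prefix t gu gv ++ x = query_prefix t' (bits h) (bits g) ++ z.
    by rewrite E /encode_tuple /query_prefix -!catA.
  move=> /query_prefix_inj[Et -> -> Ex]; subst z; rewrite -Et in ta ga.
  exists a; rewrite ha ta; split=> //.
  by case: (t) ga => [[b bc <-]|[b bc <-]|[b bc <-]|<-] //; exists b.
move=> [a [-> ta ga]].
have [g [-> Hg]] : exists g, gv = bits g /\ match t with IN => bitno a = g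
    | _ => exists2 b, b \in children a & gateno b = g end.
  by case: t ga {ta} => [[b bc ->]|[b bc ->]|[b bc ->]|->];
    [exists (gateno b)|exists (gateno b)|exists (gateno b)|exists (bitno a)];
      split=> //; exists b.
exists (gateno a), t, g, x; split=> //; last by exists a.
by rewrite /encode_tuple /query_prefix -!catA.
Qed.

(** * Height of gates and existence of a valuation *)

Section Height.

Variable C : circuit.
Implicit Types a b c : gate C.

(** It bounds the paths that end in [a], whereas [depth_le] bounds those that start at a gate. This
    bound drops by one at each child and so serves as the measure for inductions. *)
Definition height_le d a := forall a0 p, path (@edge C) a0 p -> last a0 p = a ->
  size p <= d.

Lemma height_child d a c : height_le d.+1 a -> edge c a -> height_le d c.
Proof.
move=> h e a0 p pp lp; have := h a0 (rcons p a);
  rewrite rcons_path pp lp e size_rcons last_rcons.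
by move=> /(_ isT erefl).
Qed.

Lemma height0 a c : height_le 0 a -> ~~ edge c a.
Proof. by move=> h; apply/negP => e; have := h c [:: a];
  rewrite /= e => /(_ isT erefl). Qed.

Variable x : seq bool.

Definition local_value (v : gate C -> bool) a := match gtype a with
  | IN => nth false x (bitno a)
  | NOT => [exists b in children a, ~~ v b]
  | AND => [forall b in children a, v b]
  | OR => [exists b in children a, v b]
  end.

Lemma eq_local_value v v' a : (forall c, edge c a -> v c = v' c) ->
  local_value v a = local_value v' a.
Proof.
move=> h; rewrite /local_value; case: gtype => //.
- by apply: eq_forallb => c; rewrite inE; case E: (edge c a) => //=; apply: h.
- by apply: eq_existsb => c; rewrite inE; case E: (edge c a) => //=; apply: h.
- by apply: eq_existsb => c; rewrite inE; case E: (edge c a) => //=; rewrite h.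
Qed.

(** Iterates the local rule from the constant false; a gate keeps its value once the number of
    rounds exceeds its height. *)
Fixpoint eval k a : bool := if k is k'.+1 then local_value (eval k') a else false.

Lemma eval_stable k a : height_le k a -> eval k.+1 a = eval k.+2 a.
Proof.
elim: k a => [|k IH] a h; rewrite [LHS]/= [RHS]/=; apply: eq_local_value => c e.
  by move: (height0 c h); rewrite e.
exact: IH (height_child h e).
Qed.

(** Used to get from the outcome of the game back to the circuit, because [outputs1] asks for a
    valuation to exist. *)
Lemma valuation_exists d : depth_le C d -> exists v : gate C -> bool, valuation x v.
Proof.
move=> h; exists (eval d.+1) => a; rewrite -/(local_value _ a) [LHS]/=.
have {}h : height_le d a by move=> a0 p pp _; apply: h pp.
apply: eq_local_value => c e; case: d h => [|d] h.
  by move: (height0 c h); rewrite e.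
exact: eval_stable (height_child h e).
Qed.

End Height.

(** * Certificates and the game on a layered circuit *)

Section Circuit.

Variables (Cf : Defs.family) (x : seq bool) (m d B : nat).
Hypothesis x0 : 0 < size x.
Notation C := (Cf (size x)).
Hypothesis wfC : wf_circuit (size x) C.
Hypothesis depC : depth_le C d.
Hypothesis layC : layered m C.
Hypothesis gateB : forall a : gate C, size (bits (gateno a)) <= B.
Hypothesis bitB : forall i, i < size x -> size (bits i) <= B.
Variable v : gate C -> bool.
Hypothesis vC : valuation x v.

Notation q := (query_holds Cf x).
Notation certified := (certified x B q).
Notation leaf_val := (leaf_val x B q).
Notation winning := (winning x B q).
Notation num a := (bits (gateno a)).

Lemma num_inj : injective (fun a : gate C => num a).
Proof. by case: wfC => -[inj _] _ _ _ _ a b /bits_inj /inj. Qed.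

Lemma q_gate (a : gate C) t g : q (num a) t g <-> gtype a = t /\
    if t is IN then g = bits (bitno a) else exists2 b, b \in children a & g = num b.
Proof.
rewrite query_holdsP //; split; first by move=> [a' [/num_inj <- ? ?]].
by move=> [? ?]; exists a.
Qed.

Lemma leaf_valP (a : gate C) b : leaf_val (num a) b <-> gtype a = IN /\ v a = b.
Proof.
have [_ _ _ _ /(_ a)] := wfC; have := vC a; case E: (gtype a) => va wa; split.
all: try by [move=> [h [_ /q_gate[]]]; rewrite E | case].
  move=> [h [hh /q_gate[_ ->]]]; rewrite bitsK va => /(onth_nth false) ->; by [].
move=> [_ vb]; exists (bits (bitno a)); case: wa => _ lt; split.
- exact: bitB.
- by apply/q_gate.
- by rewrite bitsK onthE (nth_map false) // -va vb.
Qed.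

(** The gate type for which a single child of value [b] forces the value [b]. For [neutral b] all
    the children must have it. *)
Definition absorbing (b : bool) := if b then OR else AND.
Definition neutral (b : bool) := if b then AND else OR.

Lemma absorbingP (a : gate C) b : gtype a = absorbing b ->
  v a = b <-> exists2 c, c \in children a & v c = b.
Proof.
move=> E; have := vC a; rewrite E /absorbing; case: b {E} => ->.
  by split=> [/existsP[c /andP[cc vc]]|[c cc vc]]; [exists c|apply/existsP;
    exists c; rewrite cc vc].
split=> [/negbT|[c cc vc]].
  by rewrite negb_forall => /existsP[c]; rewrite negb_imply => /andP[cc /negPf vc];
    exists c.
by apply/negbTE; rewrite negb_forall; apply/existsP; exists c; rewrite cc vc.
Qed.

Lemma neutralP (a : gate C) b : gtype a = neutral b ->
  v a = b <-> forall c, c \in children a -> v c = b.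
Proof.
move=> E; have := vC a; rewrite E /neutral; case: b {E} => ->.
  by split=> [/forallP h c cc|h]; [have := h c; rewrite cc|apply/forallP => c;
    apply/implyP; exact: h].
split=> [/negbT|h].
  by rewrite negb_exists => /forallP h c cc; apply/negbTE; have := h c; rewrite cc.
by apply/negbTE; rewrite negb_exists; apply/forallP => c;
  apply/negP => /andP[/h ->].
Qed.

(** Induction on the height. A certificate proves the value because a NOT gate has one child and a
    gate of fan-in 2 with two distinct certified children has no others. Conversely, the type of the
    gate and [b] determine which kind of certificate exists. *)
Lemma certifiedP (layer : gate C -> nat) k b a :
  (forall a b, edge b a -> layer b = (layer a).-1) ->
  (forall a, layer a = 0 -> if gtype a is (AND | OR) then #|children a| = 2 else
    true) ->
  layer a = 0 -> height_le k a -> certified k b (num a) <-> v a = b.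
Proof.
move=> layE layF; elim: k b a => [|k IH] b a la ha.
  rewrite /= leaf_valP; split; [by case|move=> va; split=> //].
  (* A gate of height 0 has no children, so it can only be an input gate. *)
  have nc c : c \in children a -> False by rewrite inE => e; move: (height0 c ha);
    rewrite e.
  have [_ _ _ _ /(_ a)] := wfC; case: (gtype a) => //.
  - by move=> /card_gt0P[c /nc].
  - by move=> /card_gt0P[c /nc].
  - by move=> h; have /card_gt0P[c /nc] : 0 < #|children a| by rewrite h.
have IHc c b' : c \in children a -> certified k b' (num c) <-> v c = b'.
  (* The induction stays in layer 0, since the predecessor of 0 is 0. *)
  rewrite inE => e; apply: IH; first by rewrite (layE _ _ e) la.
  exact: height_child ha e.
rewrite /=; split.
  case=> [/leaf_valP[_]|[h [_ /q_gate[E [c cc ->]]]]|[h [_ /q_gate[E hq]]]|].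
  - by [].
  - rewrite IHc // => vc; have := vC a; rewrite E => ->.
    have [_ _ _ _ /(_ a)] := wfC; rewrite E => /eqP/cards1P[c' Ec].
    rewrite Ec in_set1 in cc; rewrite (eqP cc) in vc.
    apply/idP/idP => [/existsP[c2]|hb].
      by rewrite Ec in_set1 => /andP[/eqP ->]; rewrite vc negbK.
    by apply/existsP; exists c'; rewrite Ec in_set1 eqxx vc hb.
  - have {}E : gtype a = absorbing b by rewrite E; case: (b).
    have {hq}[c cc ->] : exists2 c, c \in children a & h = num c by case: (b) hq.
    by rewrite IHc // => vc; apply/(absorbingP E); exists c.
  - move=> [h [h' [_ [/q_gate[E q1] /q_gate[_ q2]] ne v1 v2]]].
    have {}E : gtype a = neutral b by rewrite E; case: (b).
    have {q1} [c cc Eh] : exists2 c, c \in children a & h = num c by case: (b) q1.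
    have {q2} [c' cc' Eh'] : exists2 c, c \in children a & h' = num c by case: (b)
      q2.
    rewrite Eh in v1; rewrite Eh' in v2.
    have {}v1 := proj1 (IHc _ _ cc) v1; have {}v2 := proj1 (IHc _ _ cc') v2.
    apply/(neutralP E) => c2 cc2.
    have card2 : #|children a| = 2 by have := layF a la; rewrite E /neutral;
      case: (b).
    have ncc : c != c' by apply/eqP => Ecc; apply: ne; rewrite Eh Eh' Ecc.
    have sub : [set c; c'] \subset children a.
      by apply/subsetP => z; rewrite !inE => /orP[]/eqP ->; [move: cc|move: cc'];
        rewrite inE.
    have Es : [set c; c'] = children a.
      by apply/eqP; rewrite eqEcard sub card2 cards2 ncc.
    by move: cc2; rewrite -Es !inE => /orP[]/eqP ->.
move=> va; case E: (gtype a).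
- case: b va => va; last first.
    have E' : gtype a = absorbing false by [].
    have [c cc vc] := proj1 (absorbingP E') va.
    apply: Or43; exists (num c); split=> //; first by apply/q_gate; split=> //;
      exists c.
    exact/IHc.
  have := layF a la; rewrite E /= => /eqP/cards2P[c [c' [ncc Ec]]].
  have E' : gtype a = neutral true by [].
  have h := proj1 (neutralP E') va.
  have cc : c \in children a by rewrite Ec !inE eqxx.
  have cc' : c' \in children a by rewrite Ec !inE eqxx orbT.
  apply: Or44; exists (num c), (num c'); split=> //.
  - by split; apply/q_gate; split=> //; [exists c|exists c'].
  - by move=> /num_inj Ecc; rewrite Ecc eqxx in ncc.
  - by apply/IHc => //; apply: h.
  - by apply/IHc => //; apply: h.
- case: b va => va.
    have E' : gtype a = absorbing true by [].
    have [c cc vc] := proj1 (absorbingP E') va.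
    apply: Or43; exists (num c); split=> //; first by apply/q_gate; split=> //;
      exists c.
    exact/IHc.
  have := layF a la; rewrite E /= => /eqP/cards2P[c [c' [ncc Ec]]].
  have E' : gtype a = neutral false by [].
  have h := proj1 (neutralP E') va.
  have cc : c \in children a by rewrite Ec !inE eqxx.
  have cc' : c' \in children a by rewrite Ec !inE eqxx orbT.
  apply: Or44; exists (num c), (num c'); split=> //.
  - by split; apply/q_gate; split=> //; [exists c|exists c'].
  - by move=> /num_inj Ecc; rewrite Ecc eqxx in ncc.
  - by apply/IHc => //; apply: h.
  - by apply/IHc => //; apply: h.
- have [_ _ _ _ /(_ a)] := wfC; rewrite E => /eqP/cards1P[c Ec].
  have cc : c \in children a by rewrite Ec inE.
  apply: Or42; exists (num c); split=> //; first by apply/q_gate; split=> //;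
    exists c.
  apply/IHc => //; rewrite -va (vC a) E.
  apply/idP/idP => [vc|].
    by apply/negP => /existsP[c2]; rewrite Ec in_set1 => /andP[/eqP ->]; rewrite vc.
  by apply: contraR => vc; apply/existsP; exists c; rewrite cc vc.
- by apply: Or41; apply/leaf_valP.
Qed.

(** Induction on the layers. A gate of type [absorbing (~~ w)] has value [~~ w] iff some child has
    it, and by induction these are exactly the children from which the opponent, who needs the value
    [w], does not win. *)
Lemma winningP u r : 0 < m -> r = m.-1 -> gtype (output C) = absorbing (~~ u) ->
  winning u (absorbing (~~ u)) r d [:: false] <-> v (output C) = ~~ u.
Proof.
move=> m0 -> Eo; have [layer [ty [lo ty1 ty2 le lf]]] := layC.
have hd (a : gate C) : height_le d a by move=> a0 p pp _; apply: depC pp.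
have lf0 (a : gate C) : layer a = 0 -> if gtype a is (AND | OR) then #|children a| =
  2 else true.
  by move=> la; have := lf a; rewrite la; case: gtype.
have gen k w (a : gate C) : layer a = k.+1 -> gtype a = absorbing (~~ w) ->
    winning w (absorbing (~~ w)) k d (num a) <-> v a = ~~ w.
  elim: k w a => [|k IH] w a la Ea.
    split=> [[h [_ /q_gate[_ hq]]]|/(absorbingP Ea)[c cc vc]].
      have {hq}[c cc ->] : exists2 c, c \in children a & h = num c by case: (w) hq.
      move=> /(certifiedP _ le lf0 _ (hd c)) vc; apply/(absorbingP Ea);
        exists c => //.
      by apply: vc; rewrite inE in cc; rewrite (le _ _ cc) la.
    exists (num c); split; [by []|by apply/q_gate; split=> //; case: (w);
      exists c|].
    apply/(certifiedP _ le lf0 _ (hd c)) => //.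
    by rewrite inE in cc; rewrite (le _ _ cc) la.
  have child c : c \in children a -> winning (~~ w) (dual (absorbing (~~ w))) k d
    (num c) <-> v c = w.
    rewrite inE => e; have lc : layer c = k.+1 by rewrite (le _ _ e) la.
    have := lf c; rewrite lc => -[km tc]; have := lf a; rewrite la => -[km' ta].
    have Ed : dual (absorbing (~~ w)) = absorbing (~~ ~~ w) by case: (w).
    rewrite Ed IH //; first by rewrite negbK.
    (* Layers are numbered towards the output, so the type of [a] is the dual of that of [c].
       Dualizing twice gives the type of [c] back because it is AND or OR. *)
    rewrite tc -Ed -Ea ta (ty2 k.+1) //.
    by case: (ty1 k.+1) => [|->|->].
  split=> [[h [_ /q_gate[_ hq]]]|/(absorbingP Ea)[c cc vc]].
    have {hq}[c cc ->] : exists2 c, c \in children a & h = num c by case: (w) hq.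
    move=> nw; apply/(absorbingP Ea); exists c => //.
    have : v c <> w by move=> e; apply: nw; exact: (proj2 (child c cc) e).
    by case: (v c); case: (w).
  exists (num c); split; [by []|by apply/q_gate; split=> //; case: (w); exists c|].
  by move=> /(proj1 (child c cc)); rewrite vc; case: (w).
have Eo0 : num (output C) = [:: false] by case: wfC => -[_ ->].
by rewrite -Eo0; apply: gen => //; rewrite lo prednK.
Qed.

End Circuit.

(** * Running time and conclusion *)

(** The base [l.+1] is positive, so exponents can be raised freely and constants are covered at
    [l = 0] too. *)
Definition poly_bounded (f : nat -> nat) :=
  exists a e, forall l, f l <= a * l.+1 ^ e.

Lemma poly_const c : poly_bounded (fun=> c).
Proof. by exists c, 0 => l; rewrite muln1. Qed.

Lemma poly_id : poly_bounded id.
Proof. by exists 1, 1 => l; rewrite mul1n expn1. Qed.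

Lemma poly_add f g : poly_bounded f -> poly_bounded g -> poly_bounded (fun l =>
  f l + g l).
Proof.
move=> [a [e h]] [a' [e' h']]; exists (a + a'), (e + e') => l.
rewrite mulnDl; apply: leq_add.
  by apply: leq_trans (h l) _; rewrite leq_mul // leq_pexp2l // leq_addr.
by apply: leq_trans (h' l) _; rewrite leq_mul // leq_pexp2l // leq_addl.
Qed.

Lemma poly_mul f g : poly_bounded f -> poly_bounded g -> poly_bounded (fun l =>
  f l * g l).
Proof.
move=> [a [e h]] [a' [e' h']]; exists (a * a'), (e + e') => l.
by rewrite expnD mulnACA; apply: leq_mul.
Qed.

Lemma poly_succ f : poly_bounded f -> poly_bounded (fun l => (f l).+1).
Proof.
move=> h; have [a [e H]] := poly_add h (poly_const 1).
by exists a, e => l; rewrite -addn1.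
Qed.

Lemma poly_exp f k : poly_bounded f -> poly_bounded (fun l => f l ^ k).
Proof.
move=> h; elim: k => [|k IH]; first exact: (poly_const 1).
have [a [e H]] := poly_mul h IH.
by exists a, e => l; rewrite expnS.
Qed.

Ltac poly := repeat first
  [ assumption | exact: poly_id | apply: poly_const | apply: poly_add
  | apply: poly_succ | apply: poly_exp | apply: poly_mul ].

Lemma poly_powers k : poly_bounded (fun l => powers_time l k).
Proof. by elim: k => [|k IH] /=; poly. Qed.

Lemma poly_core f g h : poly_bounded f -> poly_bounded g -> poly_bounded h ->
  poly_bounded (fun l => core_time (f l) (g l) (h l)).
Proof. by move=> *; rewrite /core_time; poly. Qed.

Lemma poly_vread f g h : poly_bounded f -> poly_bounded g -> poly_bounded h ->
  poly_bounded (fun l => vread_time (f l) (g l) (h l)).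
Proof.
move=> pf pg ph; rewrite /vread_time.
have ph' := poly_succ ph; have c := poly_core pf pg ph'; poly.
Qed.

Section Time.

Variables (B am smax : nat -> nat).
Hypotheses (pB : poly_bounded B) (pa : poly_bounded am) (ps : poly_bounded smax).

Lemma poly_node_time : poly_bounded (fun l => node_time (B l) l (am l) (smax l)).
Proof.
have p4 : poly_bounded (fun l => 4 * B l + 4) by poly.
rewrite /node_time /query_time /init_addr_time /simulate_time.
have v := poly_vread poly_id p4 pa; poly.
Qed.

Lemma poly_leaf_time : poly_bounded (fun l => leaf_time (B l) l (am l) (smax l)).
Proof.
have t := poly_node_time; have v := poly_vread poly_id (poly_const 0) pB.
by rewrite /leaf_time; poly.
Qed.

Lemma poly_check_time d : poly_bounded (fun l =>
  check_time (B l) l (am l) (smax l) d).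
Proof.
by have t := poly_node_time; have t' := poly_leaf_time; elim: d => [|d IH] /=; poly.
Qed.

Lemma poly_lay_time r d : poly_bounded (fun l =>
  lay_time (B l) l (am l) (smax l) r d).
Proof.
by have t := poly_node_time; have t' := poly_check_time d; elim: r => [|r IH] /=;
  poly.
Qed.

End Time.

Lemma leq_expl p q e : p <= q -> p ^ e <= q ^ e.
Proof. by case: e => // e h; rewrite leq_exp2r. Qed.

(** For [n > 1] the logarithm is positive, hence [(clog n).+1 <= 2 * clog n]; this is the origin of
    the factor [2 ^ e]. *)
Lemma poly_clog f : poly_bounded f ->
  exists k c, forall n, 1 < n -> f (clog n) <= c * clog n ^ k.
Proof.
move=> [a [e h]]; exists e, (a * 2 ^ e) => n n1.
apply: leq_trans (h _) _; rewrite -mulnA -expnMn leq_mul // leq_expl //.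
have : 0 < clog n by rewrite /clog up_log_gt0 n1.
by clear; lia.
Qed.

(** Gives a common time bound for the finitely many queries on one input, also where the asymptotic
    bound of the decider does not apply. *)
Lemma bounded_strings B (P : seq bool -> nat -> Prop) :
  (forall g n n', n <= n' -> P g n -> P g n') ->
  (forall g, size g <= B -> exists n, P g n) ->
  exists n, forall g, size g <= B -> P g n.
Proof.
elim: B P => [|B IH] P mono h.
  by have [n hn] := h [::] isT; exists n => -[].
have [|n1 h1] := IH (fun g => P (true :: g)) (fun g => @mono _);
  first by move=> g hg; apply: h.
have [|n2 h2] := IH (fun g => P (false :: g)) (fun g => @mono _);
  first by move=> g hg; apply: h.
have [n0 h0] := h [::] isT.
exists (n0 + (n1 + n2)) => -[|[] g] hg.
- by apply: mono h0; apply: leq_addr.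
- by apply: mono (h1 g hg); rewrite addnCA leq_addr.
- by apply: mono (h2 g hg); rewrite addnA leq_addl.
Qed.

Lemma emb_id (I S : finType) (f : frag I S) : emb (f := f) (p := f) id.
Proof.
move=> s; exists s; split=> // r; case: (fd s r) => [[a k] l].
by rewrite map_id.
Qed.

(** Along a deterministic fragment the claims at entry and exit are equivalent in either kind of
    block, so the preparation only shifts the start of the game. *)
Lemma runs_val (I S : finType) (blank : S) nb x (p : frag I S) t s (Q : store I S ->
  Prop) :
  runs blank nb x p t s Q -> wf s ->
  exists s', [/\ wf s', Q s' & forall f (io : option (fs p) -> option (fs f)) (i :
    'I_nb.+1),
    emb io ->
    (V blank x i (io (Some (fe p))) s <-> V blank x i (io None) s') /\
    (forall r, bnd blank x r i (io None) s' -> bnd blank x (t + r) i (io (Some (fe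
      p))) s)].
Proof.
move=> [s' h q] w; exists s'.
have w' : wf s' by have [_ e] := h false; case: (e w).
split=> // f io i em; have [d e] := h (odd i).
have [d1 d2] := d w f io i em erefl; have [_ e1] := e w; split; last first.
  by move=> r b; apply: d2 => s2 _ <-.
by split=> [/d1[s2 [_ <- v]]|] //; apply: e1.
Qed.

(** The machine has to start in an existential state. If the game opens with a universal move, an
    immediate tick leaves an existential block without choices in front of it. *)
Definition start_in (I S : finType) (u : bool) (p : frag I S) : frag I S :=
  if u then Seq (Tick I S) p else p.

Lemma start_in_correct (I S : finType) (blank : S) nb x u (p f : frag I S) s
    (io : option (fs (start_in u p)) -> option (fs f)) :
  emb io -> wf s -> u <= nb ->
  exists (io' : option (fs p) -> option (fs f)) (i : 'I_nb.+1),
  [/\ emb io', i = u :> nat,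
    V blank x (ord0 : 'I_nb.+1) (io (Some (fe _))) s <->
      (if u then ~ V blank x i (io' (Some (fe p))) s
       else V blank x i (io' (Some (fe p))) s) &
    forall t, bnd blank x t i (io' (Some (fe p))) s ->
      bnd blank x t.+1 (ord0 : 'I_nb.+1) (io (Some (fe _))) s].
Proof.
case: u io => io em w nb0; last first.
  exists io, ord0; split=> // t; exact: bounded_leq.
have em1 := emb_seq1 em; have em2 := emb_seq2 em.
eexists; exists (inord 1); split; first exact: em2.
- by rewrite inordK.
- by have := V_Tick blank x (i := ord0) em1 w nb0.
- by move=> t b; exact (bnd_Tick (i := ord0) em1 w nb0 b).
Qed.

(** * The machine for a circuit family *)

Section Final.

Variables (u : bool) (m : nat) (C : Defs.family) (L : language).
Hypothesis m0 : 0 < m.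
Hypothesis wfC : forall n, 0 < n -> wf_circuit n (C n).
Variable d : nat.
Hypothesis depC : forall n, 0 < n -> depth_le (C n) d.
Hypothesis layC : forall n, 0 < n -> layered m (C n).
Hypothesis outC : forall n, 0 < n -> gtype (output (C n)) = absorbing (~~ u).
Hypothesis compC : computes C L.
Variables (k c : nat).
Hypothesis gateB : forall n, 0 < n ->
  forall a : gate (C n), size (bits (gateno a)) <= clog n ^ k + c.
Hypothesis bitB : forall n i, i < n -> size (bits i) <= clog n ^ k + c.
Variables (D : ratm) (kt : nat).
Hypothesis decD : decides D (DCL_language C).
Hypothesis timeD : runs_in_time D (fun n => clog n ^ kt).

(* k and c bound the lengths of the gate numbers, c taking care of the small n. *)
Let K := k + m + nodes d + 10.
(** Block numbers start from 0, so there are [nb.+1 = m + u] of them. *)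
Let nb := m.-1 + u.
(** The nodes below [base] carry the unary counters for [l] and for [l ^ 0] up to [l ^ k], the last
    one increased by [c]; node [base] carries the number of the output gate. *)
Let base := k.+2.
Let r := m.-1.

Let layers := lay D K k.+1 u (absorbing (~~ u)) r base d.

Definition program : frag (tid D K) (sym (dT D)) :=
  Seq (setup D K k c) (start_in u layers).

Definition machine := mk (blank (d0 D)) nb program.

Definition Bl l := l ^ k + c.
Definition aml l := l + 4 * Bl l + 4.

Definition total_time smax l :=
  setup_time l k c + (lay_time (Bl l) l (aml l) smax r d).+1.

Definition query_steps (x : seq bool) smax gu t gv :=
  exists n (c' : config D), [/\ n <= smax,
    nsteps (query_prefix t gu gv ++ x) n (init D (query_prefix t gu gv ++ x)) c',
    halted (query_prefix t gu gv ++ x) c' & (final c' <-> query_holds C x gu t gv)].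

(** The prefix has length at most [4 * B + 4], which is less than [2 ^ (4 * B + 4)], and
    [size x <= 2 ^ clog (size x)]; the sum of the two lengths is at most the product of these
    powers. *)
Lemma size_query_bound x gu t gv B : 0 < size x -> size gu <= B -> size gv <= B ->
  clog (size (query_prefix t gu gv ++ x)) <= clog (size x) + 4 * B + 4.
Proof.
move=> x0 hu hv; rewrite -(addnA (clog _)); apply: up_log_min => //.
rewrite size_cat size_query_prefix expnD.
have := up_logP (size x) (isT : 1 < 2); rewrite -/(clog _).
have := ltn_expl (4 * B + 4) (isT : 1 < 2).
have : 0 < 2 ^ clog (size x) by rewrite expn_gt0.
move: hu hv (size x) (2 ^ clog (size x)) (2 ^ (4 * B + 4)) => hu hv n X Y X0 hY hX.
apply: leq_trans _ (leq_mul (leqnn X) hY); rewrite mulnS.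
by have := leq_pmull (4 * B + 4) X0; move: hu hv hX; clear; lia.
Qed.

(** The machine does not depend on [smax]. With a bound that exists for the given input this yields
    correctness at every length, and with the polylogarithmic bound the running time on long
    inputs. *)
Lemma machine_correct x smax : 0 < size x ->
  (forall gu t gv, size gu <= Bl (clog (size x)) -> size gv <= Bl (clog (size x)) ->
     query_steps x smax gu t gv) ->
  (L x <-> accepting x (init machine x)) /\
  bounded x (total_time smax (clog (size x))) (init machine x).
Proof.
move=> x0 hs; set l := clog (size x); set B := Bl l.
have hx : size x <= 2 ^ l by apply: up_logP.
have oracle gu t gv : size gu <= B -> size gv <= B ->
    let w := query_prefix t gu gv ++ x in
    clog (size w) <= aml l /\
    exists n (c' : config D), [/\ n <= smax, nsteps w n (init D w) c', halted w c' &
    (final c' <-> query_holds C x gu t gv)].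
  by move=> hu hv w; split; [exact: size_query_bound|exact: hs].
rewrite init_cfg; set s0 := istore _ _ _.
have kK : k.+1 < K by rewrite /K; clear; lia.
have kb : 0 < k.+1 < base by rewrite /base ltnSn.
have w0 : wf s0 by [].
have [s1 [w1 [e1 n1 g1] H]] := runs_val (runs_setup D nb x c kK) w0.
have hK : base.+2 + r + nodes d <= K.+1 by rewrite /base /K /r; move: m0; clear;
  lia.
have gB : size [:: false] <= B.
  have := gateB x0 (output (C (size x))).
  by case: (wfC x0) => -[_ ->].
have detD : deterministic D by case: decD.
have em := @emb_id _ _ program.
have [H1 H2] := H program _ ord0 (emb_seq1 em).
have win v : valuation x v ->
    winning x B (query_holds C x) u (absorbing (~~ u)) r d [:: false] <->
    v (output (C (size x))) = ~~ u.
  by move=> hv; apply: (winningP x0 (wfC x0) (depC x0) (layC x0)) => //;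
    [exact: gateB|exact: bitB|exact: outC].
have unb : u <= nb by rewrite /nb leq_addl.
have [io' [i [em' iu Vs bs]]] := start_in_correct (blank (d0 D)) x (emb_seq2 em) w1
  unb.
have oi : odd i = u by rewrite iu; case: (u).
have ir : i + r <= nb by rewrite iu addnC.
have [L1 L2] := lay_correct detD kb hx oracle em' oi ir w1 e1 n1 (leqnn _) hK gB g1.
split; last first.
  by apply: H2; apply: bs.
(* Block 0 is existential, so the claim there is acceptance itself. *)
have -> : accepting x (cfg (blank (d0 D)) (ord0 : 'I_nb.+1) (Some (fe program)) s0)
  <->
    V (blank (d0 D)) x (ord0 : 'I_nb.+1) (Some (fe program)) s0 by [].
rewrite H1 Vs compC //.
have WV v hv := iff_trans L1 (win v hv).
move: (V (blank (d0 D)) x i _ s1) WV => Pv WV; split.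
- move=> [v hv vo]; have := WV v hv; rewrite vo.
  by case: (u) => h; [move/h|apply/h].
- move=> acc; have [v hv] := valuation_exists x (depC x0); exists v => //.
  move: acc; have := WV v hv; case: (u) => h.
    by move=> nv; apply/negPn/negP => /negbTE /h.
  by move/h.
Qed.

Lemma machine_blocks x s b (cf : config machine) : run x s b cf -> b <= m + u.
Proof.
move=> /run_blocks h; apply: leq_trans h _; apply: leq_trans (ltn_ord (cf_state
  cf).1) _.
by rewrite /nb -addSn prednK.
Qed.

Lemma steps_exist x : 0 < size x -> exists smax, forall gu t gv,
  size gu <= Bl (clog (size x)) -> size gv <= Bl (clog (size x)) -> query_steps x
    smax gu t gv.
Proof.
move=> x0; set B := Bl _.
have mono gu t gv n n' : n <= n' -> query_steps x n gu t gv -> query_steps x n' gu t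
  gv.
  by move=> h [n1 [c' [le ? ? ?]]]; exists n1, c'; split=> //; apply: leq_trans h.
have [||n hn] := @bounded_strings B (fun gu n =>
  forall t gv, size gv <= B -> query_steps x n gu t gv).
- by move=> gu n n' h H t gv hv; apply: mono h (H t gv hv).
- move=> gu hu.
  have one t : exists n, forall gv, size gv <= B -> query_steps x n gu t gv.
    apply: bounded_strings => [gv|gv hv]; first exact: mono.
    have w0 : 0 < size (query_prefix t gu gv ++ x) by rewrite size_cat
      size_query_prefix; clear; lia.
    have [_ dec] := decD; have [n [b [c' [rn [hc fc]]]]] := dec _ w0.
    exists n, n, c'; split=> //; first exact: run_nsteps rn.
    by rewrite /query_holds fc.
  have [n1 h1] := one AND; have [n2 h2] := one OR; have [n3 h3] := one NOT;
    have [n4 h4] := one IN.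
  exists (n1 + n2 + n3 + n4) => -[] gv hv.
  - by apply: mono (h1 _ hv); clear; lia.
  - by apply: mono (h2 _ hv); clear; lia.
  - by apply: mono (h3 _ hv); clear; lia.
  - by apply: mono (h4 _ hv); clear; lia.
by exists n => gu t gv hu hv; apply: hn.
Qed.

(** The decider runs on a string that is longer than [x], hence beyond its threshold whenever [x]
    is, and whose logarithm is at most [aml (clog n)]. *)
Lemma steps_plog : eventually (fun n => forall x gu t gv, size x = n -> 0 < n ->
  size gu <= Bl (clog n) -> size gv <= Bl (clog n) ->
  query_steps x (aml (clog n) ^ kt) gu t gv).
Proof.
have [n0 h0] := timeD; exists n0 => n hn x gu t gv Ex x0 hu hv; subst n.
have w0 : 0 < size (query_prefix t gu gv ++ x) by rewrite size_cat
  size_query_prefix; clear; lia.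
have [_ dec] := decD; have [n [b [c' [rn [hc fc]]]]] := dec _ w0.
exists n, c'; split=> //; [|exact: run_nsteps rn|by rewrite /query_holds fc].
apply: leq_trans (h0 _ _ _ _ _ _ erefl rn) _.
  by apply: leq_trans hn _; rewrite size_cat leq_addl.
by apply: leq_expl; exact: size_query_bound.
Qed.

Lemma poly_total : poly_bounded (fun l => total_time (aml l ^ kt) l).
Proof.
have pB : poly_bounded Bl by rewrite /Bl; poly.
have pa : poly_bounded aml by rewrite /aml; poly.
have ps : poly_bounded (fun l => aml l ^ kt) by poly.
have t := poly_lay_time pB pa ps r d; have p := poly_powers k.
by rewrite /total_time /setup_time; poly.
Qed.

Lemma SigmaPlog_machine : SigmaPlog (m + u) L.
Proof.
exists machine; split.
- by [].
- by move=> x x0; have [smax hs] := steps_exist x0; case: (machine_correct x0 hs).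
- have [e [a ha]] := poly_clog poly_total; have [n0 h0] := steps_plog.
  exists e, a, (maxn n0 2) => n; rewrite geq_max => /andP[hn n2] x Ex Lx; subst n.
  have x0 : 0 < size x by apply: ltnW.
  have [A1 A2] := machine_correct x0 (fun gu t gv => h0 _ hn x gu t gv erefl x0).
  by apply: bounded_accepting (bounded_leq (ha _ n2) A2) _; apply/A1.
- by move=> x s b cf _; exact: machine_blocks.
Qed.

End Final.

(** The constant [c] takes the maximum over the finitely many lengths below the threshold. Raising
    the exponent to [kk.+1] makes room for the bit positions, which take up to [clog n] bits even if
    [kk = 0]. *)
Lemma gate_bits_bound (C : Defs.family) kk : eventually (fun n =>
    forall a : gate (C n), gateno a < 2 ^ (clog n ^ kk)) ->
  exists c, (forall n, 0 < n -> forall a : gate (C n),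
    size (bits (gateno a)) <= clog n ^ kk.+1 + c) /\
    forall n i, i < n -> size (bits i) <= clog n ^ kk.+1 + c.
Proof.
move=> [n0 h0]; set n1 := maxn n0 2.
exists ((\max_(n < n1) \max_(a : gate (C n)) size (bits (gateno a))) + 1); split.
  move=> n n_gt0 a; case: (ltnP n n1) => hn.
    rewrite addnCA; apply: leq_trans (leq_addr _ _).
    apply: leq_trans (leq_bigmax (Ordinal hn)).
    exact: (leq_bigmax (F := fun a : gate (C n) => size (bits (gateno a))) a).
  move: hn; rewrite geq_max => /andP[hn n2].
  have l0 : 0 < clog n by rewrite /clog up_log_gt0 n2.
  apply: leq_trans (size_bits_le (h0 n hn a)) _.
  have := leq_pexp2l l0 (leqnSn kk).
  by move: (clog n ^ kk) (clog n ^ kk.+1) => p q; clear; lia.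
move=> n i hi.
have hi2 : i < 2 ^ clog n by apply: leq_trans hi _; apply: up_logP.
apply: leq_trans (size_bits_le hi2) _.
have : clog n <= clog n ^ kk.+1.
  by case: (clog n) => // l; rewrite -{1}[l.+1]expn1 leq_pexp2l.
by move: (clog n ^ kk.+1) (clog n) => p q; clear; lia.
Qed.

Lemma qAC0m_SigmaPlog (u : bool) m (L : language) (C : Defs.family) : 0 < m ->
  qAC0m m C -> (forall n, 0 < n -> gtype (output (C n)) = absorbing (~~ u)) ->
  computes C L -> SigmaPlog (m + u) L.
Proof.
move=> m0 [[wfC [kk [n0 hk]] [d hd] [D [kt [decD timeD]]]] lay] hout comp.
have [|c [hc1 hc2]] := @gate_bits_bound C kk.
  by exists n0 => n /hk[].
exact: (SigmaPlog_machine m0 wfC hd lay hout comp hc1 hc2 decD timeD).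
Qed.

Theorem lemma13 (m : nat) (hm : 1 <= m) :
  [/\ forall L : language, ExistsqAC0 m L -> SigmaPlog m L,
      forall L : language, ForallqAC0 m L -> SigmaPlog m.+1 L,
      forall (V : vocabulary) (q : query V),
        query_in (ExistsqAC0 m) q -> query_in (SigmaPlog m) q
    & forall (V : vocabulary) (q : query V),
        query_in (ForallqAC0 m) q -> query_in (SigmaPlog m.+1) q].
Proof.
have ex L : ExistsqAC0 m L -> SigmaPlog m L.
  by move=> [C [qC oC] cC]; rewrite -[m]addn0;
    exact: (qAC0m_SigmaPlog (u := false) hm qC oC cC).
have al L : ForallqAC0 m L -> SigmaPlog m.+1 L.
  by move=> [C [qC oC] cC]; rewrite -addn1; exact: (qAC0m_SigmaPlog (u := true) hm
    qC oC cC).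
split=> //.
  by move=> V q [L kL qL]; exists L => //; exact: ex.
by move=> V q [L kL qL]; exists L => //; exact: al.
Qed.
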